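(* Over GBC, the following are equivalent. (1) ${\rm Ord}$ is subtle. (2) Every logic has a stationary class of weak compactness cardinals.
   Context: GBC is Gödel–Bernays set theory with global choice (a class well-ordering of the universe). ${\rm Ord}$ is subtle if for every class club $C\subseteq{\rm Ord}$ and every class sequence $\langle A_\alpha:\alpha\in{\rm Ord}\rangle$ with $A_\alpha\subseteq\alpha$, there are $\alpha<\beta$ in $C$ with $A_\alpha=A_\beta\cap\alpha$. A class of ordinals is stationary if it meets every class club. A logic $(\mathcal{L},\vDash_\mathcal{L})$ assigns to each language $\tau$ a set $\mathcal{L}(\tau)$ of sentences with a satisfaction relation, satisfying monotonicity in $\tau$, reduct-invariance, isomorphism invariance, the renaming property, and having an occurrence number $o(\mathcal{L})$ (least cardinal $\mu$ such that every sentence uses fewer than $\mu$ symbols). A cardinal $\kappa$ is a weak compactness cardinal for $\mathcal{L}$ if every $\mathcal{L}$-theory of size $\kappa$ all of whose subsets of size ${<}\kappa$ have models, has a model. *)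

(* Defs.v *)
(* "GBC proves (1) <-> (2)" is rendered semantically:
   the equivalence holds in every (classical, two-sorted) model of GBC.  All
   set-theoretic notions below are the internal ones of such a model. *)

Class Universe : Type := {
  V : Type;                    (* the sets *)
  Cls : Type;                  (* the classes *)
  mem : V -> V -> Prop;
  cmem : V -> Cls -> Prop
}.

Notation "x ∈ y" := (mem x y) (at level 70, no associativity).
Notation "x ∉ y" := (~ mem x y) (at level 70, no associativity).

(* Sets and classes are read as predicates on sets, so that one definition of
   "function", "bijection", etc. serves both; [X x] says that x belongs to X. *)
Definition set_ext {U : Universe} (a : V) : V -> Prop := fun x => x ∈ a.
Definition cls_ext {U : Universe} (X : Cls) : V -> Prop := fun x => cmem x X.
Coercion set_ext : V >-> Funclass.
Coercion cls_ext : Cls >-> Funclass.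

(* First-order formulas quantifying over sets only, with de Bruijn variables
   ranging over sets, and with class parameters. *)
Inductive fml {U : Universe} : Type :=
| FEq (i j : nat)
| FMem (i j : nat)
| FCls (i : nat) (X : Cls)
| FBot
| FImp (p q : fml)
| FAnd (p q : fml)
| FOr (p q : fml)
| FAll (p : fml)
| FEx (p : fml).

Definition scons {A : Type} (x : A) (e : nat -> A) : nat -> A :=
  fun n => match n with O => x | S m => e m end.

Fixpoint sat {U : Universe} (e : nat -> V) (p : fml) : Prop :=
  match p with
  | FEq i j => e i = e j
  | FMem i j => e i ∈ e j
  | FCls i X => X (e i)
  | FBot => False
  | FImp p q => sat e p -> sat e q
  | FAnd p q => sat e p /\ sat e q
  | FOr p q => sat e p \/ sat e q
  | FAll p => forall x, sat (scons x e) p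
  | FEx p => exists x, sat (scons x e) p
  end.

Section SetTheory.
Context {U : Universe}.

Definition is_empty (e : V) : Prop := forall x, x ∉ e.

Definition is_upair (z x y : V) : Prop := forall w, w ∈ z <-> w = x \/ w = y.

(* Kuratowski pairs: p = {{x}, {x, y}}. *)
Definition is_opair (p x y : V) : Prop :=
  exists a b, is_upair a x x /\ is_upair b x y /\ is_upair p a b.

Definition is_succ (s x : V) : Prop := forall w, w ∈ s <-> w ∈ x \/ w = x.

Definition subset (a b : V) : Prop := forall x, x ∈ a -> x ∈ b.

(* (x, y) belongs to F; for a function F, F(x) = y. *)
Definition app (F : V -> Prop) (x y : V) : Prop := exists p, is_opair p x y /\ F p.

Definition class_well_order (W : Cls) : Prop :=
  (forall x, ~ app W x x) /\
  (forall x y z, app W x y -> app W y z -> app W x z) /\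
  (forall x y, app W x y \/ x = y \/ app W y x) /\
  (forall X : Cls, (exists x, X x) -> exists x, X x /\ forall y, X y -> ~ app W y x).

End SetTheory.

(* Separation and "every set is a class" follow from [replacement] and
   [comprehension]. *)
Record GBC (U : Universe) : Prop := {
  set_extensionality : forall a b : V, (forall x, x ∈ a <-> x ∈ b) -> a = b;
  class_extensionality : forall X Y : Cls, (forall x, X x <-> Y x) -> X = Y;
  comprehension : forall (p : fml) (e : nat -> V),
    exists X : Cls, forall x, X x <-> sat (scons x e) p;
  pairing : forall x y, exists z, is_upair z x y;
  union : forall a, exists u, forall x, x ∈ u <-> exists y, x ∈ y /\ y ∈ a;
  powerset : forall a, exists u, forall x, x ∈ u <-> subset x a;
  infinity : exists w, (exists e, is_empty e /\ e ∈ w) /\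
    (forall x, x ∈ w -> exists s, is_succ s x /\ s ∈ w);
  replacement : forall F : Cls,
    (forall x y z, app F x y -> app F x z -> y = z) ->
    forall a, exists b, forall y, y ∈ b <-> exists x, x ∈ a /\ app F x y;
  foundation : forall X : Cls, (exists x, X x) ->
    exists x, X x /\ forall y, y ∈ x -> ~ X y;
  global_choice : exists W : Cls, class_well_order W
}.

Section Ordinals.
Context {U : Universe}.

(* F is a function with domain D. *)
Definition is_fun (F D : V -> Prop) : Prop :=
  (forall p, F p -> exists x y, is_opair p x y /\ D x) /\
  (forall x, D x -> exists! y, app F x y).

Definition is_bij (f a b : V -> Prop) : Prop :=
  is_fun f a /\
  (forall x y, app f x y -> b y) /\
  (forall y, b y -> exists! x, app f x y).

(* Transitive and linearly ordered by ∈; well-foundedness of ∈ is an axiom. *)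
Definition is_ord (a : V) : Prop :=
  (forall x y, x ∈ a -> y ∈ x -> y ∈ a) /\
  (forall x y, x ∈ a -> y ∈ a -> x ∈ y \/ x = y \/ y ∈ x).

Definition is_limit (a : V) : Prop :=
  is_ord a /\ (exists x, x ∈ a) /\ forall x, x ∈ a -> exists y, y ∈ a /\ x ∈ y.

Definition is_nat (n : V) : Prop :=
  is_ord n /\ ~ is_limit n /\ forall m, m ∈ n -> ~ is_limit m.

Definition equinumerous (a b : V) : Prop := exists f : V, is_bij f a b.

Definition is_cardinal (k : V) : Prop :=
  is_ord k /\ forall a, a ∈ k -> ~ equinumerous a k.

Definition has_card (a k : V) : Prop := is_cardinal k /\ equinumerous a k.

Definition card_lt (a k : V) : Prop := exists l, l ∈ k /\ has_card a l.

Definition club (C : Cls) : Prop :=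
  (forall a, C a -> is_ord a) /\
  (forall a, is_ord a -> exists b, C b /\ a ∈ b) /\
  (forall l, is_limit l ->
     (forall a, a ∈ l -> exists b, C b /\ b ∈ l /\ a ∈ b) -> C l).

Definition stationary (S : Cls) : Prop :=
  (forall a, S a -> is_ord a) /\
  forall C : Cls, club C -> exists a, C a /\ S a.

Definition Ord_subtle : Prop :=
  forall C A : Cls, club C ->
    is_fun A is_ord -> (forall a s, app A a s -> subset s a) ->
    exists a b s t, C a /\ C b /\ a ∈ b /\ app A a s /\ app A b t /\
      forall x, x ∈ s <-> x ∈ t /\ x ∈ a.

(* The signature of an n-ary relation symbol is (0, n), that of an n-ary
   function symbol is (1, n); constants are 0-ary function symbols. *)
Definition rel_sig (t n : V) : Prop :=
  is_nat n /\ exists k, is_empty k /\ is_opair t k n.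

Definition fun_sig (t n : V) : Prop :=
  is_nat n /\ exists e k, is_empty e /\ is_succ k e /\ is_opair t k n.

(* A language is a set function from its symbols to signatures; hence the
   extension relation between languages is [subset]. *)
Definition sym (τ : V) : V -> Prop := fun s => exists t, app τ s t.

Definition is_lang (τ : V) : Prop :=
  is_fun τ (sym τ) /\
  forall s t, app τ s t -> exists n, rel_sig t n \/ fun_sig t n.

Definition is_tuple (n D v : V) : Prop :=
  is_fun v n /\ forall i x, app v i x -> x ∈ D.

(* M is the triple (τ, D, I); a structure carries its language, so that
   reducts to different languages are different objects. *)
Definition is_triple (M τ D I : V) : Prop :=
  exists q, is_opair M τ q /\ is_opair q D I.

Definition is_structure (M τ : V) : Prop :=
  is_lang τ /\
  exists D I, is_triple M τ D I /\ (exists x, x ∈ D) /\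
    is_fun I (sym τ) /\
    forall s t i n, app τ s t -> app I s i ->
      (rel_sig t n -> forall v, v ∈ i -> is_tuple n D v) /\
      (fun_sig t n -> is_fun i (is_tuple n D) /\ forall v x, app i v x -> x ∈ D).

(* For a σ-structure M and a τ-structure N with τ ⊆ σ: N is the reduct of M. *)
Definition is_reduct (N M : V) : Prop :=
  exists τ σ D I J, is_triple N τ D I /\ is_triple M σ D J /\
    forall s i, sym τ s -> (app I s i <-> app J s i).

(* h maps the tuple v pointwise to the tuple w. *)
Definition maps_tuple (h v w : V) : Prop :=
  forall i x y, app v i x -> app w i y -> app h x y.

Definition is_iso (h M N τ : V) : Prop :=
  exists D I E J, is_triple M τ D I /\ is_triple N τ E J /\ is_bij h D E /\
    forall s t i j n, app τ s t -> app I s i -> app J s j ->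
      (rel_sig t n -> forall v w, is_tuple n D v -> is_tuple n E w ->
         maps_tuple h v w -> (v ∈ i <-> w ∈ j)) /\
      (fun_sig t n -> forall v w x y, is_tuple n D v -> is_tuple n E w ->
         maps_tuple h v w -> app i v x -> app j w y -> app h x y).

Definition is_renaming (f τ σ : V) : Prop :=
  is_bij f (sym τ) (sym σ) /\
  forall s s' t, app f s s' -> (app τ s t <-> app σ s' t).

(* For f : τ -> σ a renaming, M a τ-structure, N a σ-structure: N is the
   result of renaming the symbols of M along f. *)
Definition is_renamed (f M N : V) : Prop :=
  exists τ σ D I J, is_triple M τ D I /\ is_triple N σ D J /\
    forall s s' i, app f s s' -> (app I s i <-> app J s' i).

Section Logic.
(* L is the class function τ ↦ L(τ); Sat is the satisfaction relation. *)
Context (L Sat : Cls).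

Definition sentence (τ φ : V) : Prop := exists S, app L τ S /\ φ ∈ S.

Definition bounds_occurrences (m : V) : Prop :=
  forall τ φ, is_lang τ -> sentence τ φ ->
    exists τ0, subset τ0 τ /\ card_lt τ0 m /\ sentence τ0 φ.

Definition occurrence_number (m : V) : Prop :=
  is_cardinal m /\ bounds_occurrences m /\
  forall k, k ∈ m -> is_cardinal k -> ~ bounds_occurrences k.

Record is_logic : Prop := {
  logic_sentences : is_fun L is_lang;
  logic_sat_dom : forall M φ, app Sat M φ ->
    exists τ, is_structure M τ /\ sentence τ φ;
  logic_sat_rel : forall p, Sat p -> exists M φ, is_opair p M φ;
  logic_monotone : forall τ σ φ, is_lang τ -> is_lang σ -> subset τ σ ->
    sentence τ φ -> sentence σ φ;
  logic_reduct : forall τ σ M N φ, subset τ σ ->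
    is_structure M σ -> is_structure N τ -> is_reduct N M -> sentence τ φ ->
    (app Sat M φ <-> app Sat N φ);
  logic_iso : forall τ M N h φ, is_structure M τ -> is_structure N τ ->
    is_iso h M N τ -> sentence τ φ -> (app Sat M φ <-> app Sat N φ);
  logic_renaming : forall τ σ f, is_lang τ -> is_lang σ -> is_renaming f τ σ ->
    exists g : V, is_bij g (sentence τ) (sentence σ) /\
      forall M N φ ψ, is_structure M τ -> is_structure N σ -> is_renamed f M N ->
        app g φ ψ -> (app Sat M φ <-> app Sat N ψ);
  logic_occurrence : exists m, occurrence_number m
}.

Definition is_theory (τ T : V) : Prop := forall φ, φ ∈ T -> sentence τ φ.

Definition has_model (τ T : V) : Prop :=
  exists M, is_structure M τ /\ forall φ, φ ∈ T -> app Sat M φ.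

Definition weak_compactness_cardinal (k : V) : Prop :=
  is_cardinal k /\
  forall τ T, is_lang τ -> is_theory τ T -> has_card T k ->
    (forall T0, subset T0 T -> card_lt T0 k -> has_model τ T0) ->
    has_model τ T.

End Logic.

End Ordinals.

(* Main.v *)
(* From subtlety to compactness: if no element of a club is a weak compactness
   cardinal, attach to each element k a counterexample of size k (or, when k is not
   a cardinal, a bijection with a smaller ordinal).  Since each sentence uses few
   symbols, the symbols of the xi-th sentence can be renamed into a set depending only
   on xi, so that the counterexample becomes a set of data coded by ordinals below k.
   Subtlety gives a < b whose data cohere: the first a sentences for b are, up to
   renaming, the whole counterexample for a, and they have a model because a < b.

   From compactness to subtlety: given a club C and a sequence A, use a logic whose
   sentences describe the type, over C and A, of countable sets of named elements in a
   structure that is well-ordered in some type b in C.  Compactness at a k in C, with an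
   extra element d to be different from all named ones, gives j : k -> b preserving
   these types and missing d.  If j is the identity, then k < b and A_k = A_b ∩ k.
   Otherwise let x be the least ordinal moved.  If x is in C, then A_x = A_{j x} ∩ x.
   If not, j fixes the next element of C, so all iterates of j at x lie below k; let X be
   the set of even iterates and Y = j[X].  The sets X and Y have different tails
   while j[Y] = X - {x} has the tail of X.  A choice of one tail from each pair of
   distinct tails, which is part of the type, is then both preserved and reversed by j. *)

From Stdlib Require Import Classical ClassicalEpsilon Setoid.
From Corelib Require Import ssreflect.
Require Import Defs.

(* Comprehension in GBC is predicative: a class is given by a formula quantifying over sets only.
   Hence every class, minimality argument and recursion rests on a proof of definability, and
   class-sized objects are handled through sets: recursion through set attempts, the choice of a
   tail through the [W]-least member of a proper class of sets.

   Towards compactness, the obstacle is that symbols and sentences are arbitrary sets while subtlety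
   speaks of sets of ordinals. An injection of all possible data into the ordinals repairs this, on
   the club of those k below which the codes of all data from earlier stages remain.

   Towards subtlety, the theory must have size exactly k; so only pairs of countable sets bounded in
   k are described, and k is taken closed under a coding of such pairs. Countable sets occur because
   the iterates of j form one. The tail argument plays the part of Kunen's inconsistency theorem: it
   excludes an embedding with a fixed point above its least moved ordinal. *)
Existing Class GBC.

(** * Definability *)

Section Definability.
Context {U : Universe}.

(* A predicate is a predicate of assignments of sets to variables.  A relation or
   function of several arguments reads them off the variables 0, 1, ..., the value
   of a function coming first. *)
Definition DefP (P : (nat -> V) -> Prop) : Prop := exists p, forall e, sat e p <-> P e.

Definition DefT (t : (nat -> V) -> V) : Prop := DefP (fun e => e 0 = t (fun n => e (S n))).

Definition R1 (R : V -> Prop) : Prop := DefP (fun e => R (e 0)).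
Definition R2 (R : V -> V -> Prop) : Prop := DefP (fun e => R (e 0) (e 1)).
Definition R3 (R : V -> V -> V -> Prop) : Prop := DefP (fun e => R (e 0) (e 1) (e 2)).
Definition R4 (R : V -> V -> V -> V -> Prop) : Prop :=
  DefP (fun e => R (e 0) (e 1) (e 2) (e 3)).
Definition F1 (F : V -> V) : Prop := R2 (fun y x => y = F x).
Definition F2 (F : V -> V -> V) : Prop := R3 (fun z x y => z = F x y).
Definition F3 (F : V -> V -> V -> V) : Prop := R4 (fun z x y w => z = F x y w).

Lemma sat_ext p : forall e e', (forall n, e n = e' n) -> sat e p <-> sat e' p.
Proof.
have Hs e e' (x : V) : (forall n, e n = e' n) -> forall n, scons x e n = scons x e' n.
  by move=> H [|n] /=.
elim: p => /= [i j|i j|i X||p IHp q IHq|p IHp q IHq|p IHp q IHq|p IHp|p IHp] e e' H;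
  rewrite ?H //.
- by rewrite (IHp e e' H) (IHq e e' H).
- by rewrite (IHp e e' H) (IHq e e' H).
- by rewrite (IHp e e' H) (IHq e e' H).
- by split=> Hx x; apply/(IHp _ _ (Hs e e' x H)).
- by split=> -[x Hx]; exists x; apply/(IHp _ _ (Hs e e' x H)).
Qed.

Lemma DefP_iff_ext P Q : (forall e, P e <-> Q e) -> DefP P -> DefP Q.
Proof. by move=> H [p Hp]; exists p => e; rewrite -H. Qed.

Lemma DefP_ren (r : nat -> nat) P : DefP P -> DefP (fun e => P (fun n => e (r n))).
Proof.
move=> [p Hp].
suff [p' Hp'] : exists p', forall e, sat e p' <-> sat (fun n => e (r n)) p.
  by exists p' => e; rewrite Hp'.
have Hr (q : nat -> nat) e (x : V) : forall n,
    scons x e (match n with O => O | S m => S (q m) end) = scons x (fun n => e (q n)) n.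
  by case.
clear Hp P; elim: p r => [i j|i j|i X||p IHp q IHq|p IHp q IHq|p IHp q IHq|p IHp|p IHp] r.
- by exists (FEq (r i) (r j)).
- by exists (FMem (r i) (r j)).
- by exists (FCls (r i) X).
- by exists FBot.
- by case: (IHp r) (IHq r) => p' Hp [q' Hq]; exists (FImp p' q') => e /=; rewrite Hp Hq.
- by case: (IHp r) (IHq r) => p' Hp [q' Hq]; exists (FAnd p' q') => e /=; rewrite Hp Hq.
- by case: (IHp r) (IHq r) => p' Hp [q' Hq]; exists (FOr p' q') => e /=; rewrite Hp Hq.
- case: (IHp (fun n => match n with O => O | S m => S (r m) end)) => p' Hp.
  have E e x : sat (fun n => scons x e match n with O => O | S m => S (r m) end) p
      <-> sat (scons x (fun n => e (r n))) p := sat_ext p _ _ (Hr r e x).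
  by exists (FAll p') => e /=; split=> H x; [apply/E/Hp|apply/Hp/E].
- case: (IHp (fun n => match n with O => O | S m => S (r m) end)) => p' Hp.
  have E e x : sat (fun n => scons x e match n with O => O | S m => S (r m) end) p
      <-> sat (scons x (fun n => e (r n))) p := sat_ext p _ _ (Hr r e x).
  by exists (FEx p') => e /=; split=> -[x H]; exists x; [apply/E/Hp|apply/Hp/E].
Qed.

Lemma DefP_and P Q : DefP P -> DefP Q -> DefP (fun e => P e /\ Q e).
Proof. by move=> [p Hp] [q Hq]; exists (FAnd p q) => e /=; rewrite Hp Hq. Qed.
Lemma DefP_or P Q : DefP P -> DefP Q -> DefP (fun e => P e \/ Q e).
Proof. by move=> [p Hp] [q Hq]; exists (FOr p q) => e /=; rewrite Hp Hq. Qed.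
Lemma DefP_imp P Q : DefP P -> DefP Q -> DefP (fun e => P e -> Q e).
Proof. by move=> [p Hp] [q Hq]; exists (FImp p q) => e /=; rewrite Hp Hq. Qed.
Lemma DefP_false : DefP (fun _ => False).
Proof. by exists FBot. Qed.
Lemma DefP_not P : DefP P -> DefP (fun e => ~ P e).
Proof. by move=> H; apply DefP_imp => //; apply DefP_false. Qed.
Lemma DefP_iff P Q : DefP P -> DefP Q -> DefP (fun e => P e <-> Q e).
Proof. by move=> HP HQ; apply DefP_and; apply DefP_imp. Qed.
(** Classical case distinction: a proposition independent of the assignment is true or false
    outright, so even one that quantifies over classes may occur as a parameter. *)
Lemma DefP_const (P : Prop) : DefP (fun _ => P).
Proof.
case: (classic P) => H; [exists (FImp FBot FBot)|exists FBot] => e /=; tauto.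
Qed.
(** The bound variable stays a separate argument of [Q], so that unification can read [Q] off a goal
    under a binder. *)
Lemma DefP_all (Q : (nat -> V) -> V -> Prop) :
  DefP (fun e => Q (fun n => e (S n)) (e 0)) -> DefP (fun e => forall x, Q e x).
Proof. by move=> [p Hp]; exists (FAll p) => e /=; split=> H x;
  [exact (proj1 (Hp (scons x e)) (H x))|exact (proj2 (Hp (scons x e)) (H x))]. Qed.
Lemma DefP_ex (Q : (nat -> V) -> V -> Prop) :
  DefP (fun e => Q (fun n => e (S n)) (e 0)) -> DefP (fun e => exists x, Q e x).
Proof.
by move=> [p Hp]; exists (FEx p) => e /=; split=> -[x H]; exists x;
  [exact (proj1 (Hp (scons x e)) H)|exact (proj2 (Hp (scons x e)) H)].
Qed.
Lemma DefP_cls_var (X : Cls) i : DefP (fun e => cls_ext X (e i)).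
Proof. by exists (FCls i X). Qed.
Lemma DefP_mem_var i j : DefP (fun e => e i ∈ e j).
Proof. by exists (FMem i j). Qed.
Lemma DefP_eq_var i j : DefP (fun e => e i = e j).
Proof. by exists (FEq i j). Qed.

Lemma DefT_var i : DefT (fun e => e i).
Proof. exact: (DefP_eq_var 0 (S i)). Qed.

Lemma DefT_weak t : DefT t -> DefT (fun e => t (fun n => e (S n))).
Proof.
move=> H.
exact: (DefP_ren (fun n => match n with O => O | S m => S (S m) end) _ H).
Qed.

(** Formulas have no function terms; a definable function is eliminated through
    [exists x, x = t e /\ Q e x]. *)
Lemma DefP_subst (Q : (nat -> V) -> V -> Prop) t :
  DefT t -> DefP (fun e => Q (fun n => e (S n)) (e 0)) -> DefP (fun e => Q e (t e)).
Proof.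
move=> Ht HQ.
apply: (DefP_iff_ext (fun e => exists x, x = t e /\ Q e x)).
  by move=> e; split=> [[x [-> //]]|H]; exists (t e).
by apply DefP_ex; apply DefP_and.
Qed.

Lemma DefP_rel1 R a : R1 R -> DefT a -> DefP (fun e => R (a e)).
Proof.
move=> HR Ha; apply: (DefP_subst (fun _ x => R x)) => //.
Qed.

Lemma DefP_rel2 R a b : R2 R -> DefT a -> DefT b -> DefP (fun e => R (a e) (b e)).
Proof.
move=> HR Ha Hb; apply: (DefP_subst (fun e x => R x (b e))) => //.
apply: (DefP_subst (fun e x => R (e 0) x)); first exact: (DefT_weak _ Hb).
exact: (DefP_ren (fun n => match n with O => 1 | S _ => 0 end) _ HR).
Qed.

Lemma DefP_rel3 R a b c : R3 R -> DefT a -> DefT b -> DefT c -> DefP (fun e => R (a e) (b e) (c e)).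
Proof.
move=> HR Ha Hb Hc; apply: (DefP_subst (fun e x => R x (b e) (c e))) => //.
apply: (DefP_subst (fun e x => R (e 0) x (c (fun n => e (S n))))); first exact: (DefT_weak _ Hb).
apply: (DefP_subst (fun e x => R (e 1) (e 0) x)); first exact: (DefT_weak _ (DefT_weak _ Hc)).
exact: (DefP_ren (fun n => match n with O => 2 | 1 => 1 | _ => 0 end) _ HR).
Qed.

Lemma DefP_rel4 R a b c d : R4 R -> DefT a -> DefT b -> DefT c -> DefT d ->
  DefP (fun e => R (a e) (b e) (c e) (d e)).
Proof.
move=> HR Ha Hb Hc Hd; apply: (DefP_subst (fun e x => R x (b e) (c e) (d e))) => //.
apply: (DefP_subst (fun e x => R (e 0) x (c (fun n => e (S n))) (d (fun n => e (S n)))));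
  first exact: (DefT_weak _ Hb).
apply: (DefP_subst (fun e x => R (e 1) (e 0) x (d (fun n => e (S (S n))))));
  first exact: (DefT_weak _ (DefT_weak _ Hc)).
apply: (DefP_subst (fun e x => R (e 2) (e 1) (e 0) x));
  first exact: (DefT_weak _ (DefT_weak _ (DefT_weak _ Hd))).
exact: (DefP_ren (fun n => match n with O => 3 | 1 => 2 | 2 => 1 | _ => 0 end) _ HR).
Qed.

Lemma DefT_fun1 F a : F1 F -> DefT a -> DefT (fun e => F (a e)).
Proof. by move=> HF Ha; exact (DefP_rel2 (fun y x => y = F x) _ _ HF (DefT_var 0) (DefT_weak _ Ha)). Qed.
Lemma DefT_fun2 F a b : F2 F -> DefT a -> DefT b -> DefT (fun e => F (a e) (b e)).
Proof.
by move=> HF Ha Hb; exact (DefP_rel3 (fun z x y => z = F x y) _ _ _ HF (DefT_var 0) (DefT_weak _ Ha) (DefT_weak _ Hb)).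
Qed.
Lemma DefT_fun3 F a b c : F3 F -> DefT a -> DefT b -> DefT c -> DefT (fun e => F (a e) (b e) (c e)).
Proof.
by move=> HF Ha Hb Hc;
  exact (DefP_rel4 (fun z x y w => z = F x y w) _ _ _ _ HF (DefT_var 0) (DefT_weak _ Ha) (DefT_weak _ Hb) (DefT_weak _ Hc)).
Qed.

Lemma DefP_mem a b : DefT a -> DefT b -> DefP (fun e => a e ∈ b e).
Proof. exact (DefP_rel2 mem _ _ (DefP_mem_var 0 1)). Qed.
Lemma DefP_set_ext a b : DefT a -> DefT b -> DefP (fun e => set_ext (b e) (a e)).
Proof. exact: DefP_mem. Qed.
Lemma DefP_eq a b : DefT a -> DefT b -> DefP (fun e => a e = b e).
Proof. exact (DefP_rel2 (fun x y => x = y) _ _ (DefP_eq_var 0 1)). Qed.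
Lemma DefP_cls (X : Cls) a : DefT a -> DefP (fun e => cls_ext X (a e)).
Proof. exact (DefP_rel1 (fun x => cls_ext X x) _ (DefP_cls_var X 0)). Qed.

Lemma DefP_unique (Q : (nat -> V) -> V -> Prop) :
  DefP (fun e => Q (fun n => e (S n)) (e 0)) -> DefP (fun e => exists! x, Q e x).
Proof.
move=> H; apply DefP_ex; apply DefP_and => //.
apply (DefP_all (fun e y => Q (fun n => e (S n)) y -> e 0 = y)).
apply DefP_imp; last exact: DefP_eq_var.
exact: (DefP_ren (fun n => match n with O => 0 | S m => S (S m) end) _ H).
Qed.

Context {HU : GBC U}.

Lemma inhV : inhabited V.
Proof. by case: (infinity U HU) => w _. Qed.

Lemma comprehend (P : V -> Prop) : R1 P -> exists X : Cls, forall x, X x <-> P x.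
Proof.
move=> [p Hp]; case: inhV => v0.
case: (comprehension U HU p (fun _ => v0)) => X HX; exists X => x.
by rewrite HX Hp.
Qed.

(** Formulas take class parameters only; a set parameter [c] enters through the class [{c}], which
    comprehension provides because its assignment may mention [c]. *)
Lemma DefT_const (c : V) : DefT (fun _ => c).
Proof.
case: (comprehension U HU (FEq 0 1) (fun _ => c)) => X HX.
by exists (FCls 0 X) => e /=; rewrite HX.
Qed.

End Definability.

(** Two hooks, rebound by [::=] as notions are introduced: [def_known] applies definability already
    proved for a constant, [def_unfold] unfolds other constants. *)
Ltac def_known := fail.
Ltac def_unfold := fail.

Ltac def_hyp := match goal with
  | H : R1 ?R |- DefP (fun e => ?R _) => apply (DefP_rel1 R _ H)
  | H : R2 ?R |- DefP (fun e => ?R _ _) => apply (DefP_rel2 R _ _ H)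
  | H : R3 ?R |- DefP (fun e => ?R _ _ _) => apply (DefP_rel3 R _ _ _ H)
  | H : F1 ?F |- DefT (fun e => ?F _) => apply (DefT_fun1 F _ H)
  | H : F2 ?F |- DefT (fun e => ?F _ _) => apply (DefT_fun2 F _ _ H)
  | H : F3 ?F |- DefT (fun e => ?F _ _ _) => apply (DefT_fun3 F _ _ _ H)
  end.

Ltac def_step := lazymatch goal with
  | |- DefP (fun _ => ?P) => apply DefP_const
  | |- DefT (fun _ => ?c) => apply DefT_const
  | |- DefT (fun e => e _) => apply DefT_var
  | |- DefP (fun e => _ /\ _) => apply DefP_and
  | |- DefP (fun e => _ \/ _) => apply DefP_or
  | |- DefP (fun e => ~ _) => apply DefP_not
  | |- DefP (fun e => _ <-> _) => apply DefP_iff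
  | |- DefP (fun e => exists! x, _) => apply DefP_unique; cbv beta
  | |- DefP (fun e => exists x, _) => apply DefP_ex; cbv beta
  | |- DefP (fun e => _ ∈ _) => apply DefP_mem
  | |- DefP (fun e => set_ext _ _) => apply DefP_set_ext
  | |- DefP (fun e => _ = _) => apply DefP_eq
  | |- DefP (fun e => cls_ext _ _) => apply DefP_cls
  | |- _ => first [ def_hyp | def_known | progress def_unfold; cbv beta | apply DefP_imp | apply DefP_all; cbv beta ]
  end.
Ltac definability := unfold F1, F2, F3, R1, R2, R3, R4; cbv beta; repeat def_step.

(** * Set operations *)

Section Description.
Context {U : Universe} {HU : GBC U}.

Lemma is_empty_ex : exists y : V, is_empty y.
Proof. by case: (infinity U HU) => w [[e [He _]] _]; exists e. Qed.

Lemma is_empty_uniq (x y : V) : is_empty x -> is_empty y -> x = y.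
Proof.
by move=> Hx Hy; apply: (set_extensionality U HU) => z; split=> Hz; [case: (Hx z)|case: (Hy z)].
Qed.

(** Prescribing a value when there is no unique witness makes the whole graph first-order in [P];
    definability of a description then asks for no proof of existence. *)
Lemma iota_sig : {f : (V -> Prop) -> V | forall P y,
  y = f P <-> ((exists! x, P x) /\ P y) \/ (~ (exists! x, P x) /\ is_empty y)}.
Proof.
pose (Q := fun P y => ((exists! x, P x) /\ P y) \/ (~ (exists! x, P x) /\ is_empty y)).
exists (fun P => epsilon inhV (Q P)) => P y.
have Hex : exists y, Q P y.
  case: (classic (exists! x, P x)) => H.
    by case: (H) => x [Hx _]; exists x; left.
  by case: is_empty_ex => e He; exists e; right.
have HQ : Q P (epsilon inhV (Q P)) by exact: (epsilon_spec inhV _ Hex).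
split=> [->//|H]; case: H HQ => -[H1 H2] [[H3 H4]|[H3 H4]] //.
- by case: H1 => x [_ Hx]; rewrite -(Hx _ H2) -(Hx _ H4).
- exact: is_empty_uniq.
Qed.

(* Definite description, with value the empty set in the absence of a unique witness.
   The [Qed] above matters: were [iota] to compute, comparing two distinct nested
   descriptions up to conversion would take exponential time. *)
Definition iota : (V -> Prop) -> V := proj1_sig iota_sig.

Lemma iota_graph P y :
  y = iota P <-> ((exists! x, P x) /\ P y) \/ (~ (exists! x, P x) /\ is_empty y).
Proof. exact: (proj2_sig iota_sig). Qed.

Lemma iota_eq P y : P y -> (forall z, P z -> z = y) -> iota P = y.
Proof.
move=> Hy H; symmetry; apply/iota_graph; left; split=> //.
by exists y; split=> // z /H.
Qed.

Lemma iota_spec P : (exists! x, P x) -> P (iota P).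
Proof.
move=> H; have /iota_graph := eq_refl (iota P).
by move=> [[]|[]].
Qed.

Lemma DefT_iota (Q : (nat -> V) -> V -> Prop) :
  DefP (fun e => Q (fun n => e (S n)) (e 0)) -> DefT (fun e => iota (Q e)).
Proof.
move=> H; rewrite /DefT.
apply: (DefP_iff_ext _ _ (fun e => iff_sym (iota_graph _ _))).
have HQ : DefP (fun e => exists! x, Q (fun n => e (S n)) x).
  apply: (DefP_unique (fun e x => Q (fun n => e (S n)) x)).
  exact: (DefP_ren (fun n => match n with O => 0 | S m => S (S m) end) _ H).
apply DefP_or; apply DefP_and => //; first by apply DefP_not.
rewrite /is_empty; definability.
Qed.

(** When no set has extension [P] the value is the empty set, so definability can be settled before
    smallness, which enters in [setof_spec]. *)
Definition setof (P : V -> Prop) : V := iota (fun b => forall x, x ∈ b <-> P x).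
Definition Small (P : V -> Prop) : Prop := exists b, forall x, P x -> x ∈ b.

Lemma DefT_setof (Q : (nat -> V) -> V -> Prop) :
  DefP (fun e => Q (fun n => e (S n)) (e 0)) -> DefT (fun e => setof (Q e)).
Proof.
move=> H; apply (DefT_iota (fun e b => forall x, x ∈ b <-> Q e x)).
apply (DefP_all (fun e x => x ∈ e 0 <-> Q (fun n => e (S n)) x)).
apply DefP_iff; first by definability.
exact: (DefP_ren (fun n => match n with O => 0 | S m => S (S m) end) _ H).
Qed.

Lemma ext (a b : V) : (forall x, x ∈ a <-> x ∈ b) -> a = b.
Proof. exact: (set_extensionality U HU). Qed.

End Description.

Ltac def_known ::= first
 [ lazymatch goal with |- DefT (fun e => iota (@?Q e)) => apply (DefT_iota Q) end
 | lazymatch goal with |- DefT (fun e => setof (@?Q e)) => apply (DefT_setof Q) end ]; cbv beta.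

Ltac def_unfold ::= unfold is_upair, is_opair, app, is_succ, is_empty, subset,
  class_well_order, is_fun, is_bij, is_ord, sym.

(** * Unordered and ordered pairs *)

Section Pairs.
Context {U : Universe} {HU : GBC U}.

Lemma is_upair_uniq z z' x y : is_upair z x y -> is_upair z' x y -> z = z'.
Proof. by move=> H H'; apply ext => w; rewrite (H w) (H' w). Qed.

Definition upair x y := iota (fun z => is_upair z x y).

Lemma upairP x y w : w ∈ upair x y <-> w = x \/ w = y.
Proof.
have H : is_upair (upair x y) x y.
  apply: (iota_spec (fun z => is_upair z x y)); case: (pairing U HU x y) => z Hz; exists z; split=> // z'.
  exact: is_upair_uniq.
exact: (H w).
Qed.

Lemma is_upairE z x y : is_upair z x y <-> z = upair x y.
Proof.
split=> [H|->]; last exact: upairP.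
by apply ext => w; rewrite upairP (H w).
Qed.

Lemma upair_inj x y x' y' : upair x y = upair x' y' ->
  (x = x' /\ y = y') \/ (x = y' /\ y = x').
Proof.
move=> E.
have H w : w = x \/ w = y <-> w = x' \/ w = y' by rewrite -!upairP E.
have := proj1 (H x) (or_introl eq_refl); have := proj1 (H y) (or_intror eq_refl).
have := proj2 (H x') (or_introl eq_refl); have := proj2 (H y') (or_intror eq_refl).
intuition congruence.
Qed.

(** Sealed by [Qed] for the same reason as [iota]; [opairE] gives the equation back. *)
Lemma opair_sig : {f : V -> V -> V | forall x y, f x y = upair (upair x x) (upair x y)}.
Proof. by exists (fun x y => upair (upair x x) (upair x y)). Qed.

Definition opair : V -> V -> V := proj1_sig opair_sig.

Lemma opairE x y : opair x y = upair (upair x x) (upair x y).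
Proof. exact: (proj2_sig opair_sig). Qed.

Lemma is_opairE p x y : is_opair p x y <-> p = opair x y.
Proof.
split.
  by rewrite opairE; move=> [a [b [/is_upairE -> [/is_upairE -> /is_upairE ->]]]].
by move=> ->; rewrite opairE; exists (upair x x), (upair x y); rewrite !is_upairE.
Qed.

Lemma opair_inj x y x' y' : opair x y = opair x' y' <-> x = x' /\ y = y'.
Proof.
rewrite !opairE; split=> [/upair_inj H|[-> ->] //].
have K a b c : upair a a = upair b c -> a = b /\ a = c.
  by case/upair_inj => -[-> ->].
case: H => -[H1 H2].
  by case: (K _ _ _ H1) => E _; case/upair_inj: H2; intuition congruence.
by case: (K _ _ _ H1) (K _ _ _ (eq_sym H2)); intuition congruence.
Qed.

Lemma opair_fst x y : upair x x ∈ opair x y.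
Proof. by rewrite opairE upairP; left. Qed.

Lemma appE (F : V -> Prop) x y : app F x y <-> F (opair x y).
Proof.
split=> [[p [/is_opairE -> //]]|H].
by exists (opair x y); split=> //; apply/is_opairE.
Qed.

Lemma D_is_opair : R3 is_opair. Proof. definability. Qed.
Lemma D_upair : F2 upair. Proof. unfold upair. definability. Qed.
Lemma D_opair : F2 opair.
Proof.
apply: (DefP_iff_ext (fun e => is_opair (e 0) (e 1) (e 2))) => [e|]; first exact: is_opairE.
exact: D_is_opair.
Qed.

End Pairs.

Ltac def_known1 := first
 [ lazymatch goal with |- DefT (fun e => iota (@?Q e)) => apply (DefT_iota Q) end
 | lazymatch goal with |- DefT (fun e => setof (@?Q e)) => apply (DefT_setof Q) end
 | lazymatch goal with |- DefP (fun e => is_opair _ _ _) => apply (DefP_rel3 is_opair _ _ _ D_is_opair) end | lazymatch goal with |- DefT (fun e => opair _ _) => apply (DefT_fun2 opair _ _ D_opair) end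
 | lazymatch goal with |- DefT (fun e => upair _ _) => apply (DefT_fun2 upair _ _ D_upair) end ]; cbv beta.
Ltac def_known ::= def_known1.

Section Sets.
Context {U : Universe} {HU : GBC U}.

Lemma replace (F : V -> V) a : F1 F -> exists b, forall y, y ∈ b <-> exists x, x ∈ a /\ y = F x.
Proof.
move=> HF.
have [X HX] : exists X : Cls, forall p, X p <-> exists x, p = opair x (F x).
  by apply: comprehend; definability.
have HA x y : app X x y <-> y = F x.
  rewrite appE HX; split=> [[x' /opair_inj [-> ->] //]|->]; by exists x.
have HX1 x y z : app X x y -> app X x z -> y = z by rewrite !HA => -> ->.
case: (replacement U HU X HX1 a) => b Hb.
by exists b => y; rewrite Hb; split=> -[x [Hx /HA H]]; exists x.
Qed.

(** Separation from replacement: the image of [b] under the partial identity [{(x, x) : P x}] is the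
    wanted set. *)
Lemma setof_spec P : R1 P -> Small P -> forall x, x ∈ setof P <-> P x.
Proof.
move=> HP [b Hb].
suff [c Hc] : exists c, forall x, x ∈ c <-> P x.
  apply: (iota_spec (fun b => forall x, x ∈ b <-> P x)); exists c; split=> // c' Hc'.
  by apply ext => x; rewrite Hc Hc'.
have [X HX] : exists X : Cls, forall p, X p <-> exists x, P x /\ p = opair x x.
  by apply: comprehend; definability.
have HA x y : app X x y <-> P x /\ y = x.
  rewrite appE HX; split=> [[x' [? /opair_inj [-> ->]]] //|[? ->]]; by exists x.
have HX1 x y z : app X x y -> app X x z -> y = z by rewrite !HA => -[_ ->] [_ ->].
case: (replacement U HU X HX1 b) => c Hc; exists c => y; rewrite Hc; split=> [[x [_ /HA [? ->]]] //|H].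
by exists y; split; [apply Hb|apply/HA].
Qed.

Lemma Small_sub (P Q : V -> Prop) : (forall x, Q x -> P x) -> Small P -> Small Q.
Proof. by move=> H [b Hb]; exists b => x /H /Hb. Qed.
Lemma Small_mem a : Small (fun x => x ∈ a).
Proof. by exists a. Qed.
Lemma Small_img F a : F1 F -> Small (fun y => exists x, x ∈ a /\ y = F x).
Proof. by move=> /(replace F a) [b Hb]; exists b => y /Hb. Qed.

Definition image (F : V -> V) a := setof (fun y => exists x, x ∈ a /\ y = F x).
Lemma imageP F a y : F1 F -> y ∈ image F a <-> exists x, x ∈ a /\ y = F x.
Proof. by move=> HF; apply: setof_spec; [definability|exact: Small_img]. Qed.

Definition bigcup a := setof (fun x => exists y, x ∈ y /\ y ∈ a).
Lemma bigcupP a x : x ∈ bigcup a <-> exists y, x ∈ y /\ y ∈ a.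
Proof.
apply: setof_spec; first by definability.
by case: (union U HU a) => b Hb; exists b => z /Hb.
Qed.

Definition power a := setof (fun x => subset x a).
Lemma Small_subset a : Small (fun x => subset x a).
Proof. by case: (powerset U HU a) => b Hb; exists b => z /Hb. Qed.
Lemma powerP a x : x ∈ power a <-> subset x a.
Proof. by apply: setof_spec; [definability|exact: Small_subset]. Qed.

Definition empset := iota is_empty.
Lemma empsetP x : ~ x ∈ empset.
Proof.
have H : is_empty empset; last exact: H.
apply: (iota_spec is_empty); case: is_empty_ex => e He; exists e; split=> // e'; exact: is_empty_uniq.
Qed.
Lemma is_emptyE e : is_empty e <-> e = empset.
Proof. by split=> [H|->]; [apply: is_empty_uniq|]; move=> // x; apply: empsetP. Qed.

Definition cup a b := bigcup (upair a b).
Lemma cupP a b x : x ∈ cup a b <-> x ∈ a \/ x ∈ b.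
Proof.
rewrite bigcupP; split=> [[y [Hx /upairP [<-|<-]]]|[H|H]]; [by left|by right|exists a|exists b];
by rewrite upairP; auto.
Qed.

Definition sing x := upair x x.
Lemma singP x y : y ∈ sing x <-> y = x.
Proof. rewrite upairP; tauto. Qed.
Lemma sing_inj x y : sing x = sing y -> x = y.
Proof. by move=> H; apply/singP; rewrite -H; apply/singP. Qed.

Definition succ x := cup x (sing x).
Lemma succP x y : y ∈ succ x <-> y ∈ x \/ y = x.
Proof. by rewrite cupP singP. Qed.
Lemma is_succE s x : is_succ s x <-> s = succ x.
Proof.
split=> [H|-> w]; last exact: succP.
by apply ext => w; rewrite (H w) succP.
Qed.

Lemma D_bigcup : F1 bigcup. Proof. unfold bigcup; definability. Qed.
Lemma D_power : F1 power. Proof. unfold power; definability. Qed.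

End Sets.

Ltac def_known2 := first [ def_known1 | lazymatch goal with |- DefT (fun e => bigcup _) => apply (DefT_fun1 bigcup _ D_bigcup) end | lazymatch goal with |- DefT (fun e => power _) => apply (DefT_fun1 power _ D_power) end ].
Ltac def_known ::= def_known2.
Ltac def_unfold ::= unfold is_upair, is_opair, app, is_succ, is_empty, subset,
  class_well_order, is_fun, is_bij, is_ord, sym, cup, sing, succ, image.

(** * Functions and bijections that are sets *)

Section Functions.
Context {U : Universe} {HU : GBC U}.

Lemma Small_pair P Q : R1 P -> R1 Q -> Small P -> Small Q ->
  Small (fun z => exists x y, P x /\ Q y /\ z = opair x y).
Proof.
move=> HP HQ [a Ha] [b Hb].
exists (bigcup (image (fun x => image (fun y => opair x y) b) a)) => z [x [y [Px [Qy ->]]]].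
apply/bigcupP; exists (image (fun y => opair x y) b); rewrite !imageP; try by definability.
by split; [exists y|exists x]; split=> //; auto.
Qed.

Definition cartesian a b := setof (fun z => exists x y, x ∈ a /\ y ∈ b /\ z = opair x y).
Lemma cartesianP a b z : z ∈ cartesian a b <-> exists x y, x ∈ a /\ y ∈ b /\ z = opair x y.
Proof.
apply: setof_spec; first by definability.
by apply: Small_pair; first [by definability|exact: Small_mem].
Qed.
Lemma pair_cartesian a b x y : opair x y ∈ cartesian a b <-> x ∈ a /\ y ∈ b.
Proof.
rewrite cartesianP; split=> [[x' [y' [? [? /opair_inj [-> ->]]]]] //|[? ?]].
by exists x, y.
Qed.

Definition lam (F : V -> V) a := setof (fun p => exists x, x ∈ a /\ p = opair x (F x)).
Lemma lamP F a p : F1 F -> p ∈ lam F a <-> exists x, x ∈ a /\ p = opair x (F x).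
Proof.
move=> HF; apply: setof_spec; first by definability.
by apply: (Small_img (fun x => opair x (F x))); definability.
Qed.
Lemma app_lam F a x y : F1 F -> app (lam F a) x y <-> x ∈ a /\ y = F x.
Proof.
move=> HF; rewrite appE /set_ext lamP //.
by split=> [[x' [? /opair_inj [-> ->]]] //|[? ->]]; exists x.
Qed.

Definition ap (f x : V) : V := iota (fun y => app f x y).
Definition apc (F : Cls) (x : V) : V := iota (fun y => app F x y).

Lemma ap_lam F a x : F1 F -> x ∈ a -> ap (lam F a) x = F x.
Proof. by move=> HF Hx; apply: iota_eq => [|z]; rewrite app_lam // => -[]. Qed.

Lemma is_fun_app (F D : V -> Prop) x y : is_fun F D -> app F x y -> D x.
Proof.
move=> [H _] /appE /H [x' [y' [/is_opairE /opair_inj [-> _] //]]].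
Qed.
Lemma is_fun_uniq (F D : V -> Prop) x y z : is_fun F D -> app F x y -> app F x z -> y = z.
Proof.
move=> HF Hy Hz; case: (HF) => _ /(_ x (is_fun_app F D x y HF Hy)) [w [_ Hw]].
by rewrite -(Hw _ Hy) -(Hw _ Hz).
Qed.
Lemma ap_app (f : V) D x : is_fun f D -> D x -> app f x (ap f x).
Proof. by move=> [_ H] Hx; apply: (iota_spec (fun y => app f x y)); apply: H. Qed.
Lemma apc_app (F : Cls) D x : is_fun F D -> D x -> app F x (apc F x).
Proof. by move=> [_ H] Hx; apply: (iota_spec (fun y => app F x y)); apply: H. Qed.
Lemma app_ap (f : V) D x y : is_fun f D -> app f x y -> y = ap f x.
Proof.
by move=> HF H; apply: (is_fun_uniq f D x) => //; apply: (ap_app f D) => //; apply: (is_fun_app f D x y).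
Qed.
Lemma appP (f : V) D x y : is_fun f D -> app f x y <-> D x /\ y = ap f x.
Proof.
move=> HF; split=> [H|[Hx ->]]; last exact: (ap_app f D).
by split; [apply: (is_fun_app f D x y)|apply: (app_ap f D)].
Qed.
Lemma apcP (f : Cls) D x y : is_fun f D -> app f x y <-> D x /\ y = apc f x.
Proof.
move=> HF; split=> [H|[Hx ->]]; last exact: (apc_app f D).
have Hx := is_fun_app f D x y HF H.
by split=> //; apply: (is_fun_uniq f D x) => //; apply: (apc_app f D).
Qed.

Lemma is_fun_lam F a (D : V -> Prop) : F1 F -> (forall x, D x <-> x ∈ a) -> is_fun (lam F a) D.
Proof.
move=> HF HD; split=> [p /lamP|x /HD Hx].
  by move=> /(_ HF) [x [Hx ->]]; exists x, (F x); rewrite is_opairE HD.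
by exists (F x); split=> [|y]; rewrite app_lam // => -[].
Qed.

Lemma fun_ext (f g : V) (D : V -> Prop) :
  is_fun f D -> is_fun g D -> (forall x, D x -> ap f x = ap g x) -> f = g.
Proof.
move=> Hf Hg H; apply ext.
suff K : forall f g : V, is_fun f D -> is_fun g D -> (forall x, D x -> ap f x = ap g x) ->
  forall p, p ∈ f -> p ∈ g.
  by move=> p; split; apply: K => // x Hx; rewrite H.
clear; move=> f g Hf Hg H p Hp; case: (Hf) => /(_ p Hp) [x [y [/is_opairE E Hx]]] _.
have : app f x y by rewrite appE -E.
move=> /(app_ap f D _ _ Hf); rewrite H // => Ey.
have := ap_app g D x Hg Hx; by rewrite -Ey appE -E.
Qed.

Lemma bij_lam F a (D E : V -> Prop) : F1 F -> (forall x, D x <-> x ∈ a) ->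
  (forall x, D x -> E (F x)) -> (forall x y, D x -> D y -> F x = F y -> x = y) ->
  (forall y, E y -> exists x, D x /\ y = F x) -> is_bij (lam F a) D E.
Proof.
move=> HF HD HE Hi Hs; split; first exact: is_fun_lam.
split=> [x y|y Hy]; first by rewrite app_lam // -HD => -[? ->]; auto.
case: (Hs y Hy) => x [Hx Ey]; exists x; split=> [|x']; rewrite app_lam // -HD //.
by move=> [? E']; apply: Hi => //; rewrite -Ey.
Qed.

Definition binv (f y : V) : V := iota (fun x => app f x y).

Section Bij.
Context (f : V) (D E : V -> Prop) (Hf : is_bij f D E).
Lemma bij_fun : is_fun f D. Proof. by case: Hf. Qed.
Lemma bij_ap x : D x -> E (ap f x).
Proof. by move=> Hx; case: Hf => H1 [H2 _]; apply: (H2 x); apply: (ap_app f D). Qed.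
Lemma bij_inj x y : D x -> D y -> ap f x = ap f y -> x = y.
Proof.
move=> Hx Hy Exy; case: (Hf) => H1 [H2 H3].
case: (H3 (ap f x) (bij_ap x Hx)) => w [_ Hw].
have Ex : w = x by apply: Hw; apply: (ap_app f D).
have Ey : w = y by apply: Hw; rewrite Exy; apply: (ap_app f D).
by rewrite -Ex.
Qed.
Lemma bij_binv y : E y -> D (binv f y) /\ ap f (binv f y) = y.
Proof.
move=> Hy; case: (Hf) => H1 [H2 H3].
have H : app f (binv f y) y by apply: (iota_spec (fun x => app f x y)); apply: H3.
by split; [apply: (is_fun_app f D _ y)|rewrite -(app_ap f D _ y)].
Qed.
Lemma bij_binv_ap x : D x -> binv f (ap f x) = x.
Proof. by move=> Hx; have [H1 H2] := bij_binv _ (bij_ap x Hx); apply: bij_inj. Qed.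
End Bij.

Lemma D_ap : F2 ap. Proof. unfold ap; definability. Qed.
Lemma D_apc C : F1 (apc C). Proof. unfold apc; definability. Qed.
Lemma D_binv : F2 binv. Proof. unfold binv; definability. Qed.
Lemma D_cartesian : F2 cartesian. Proof. unfold cartesian; definability. Qed.

End Functions.

Ltac def_known3 := first [ def_known2 | lazymatch goal with |- DefT (fun e => ap _ _) => apply (DefT_fun2 ap _ _ D_ap) end | lazymatch goal with |- DefT (fun e => apc _ _) => apply (DefT_fun1 (apc _) _ (D_apc _)) end
  | lazymatch goal with |- DefT (fun e => binv _ _) => apply (DefT_fun2 binv _ _ D_binv) end | lazymatch goal with |- DefT (fun e => cartesian _ _) => apply (DefT_fun2 cartesian _ _ D_cartesian) end ].
Ltac def_known ::= def_known3.
Ltac def_unfold ::= unfold is_upair, is_opair, app, is_succ, is_empty, subset,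
  class_well_order, is_fun, is_bij, is_ord, sym, cup, sing, succ, image, lam.

(** * Ordinals *)

Section Ords.
Context {U : Universe} {HU : GBC U}.

Lemma mem_min (P : V -> Prop) : R1 P -> (exists x, P x) -> exists x, P x /\ forall y, y ∈ x -> ~ P y.
Proof.
move=> /comprehend [X HX] [x Hx].
case: (foundation U HU X) => [|y [Hy Hm]]; first by exists x; apply/HX.
exists y; split=> [|z /Hm Hz /HX //]; exact/HX.
Qed.

Lemma mem_ind (P : V -> Prop) : R1 P -> (forall x, (forall y, y ∈ x -> P y) -> P x) -> forall x, P x.
Proof.
move=> HP H; apply: NNPP => Hn.
have [x [Hx Hm]] : exists x, ~ P x /\ forall y, y ∈ x -> ~ ~ P y.
  by apply: (mem_min (fun x => ~ P x)); [definability|apply: not_all_ex_not].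
by apply: Hx; apply: H => y /Hm /NNPP.
Qed.

Lemma mem_irrefl x : ~ x ∈ x.
Proof.
move=> Hx; case: (mem_min (fun z => z = x)); [by definability|by exists x|].
by move=> y [-> /(_ x Hx)].
Qed.

Lemma mem_asym x y : x ∈ y -> ~ y ∈ x.
Proof.
move=> Hxy Hyx; case: (mem_min (fun z => z = x \/ z = y)); [by definability|by exists x; left|].
by move=> z [[->|->] H]; [apply: (H y)|apply: (H x)]; auto.
Qed.

Lemma D_is_ord : R1 is_ord. Proof. definability. Qed.

Lemma ord_trans a x y : is_ord a -> x ∈ a -> y ∈ x -> y ∈ a.
Proof. by move=> [H _]; apply: H. Qed.

Lemma ord_mem a x : is_ord a -> x ∈ a -> is_ord x.
Proof.
move=> Ha Hx; have [_ Hl] := Ha; split.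
- move=> u v Hu Hv.
  have Hua := ord_trans a x u Ha Hx Hu; have Hva := ord_trans a u v Ha Hua Hv.
  case: (Hl v x Hva Hx) => // -[E|H]; first by case: (mem_asym v u Hv); rewrite E.
  exfalso; case: (mem_min (fun z => z = u \/ z = v \/ z = x)); [by definability|by exists u; left|].
  by move=> z [[->|[->|->]] K]; [apply: (K v)|apply: (K x)|apply: (K u)]; auto.
- by move=> u v Hu Hv; apply: Hl; apply: (ord_trans a x).
Qed.

(** If [c] omits an element of [a], the least one omitted is [c] itself. *)
Lemma ord_sub_mem a c : is_ord a -> (forall x, x ∈ c -> x ∈ a) ->
  (forall x y, x ∈ c -> y ∈ x -> y ∈ c) -> c = a \/ c ∈ a.
Proof.
move=> Ha Hs Ht; case: (classic (exists x, x ∈ a /\ ~ x ∈ c)) => [H|H].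
- right; case: (mem_min (fun x => x ∈ a /\ ~ x ∈ c)) => //; first by definability.
  move=> x [[Hx Hxc] Hm]; suff -> : c = x by [].
  apply ext => y; split=> Hy.
    case: (proj2 Ha y x (Hs y Hy) Hx) => // -[E|K]; case: Hxc; [by rewrite -E|by apply: (Ht y)].
  apply: NNPP => K; apply: (Hm y Hy); split=> //; exact: (ord_trans a x).
- left; apply ext => y; split=> [/Hs //|Hy].
  by apply: NNPP => K; apply: H; exists y.
Qed.

Lemma sep_ex a (P : V -> Prop) : R1 P -> exists c, forall x, x ∈ c <-> x ∈ a /\ P x.
Proof.
move=> HP; exists (setof (fun x => x ∈ a /\ P x)) => x; apply: setof_spec; first by definability.
by apply: (Small_sub (fun x => x ∈ a)); [move=> y []|exact: Small_mem].
Qed.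

(** The intersection [c] is an initial segment of both; were it proper in both, it would be an
    element of itself. *)
Lemma ord_tri a b : is_ord a -> is_ord b -> a ∈ b \/ a = b \/ b ∈ a.
Proof.
move=> Ha Hb; case: (sep_ex a (fun x => x ∈ b)) => [|c Hc]; first by definability.
have Ht x y : x ∈ c -> y ∈ x -> y ∈ c.
  by rewrite !Hc => -[H1 H2] Hy; split; [apply: (ord_trans a x)|apply: (ord_trans b x)].
case: (ord_sub_mem a c) => // [x /Hc []||] // Ea.
  case: (ord_sub_mem b c) => // [x /Hc []||] // Eb; [right; left|left]; by rewrite -Ea.
case: (ord_sub_mem b c) => // [x /Hc []||] // Eb; first by right; right; rewrite -Eb.
by case: (mem_irrefl c); apply/Hc.
Qed.

Lemma ord_sub a b : is_ord a -> is_ord b -> (forall x, x ∈ a -> x ∈ b) -> a = b \/ a ∈ b.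
Proof. by move=> Ha Hb H; apply: ord_sub_mem => // x y; apply: ord_trans. Qed.

Lemma ord_succ a : is_ord a -> is_ord (succ a).
Proof.
move=> Ha; split=> x y; rewrite !succP.
  by move=> [Hx|->] Hy; left => //; apply: (ord_trans a x).
move=> [Hx|->] [Hy|->]; auto.
by case: (proj2 Ha x y Hx Hy); auto.
Qed.

Lemma ord_bigcup a : (forall x, x ∈ a -> is_ord x) -> is_ord (bigcup a).
Proof.
move=> H; split=> x y; rewrite !bigcupP.
  by move=> [z [Hx Hz]] Hy; exists z; split=> //; apply: (ord_trans z x) => //; apply: H.
move=> [u [Hx Hu]] [v [Hy Hv]]; apply: ord_tri; [apply: (ord_mem u)|apply: (ord_mem v)]; auto.
Qed.

Lemma ord_empset : is_ord empset.
Proof. by split=> x y /empsetP. Qed.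

Lemma ord_of_ords a : (forall x, x ∈ a -> is_ord x) -> (forall x y, x ∈ a -> y ∈ x -> y ∈ a) -> is_ord a.
Proof. by move=> H Ht; split=> // x y /H Hx /H Hy; apply: ord_tri. Qed.

Lemma ord_min (P : V -> Prop) : R1 P -> (exists a, is_ord a /\ P a) ->
  exists a, is_ord a /\ P a /\ forall b, b ∈ a -> ~ P b.
Proof.
move=> HP H; case: (mem_min (fun a => is_ord a /\ P a)) => //; first by definability.
move=> a [[Ha Pa] Hm]; exists a; do 2!split=> //; move=> b Hb Pb.
by apply: (Hm b Hb); split=> //; apply: (ord_mem a).
Qed.

Lemma ord_min_unique (P : V -> Prop) a b : is_ord a -> is_ord b -> P a -> P b ->
  (forall c, c ∈ a -> ~ P c) -> (forall c, c ∈ b -> ~ P c) -> a = b.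
Proof. by move=> Ha Hb Pa Pb Ma Mb; case: (ord_tri a b) => // [/Mb //|[//|/Ma //]]. Qed.

Definition least_ord (P : V -> Prop) := iota (fun a => is_ord a /\ P a /\ forall b, b ∈ a -> ~ P b).
Lemma least_ord_spec P : R1 P -> (exists a, is_ord a /\ P a) ->
  is_ord (least_ord P) /\ P (least_ord P) /\ forall b, b ∈ least_ord P -> ~ P b.
Proof.
move=> HP H; apply: (iota_spec (fun a => is_ord a /\ P a /\ forall b, b ∈ a -> ~ P b)).
case: (ord_min P HP H) => a Ha; exists a; split=> // b Hb.
apply: (ord_min_unique P); tauto.
Qed.

Lemma ord_le_mem a b c : is_ord c -> (a ∈ b \/ a = b) -> b ∈ c -> a ∈ c.
Proof. by move=> Hc [Ha|->] // Hb; apply: (ord_trans c b). Qed.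

Lemma ord_bound a : (forall x, x ∈ a -> is_ord x) -> exists b, is_ord b /\ forall x, x ∈ a -> x ∈ b.
Proof.
move=> H; exists (succ (bigcup a)); split; first by apply/ord_succ/ord_bigcup.
move=> x Hx; rewrite succP.
case: (ord_sub x (bigcup a)) => [||y Hy||]; auto; first exact: ord_bigcup.
by apply/bigcupP; exists x.
Qed.

Lemma limit_succ a x : is_limit a -> x ∈ a -> succ x ∈ a.
Proof.
move=> [Ha [_ Hl]] Hx; case: (Hl x Hx) => y [Hy Hxy].
have Ho := ord_mem a x Ha Hx; have Hy' := ord_mem a y Ha Hy.
apply: (ord_le_mem _ y) => //.
case: (ord_sub (succ x) y) => //; [exact: ord_succ| |auto|auto].
by move=> z /succP [Hz|->] //; apply: (ord_trans y x).
Qed.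

Lemma limit_empset a : is_limit a -> empset ∈ a.
Proof.
move=> [Ha [[x Hx] _]]; case: (ord_tri empset a ord_empset Ha) => [//|[E|/empsetP //]].
by move: Hx; rewrite -E => /empsetP.
Qed.

Lemma D_is_limit : R1 is_limit. Proof. unfold is_limit. definability. Qed.

Definition omega := setof is_nat.
Lemma D_is_nat : R1 is_nat. Proof. unfold is_nat, is_limit; definability. Qed.

Lemma nat_cases n : is_nat n -> n = empset \/ exists m, is_nat m /\ n = succ m.
Proof.
move=> [Hn [Hl Hm]]; case: (classic (exists x, x ∈ n)) => [H|H]; last first.
  by left; apply/is_emptyE => x Hx; apply: H; exists x.
right; case: (classic (exists x, x ∈ n /\ forall y, y ∈ n -> ~ x ∈ y)) => [[m [Hmn Hx]]|K].
- exists m; have Ho := ord_mem n m Hn Hmn; split.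
    by split=> //; split=> [|k Hk]; apply: Hm => //; apply: (ord_trans n m).
  apply ext => x; rewrite succP; split=> [Hxn|[Hxm|->]] //; last by apply: (ord_trans n m).
  by case: (proj2 Hn x m) => // [|[|/Hx]]; auto.
- case: Hl; split=> //; split=> // x Hx.
  by apply: NNPP => K'; apply: K; exists x; split=> // y Hy Hxy; apply: K'; exists y.
Qed.

Lemma omegaP n : n ∈ omega <-> is_nat n.
Proof.
apply: setof_spec; first exact: D_is_nat.
case: (infinity U HU) => w [[e [/is_emptyE -> He]] Hs]; exists w.
apply: NNPP => /not_all_ex_not [n0 Hn0].
case: (mem_min (fun n => is_nat n /\ ~ n ∈ w)).
- have H := D_is_nat; definability.
- by exists n0; tauto.
- move=> k [[Hn Hnw] Hm]; case: (nat_cases k Hn) => [E|[m [Hm' E]]]; first by rewrite E in Hnw.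
have Hmw : m ∈ w.
  by apply: NNPP => K; apply: (Hm m) => //; rewrite E succP; right.
by case: (Hs m Hmw) => s [/is_succE Es Hsw]; apply: Hnw; rewrite E -Es.
Qed.

Lemma nat_empset : is_nat empset.
Proof. by split; [exact: ord_empset|split=> [[_ [[x /empsetP]]]|m /empsetP] //]. Qed.
Lemma nat_succ n : is_nat n -> is_nat (succ n).
Proof.
move=> [Hn [Hl Hm]]; split; [exact: ord_succ|split].
  move=> [_ [_ /(_ n)]]; rewrite succP => -[|y [/succP [H1|->] H2]]; first by right.
  by case: (mem_asym n y).
  by case: (mem_irrefl n).
by move=> m /succP [/Hm|->].
Qed.
Lemma nat_ind (P : V -> Prop) : R1 P -> P empset -> (forall n, is_nat n -> P n -> P (succ n)) ->
  forall n, is_nat n -> P n.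
Proof.
move=> HP H0 Hs n Hn; apply: NNPP => Hnn.
case: (mem_min (fun n => is_nat n /\ ~ P n)); [|by exists n|].
  have H := D_is_nat; definability.
move=> k [[Hk Hkn] Hm]; case: (nat_cases k Hk) => [E|[m [Hm' E]]]; first by rewrite E in Hkn.
apply: Hkn; rewrite E; apply: Hs => //; apply: NNPP => K.
by apply: (Hm m) => //; rewrite E succP; right.
Qed.

Definition W : Cls := epsilon (let: ex_intro _ X _ := global_choice U HU in inhabits X) class_well_order.
Lemma WP : class_well_order W.
Proof. by apply: epsilon_spec; exact: (global_choice U HU). Qed.

Lemma W_tri x y : app W x y \/ x = y \/ app W y x.
Proof. by case: WP => _ [_ [H _]]. Qed.
Lemma W_irr x : ~ app W x x. Proof. by case: WP. Qed.
Lemma W_trans x y z : app W x y -> app W y z -> app W x z.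
Proof. by case: WP => _ [H _]; apply: H. Qed.
Lemma W_min (P : V -> Prop) : R1 P -> (exists x, P x) -> exists x, P x /\ forall y, P y -> ~ app W y x.
Proof.
move=> /comprehend [X HX] [x Hx]; case: WP => _ [_ [_ H]].
case: (H X) => [|y [Hy K]]; first by exists x; apply/HX.
by exists y; split; [apply/HX|move=> z /HX /K].
Qed.

(** A choice operator with definable result, so that choices made for all indices at once form a
    class. *)
Definition W_least (P : V -> Prop) := iota (fun x => P x /\ forall y, P y -> ~ app W y x).
Lemma W_least_spec P : R1 P -> (exists x, P x) -> P (W_least P).
Proof.
move=> HP H; case: (W_min P HP H) => x [Hx Hm].
suff [] : P (W_least P) /\ forall y, P y -> ~ app W y (W_least P) by [].
apply: (iota_spec (fun x => P x /\ forall y, P y -> ~ app W y x)).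
by exists x; split=> // y [Hy Hmy]; case: (W_tri x y) => [/(Hmy _ Hx)|[|/(Hm _ Hy)]].
Qed.

Lemma DefT_W_least (Q : (nat -> V) -> V -> Prop) :
  DefP (fun e => Q (fun n => e (S n)) (e 0)) -> DefT (fun e => W_least (Q e)).
Proof.
move=> H; apply (DefT_iota (fun e x => Q e x /\ forall y, Q e y -> ~ app W y x)).
apply DefP_and => //.
apply (DefP_all (fun e y => Q (fun n => e (S n)) y -> ~ app W y (e 0))).
apply DefP_imp; last by definability.
exact: (DefP_ren (fun n => match n with O => 0 | S m => S (S m) end) _ H).
Qed.

Lemma DefT_least_ord (Q : (nat -> V) -> V -> Prop) :
  DefP (fun e => Q (fun n => e (S n)) (e 0)) -> DefT (fun e => least_ord (Q e)).
Proof.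
move=> H; apply (DefT_iota (fun e x => is_ord x /\ Q e x /\ forall y, y ∈ x -> ~ Q e y)).
apply DefP_and; first by definability.
apply DefP_and => //.
apply (DefP_all (fun e y => y ∈ e 0 -> ~ Q (fun n => e (S n)) y)).
apply DefP_imp; first by definability.
apply DefP_not.
exact: (DefP_ren (fun n => match n with O => 0 | S m => S (S m) end) _ H).
Qed.

End Ords.

Ltac def_known4 := first [
   lazymatch goal with |- DefT (fun e => W_least (@?Q e)) => apply (DefT_W_least Q) end
 | lazymatch goal with |- DefT (fun e => least_ord (@?Q e)) => apply (DefT_least_ord Q) end
 | def_known3
 | lazymatch goal with |- DefP (fun e => is_ord _) => apply (DefP_rel1 is_ord _ D_is_ord) end | lazymatch goal with |- DefP (fun e => is_limit _) => apply (DefP_rel1 is_limit _ D_is_limit) end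
 | lazymatch goal with |- DefP (fun e => is_nat _) => apply (DefP_rel1 is_nat _ D_is_nat) end]; cbv beta.
Ltac def_known ::= def_known4.

(** * Recursion along a transitive, set-like, well-founded relation *)

Section Recursion.
Context {U : Universe} {HU : GBC U}.
Context (seg : V -> V) (Phi : V -> V -> V) (Dseg : F1 seg) (DPhi : F2 Phi).
Context (seg_trans : forall x y z, y ∈ seg x -> z ∈ seg y -> z ∈ seg x).
Context (seg_min : forall P, R1 P -> (exists x, P x) -> exists x, P x /\ forall y, y ∈ seg x -> ~ P y).

(** An attempt at the recursion, on the proper predecessors of [x]. It is a set, which keeps the
    definition of [rec] within predicative comprehension. *)
Let att (f x : V) := is_fun f (set_ext (seg x)) /\
  forall y, y ∈ seg x -> ap f y = Phi y (lam (fun z => ap f z) (seg y)).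

Lemma lam_congr F G a : F1 F -> F1 G -> (forall x, x ∈ a -> F x = G x) -> lam F a = lam G a.
Proof.
move=> HF HG H; apply ext => p; rewrite !lamP //.
by split=> -[x [Hx ->]]; exists x; rewrite H.
Qed.

Lemma lam_ap (f : V) a : is_fun f (set_ext a) -> lam (fun x => ap f x) a = f.
Proof.
move=> Hf; apply: (fun_ext _ _ (set_ext a)) => // [|x Hx].
  by apply: is_fun_lam => //; definability.
by rewrite ap_lam //; definability.
Qed.

Let att_uniq f g x : att f x -> att g x -> f = g.
Proof.
move=> [Hf Ef] [Hg Eg]; apply: (fun_ext _ _ (set_ext (seg x))) => // y Hy.
apply: NNPP => Hn.
case: (seg_min (fun y => y ∈ seg x /\ ap f y <> ap g y)); [by definability|by exists y|].
move=> w [[Hw Hne] Hm]; apply: Hne; rewrite Ef // Eg //; congr Phi.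
apply: lam_congr; [by definability|by definability|] => z Hz; apply: NNPP => K.
by apply: (Hm z Hz); split=> //; apply: (seg_trans x w).
Qed.

Definition rec (x : V) := Phi x (iota (fun f => att f x)).

Lemma D_rec : F1 rec.
Proof. unfold rec, att; definability. Qed.

Let att_rec x : (exists f, att f x) -> rec x = Phi x (iota (fun f => att f x)) /\ att (iota (fun f => att f x)) x.
Proof.
move=> [f Hf]; split=> //; apply: (iota_spec (fun f => att f x)).
exists f; split=> // g Hg; exact: (att_uniq f g x).
Qed.

(** Gluing: [rec y] is computed from the attempt on [seg y], and uniqueness of attempts identifies
    the values of that attempt with those of [rec]. *)
Let att_lam x : (forall y, y ∈ seg x -> exists f, att f y) -> att (lam rec (seg x)) x.
Proof.
move=> H; have Drec := D_rec; split; first by apply: is_fun_lam.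
move=> y Hy; rewrite ap_lam //.
case: (att_rec y (H y Hy)) => -> Hf; congr Phi.
set f := iota _ in Hf *.
rewrite -[LHS](lam_ap f (seg y)); first by case: Hf.
apply: lam_congr; [by definability|by definability|] => z Hz; have Hzx := seg_trans x y z Hy Hz.
rewrite ap_lam //; case: (att_rec z (H z Hzx)) => -> Hg.
rewrite (proj2 Hf) //; congr Phi; symmetry; apply: (att_uniq _ _ z) => //.
case: Hf => Hf Ef; split; first by apply: is_fun_lam => //; definability.
move=> w Hw; have Hwy := seg_trans y z w Hz Hw.
have Df g : F1 (fun x => ap g x) by definability.
rewrite ap_lam // Ef //; congr Phi.
apply: lam_congr; [by definability|by definability|] => v Hv; rewrite ap_lam //.
exact: (seg_trans z w).
Qed.

Lemma rec_eq x : rec x = Phi x (lam rec (seg x)).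
Proof.
have Ha : forall x, exists f, att f x.
  move=> z; apply: NNPP => Hn.
  case: (seg_min (fun x => ~ exists f, att f x)); [|by exists z|].
    by unfold att; definability.
  by move=> w [Hw Hm]; apply: Hw; exists (lam rec (seg w)); apply: att_lam => y /Hm /NNPP.
case: (att_rec x (Ha x)) => -> Hf; congr Phi.
by apply: (att_uniq _ _ x) => //; apply: att_lam.
Qed.

End Recursion.

(** * Mostowski collapse of a set-like well-order *)

Section Collapse.
Context {U : Universe} {HU : GBC U}.
Context (D : V -> Prop) (seg : V -> V) (Dseg : F1 seg).
Context (seg_D : forall x y, y ∈ seg x -> D y).
Context (seg_trans : forall x y z, y ∈ seg x -> z ∈ seg y -> z ∈ seg x).
Context (seg_tri : forall x y, D x -> D y -> x ∈ seg y \/ x = y \/ y ∈ seg x).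
Context (seg_min : forall P, R1 P -> (exists x, P x) -> exists x, P x /\ forall y, y ∈ seg x -> ~ P y).

(** [G x] is the set of values of [G] on [seg x]. Trichotomy makes it linearly ordered, hence an
    ordinal, and makes [G] injective on [D]. Only the segments are sets, so [D] may be a proper
    class. *)
Lemma collapse : exists G, F1 G /\ (forall x, is_ord (G x)) /\
  (forall x z, z ∈ G x <-> exists y, y ∈ seg x /\ z = G y) /\
  (forall x y, D x -> D y -> G x = G y -> x = y).
Proof.
pose (Phi := fun x g : V => image (fun y => ap g y) (seg x)).
have DPhi : F2 Phi by unfold Phi; definability.
exists (rec seg Phi).
have DG := D_rec seg Phi Dseg DPhi.
have HG x z : z ∈ rec seg Phi x <-> exists y, y ∈ seg x /\ z = rec seg Phi y.
  rewrite rec_eq // {1}/Phi imageP; first by definability.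
  by split=> -[y [Hy ->]]; exists y; rewrite ap_lam.
have Hlt x y : y ∈ seg x -> rec seg Phi y ∈ rec seg Phi x by move=> Hy; apply/HG; exists y.
split=> //; split; [|split=> //].
- move=> x; split=> u v /HG [y [Hy ->]].
    by move=> /HG [z [Hz ->]]; apply/Hlt/(seg_trans x y).
  move=> /HG [z [Hz ->]].
  by case: (seg_tri y z (seg_D _ _ Hy) (seg_D _ _ Hz)) => [/Hlt|[->|/Hlt]]; auto.
- move=> x y Hx Hy E; case: (seg_tri x y Hx Hy) => [/Hlt|[//|/Hlt]]; rewrite E => /mem_irrefl [].
Qed.

End Collapse.

(** * Cardinals, clubs and enumerations *)

Section Cardinals.
Context {U : Universe} {HU : GBC U}.

Lemma equinumP (a b : V) : equinumerous a b <-> exists F, F1 F /\ (forall x, x ∈ a -> F x ∈ b) /\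
  (forall x y, x ∈ a -> y ∈ a -> F x = F y -> x = y) /\
  (forall y, y ∈ b -> exists x, x ∈ a /\ y = F x).
Proof.
split=> [[f Hf]|[F [DF [H1 [H2 H3]]]]]; last by exists (lam F a); apply: bij_lam.
exists (ap f); split; [by definability|split; [|split]].
- exact: (bij_ap f a b).
- exact: (bij_inj f a b).
- by move=> y /(bij_binv f a b Hf) [H1 H2]; exists (binv f y).
Qed.

Lemma equinum_sym (a b : V) : equinumerous a b -> equinumerous b a.
Proof.
move=> [f Hf]; apply/equinumP; exists (binv f); split; [by definability|split; [|split]].
- by move=> y /(bij_binv f a b Hf) [].
- by move=> x y /(bij_binv f a b Hf) [_ {2}<-] /(bij_binv f a b Hf) [_ {2}<-] ->.
- move=> x Hx; exists (ap f x); split; first exact: (bij_ap f a b).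
  by rewrite (bij_binv_ap f a b).
Qed.

Lemma equinum_trans (a b c : V) : equinumerous a b -> equinumerous b c -> equinumerous a c.
Proof.
move=> /equinumP [F [DF [F1 [F2 F3]]]] /equinumP [G [DG [G1 [G2 G3]]]].
apply/equinumP; exists (fun x => G (F x)); split; [by definability|split; [|split]].
- by move=> x /F1 /G1.
- by move=> x y Hx Hy /G2 E; apply: F2 => //; apply: E; apply: F1.
- by move=> z /G3 [y [/F3 [x [Hx ->]] ->]]; exists x.
Qed.

(** The collapse never raises an element ([Hle]), so the order type of [Y] is at most [l]. *)
Lemma sub_ord_type l Y : is_ord l -> (forall y, y ∈ Y -> y ∈ l) ->
  exists t, is_ord t /\ (t = l \/ t ∈ l) /\ equinumerous Y t.
Proof.
move=> Hl HY.
have HO y : y ∈ Y -> is_ord y by move=> /HY; apply: ord_mem.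
(* The clause [y ∈ Y] empties the segments of points outside [Y], where transitivity could fail. *)
pose (seg := fun y : V => setof (fun z => z ∈ Y /\ z ∈ y /\ y ∈ Y)).
have Dseg : F1 seg by unfold seg; definability.
have segP y z : z ∈ seg y <-> z ∈ Y /\ z ∈ y /\ y ∈ Y.
  apply: setof_spec; first by definability.
  by apply: (Small_sub (fun x => x ∈ Y)); [move=> u []|exact: Small_mem].
case: (collapse (fun x => x ∈ Y) seg Dseg).
  by move=> x y /segP [].
  move=> x y z; rewrite !segP => -[Hy [Hyx Hx]] [Hz [Hzy _]]; do !split=> //.
  by apply: (ord_trans x y) => //; apply: HO.
  move=> x y Hx Hy; rewrite !segP.
  by case: (ord_tri x y (HO x Hx) (HO y Hy)) => [|[|]]; auto.
  move=> P HP /(mem_min P HP) [x [Hx Hm]]; exists x; split=> // y /segP [_ [/Hm]] //.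
move=> G [DG [GO [GP Ginj]]].
have Hle y : y ∈ Y -> G y = y \/ G y ∈ y.
  move: y; apply: mem_ind; first by definability.
  move=> y IH Hy; apply: ord_sub => //; first exact: HO.
  move=> z /GP [w [/segP [Hw [Hwy _]] ->]].
  by case: (IH w Hwy Hw) => [->//|H]; apply: (ord_trans y w) => //; apply: HO.
have tP z : z ∈ image G Y <-> exists y, y ∈ Y /\ z = G y by apply: imageP.
have Ht : is_ord (image G Y).
  apply: ord_of_ords => [x /tP [y [_ ->]] //|x y /tP [u [Hu ->]] /GP [v [/segP [Hv _] ->]]].
  by apply/tP; exists v.
exists (image G Y); split=> //; split.
  apply: ord_sub => // x /tP [y [Hy ->]].
  by case: (Hle y Hy) => [->|H]; [apply: HY|apply: (ord_trans l y) => //; apply: HY].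
apply/equinumP; exists G; split=> //; split; [|split].
- by move=> x Hx; apply/tP; exists x.
- by move=> x y; apply: Ginj.
- by move=> y /tP.
Qed.

(** [is_cardinal] speaks of bijections with smaller ordinals; an injection into [l] gives one, with
    the order type of its range. *)
Lemma card_no_inj k l F : is_cardinal k -> l ∈ k -> F1 F -> (forall x, x ∈ k -> F x ∈ l) ->
  ~ (forall x y, x ∈ k -> y ∈ k -> F x = F y -> x = y).
Proof.
move=> [Hk Hc] Hl DF HF Hi.
case: (sub_ord_type l (image F k)); first exact: (ord_mem k).
  by move=> y /imageP [//|x [Hx ->]]; apply: HF.
move=> t [Ht [Htl E]].
apply: (Hc t); first by case: Htl => [->//|H]; apply: (ord_trans k l).
apply: equinum_sym; apply: (equinum_trans _ (image F k)) => //.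
apply/equinumP; exists F; split=> //; split; [|split=> //].
- by move=> x Hx; apply/imageP => //; exists x.
- by move=> y /imageP; apply.
Qed.

(** Restricted to the set [a], the global well-order collapses to an ordinal; the least ordinal
    equinumerous with [a] is then a cardinal. *)
Lemma card_exists a : exists k, has_card a k.
Proof.
pose (seg := fun y : V => setof (fun z => z ∈ a /\ y ∈ a /\ app W z y)).
have Dseg : F1 seg by unfold seg; definability.
have segP y z : z ∈ seg y <-> z ∈ a /\ y ∈ a /\ app W z y.
  apply: setof_spec; first by definability.
  by apply: (Small_sub (fun x => x ∈ a)); [move=> u []|exact: Small_mem].
case: (collapse (fun x => x ∈ a) seg Dseg).
  by move=> x y /segP [].
  move=> x y z; rewrite !segP => -[Hy [Hyx Hx]] [Hz [Hzy H]]; do !split=> //.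
  exact: (W_trans z y).
  by move=> x y Hx Hy; rewrite !segP; case: (W_tri x y) => [|[|]]; auto.
  move=> P HP /(W_min P HP) [x [Hx Hm]]; exists x; split=> // y /segP [_ [_ H]] /Hm //.
move=> G [DG [GO [GP Ginj]]].
have tP z : z ∈ image G a <-> exists y, y ∈ a /\ z = G y by apply: imageP.
have Ht : is_ord (image G a).
  apply: ord_of_ords => [x /tP [y [_ ->]] //|x y /tP [u [Hu ->]] /GP [v [/segP [Hv _] ->]]].
  by apply/tP; exists v.
case: (ord_min (fun k => equinumerous a k)); first by unfold equinumerous; definability.
{ exists (image G a); split=> //; apply/equinumP; exists G; split=> //; split; [|split].
  - by move=> x Hx; apply/tP; exists x.
  - by move=> x y; apply: Ginj.
  - by move=> y /tP. }
move=> k [Hk [E Hm]]; exists k; split=> //; split=> // b Hb Hbk; apply: (Hm b Hb).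
by apply: (equinum_trans _ k) => //; apply: equinum_sym.
Qed.

(** Cantor's argument, with [m] the cardinality of the power set of [K]: if [F] on [K] covered a set
    of size at least [m], elements of [K] would code all subsets of [K]. The bound is uniform in [Z]
    and [F], as an occurrence number requires. *)
Lemma cover_card K : exists m, is_cardinal m /\ forall Z F, F1 F ->
  (forall z, z ∈ Z -> exists n, n ∈ K /\ z = F n) -> card_lt Z m.
Proof.
case: (card_exists (power K)) => m [Hm Em]; exists m; split=> // Z F DF HF.
case: (card_exists Z) => l [Hl El]; exists l.
case: (classic (l ∈ m)) => [//|Hlm]; exfalso.
have Hml x : x ∈ m -> x ∈ l.
  case: (ord_tri l m (proj1 Hl) (proj1 Hm)) => [//|[->//|H]] Hx.
  exact: (ord_trans l m x (proj1 Hl)).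
case/equinumP: Em => B [DB [B1 [B2 _]]].
case/equinumP: (equinum_sym _ _ El) => G [DG [G1 [G2 _]]].
(* The diagonal set: those [n] that code a set [S] to which [n] does not belong. *)
case: (sep_ex K (fun n => exists S, S ∈ power K /\ G (B S) = F n /\ ~ n ∈ S)) => [|D HD].
  by definability.
have DP : D ∈ power K by apply/powerP => x /HD [].
case: (HF (G (B D))) => [|n [Hn E]]; first by apply: G1; apply: Hml; apply: B1.
have HnD : n ∈ D <-> ~ n ∈ D.
  split=> [/HD [_ [S [HS [ES HnS]]]]|H]; last by apply/HD; split=> //; exists D.
  suff <- : S = D by [].
  apply: B2 => //; apply: G2; [apply: Hml; apply: B1..|] => //.
  by rewrite ES.
tauto.
Qed.

(** In place of Cantor-Bernstein: a cardinality below [k] contradicts [card_no_inj] through [H], one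
    above [k] through [F]. *)
Lemma card_of_inj T k F H : is_cardinal k -> F1 F -> F1 H ->
  (forall x, x ∈ T -> F x ∈ k) -> (forall x y, x ∈ T -> y ∈ T -> F x = F y -> x = y) ->
  (forall x, x ∈ k -> H x ∈ T) -> (forall x y, x ∈ k -> y ∈ k -> H x = H y -> x = y) ->
  has_card T k.
Proof.
move=> Hk DF DH HF Fi HH Hi; case: (card_exists T) => l [Hl El].
case/equinumP: (El) => B [DB [B1 [B2 _]]].
case/equinumP: (equinum_sym _ _ El) => G [DG [G1 [G2 _]]].
case: (ord_tri l k (proj1 Hl) (proj1 Hk)) => [K|[<-//|K]]; exfalso.
- apply: (card_no_inj k l (fun x => B (H x))) => //; first by definability.
    by move=> x /HH /B1.
  by move=> x y Hx Hy /B2 E; apply: Hi => //; apply: E; apply: HH.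
- apply: (card_no_inj l k (fun x => F (G x))) => //; first by definability.
    by move=> x /G1 /HF.
  by move=> x y Hx Hy /Fi E; apply: G2 => //; apply: E; apply: G1.
Qed.

End Cardinals.

(** * Coding staged data by ordinals; clubs of closure points *)

Section Enumeration.
Context {U : Universe} {HU : GBC U}.

Lemma empset_ne_succ x : empset <> succ x.
Proof. by move=> E; apply: (empsetP x); rewrite E succP; right. Qed.

(* The global well-order need not be set-like; ordering by the first stage first, and
   only then by [W], is. *)
Lemma enumerate (E : V -> V) : F1 E -> exists G, F1 G /\ (forall x, is_ord (G x)) /\
  forall x y, (exists i, is_ord i /\ x ∈ E i) -> (exists i, is_ord i /\ y ∈ E i) ->
    G x = G y -> x = y.
Proof.
move=> DE.
pose (D := fun x : V => exists i, is_ord i /\ x ∈ E i).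
pose (st := fun x : V => least_ord (fun i => x ∈ E i)).
have DD : R1 D by unfold D; definability.
have Dst : F1 st by unfold st; definability.
have stP x : D x -> is_ord (st x) /\ x ∈ E (st x).
  by move=> Hx; case: (least_ord_spec (fun i => x ∈ E i)) => [|//|? []//]; definability.
pose (seg := fun x : V => setof (fun y => D y /\ D x /\ (st y ∈ st x \/ (st y = st x /\ app W y x)))).
have Dseg : F1 seg by unfold seg; definability.
have segP x y : y ∈ seg x <-> D y /\ D x /\ (st y ∈ st x \/ (st y = st x /\ app W y x)).
  apply: setof_spec; first by definability.
  exists (bigcup (image E (succ (st x)))) => z [Hz [Hx H]]; apply/bigcupP; exists (E (st z)).
  split; first by apply: (proj2 (stP z Hz)).
  by apply/imageP => //; exists (st z); split=> //; apply/succP; tauto.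
case: (collapse D seg Dseg).
  by move=> x y /segP [].
  move=> x y z; rewrite !segP => -[Hy [Hx H1]] [Hz [_ H2]]; do 2!split=> //.
  have Ho := proj1 (stP x Hx).
  case: H1 H2 => [H1|[<- H1]] [H2|[-> H2]]; auto.
    by left; apply: (ord_trans _ (st y)).
  by right; split=> //; apply: (W_trans z y).
  move=> x y Hx Hy; rewrite !segP.
  case: (ord_tri (st x) (st y) (proj1 (stP x Hx)) (proj1 (stP y Hy))) => [|[E1|]]; try tauto.
  by case: (W_tri x y) => [|[|]]; rewrite E1; tauto.
  move=> P HP [x0 Hx0].
  (* Outside [D] segments are empty, so such a point is minimal at once. *)
  case: (classic (D x0)) => [Dx0|Hn]; last first.
    by exists x0; split=> // y /segP [_ []].
  case: (ord_min (fun i => exists x, P x /\ D x /\ st x = i)); first by definability.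
    by exists (st x0); split; [case: (stP x0 Dx0)|exists x0].
  move=> i [Hi [[x1 Hx1] Hm]].
  case: (W_min (fun x => P x /\ D x /\ st x = i)); [by definability|by exists x1|].
  move=> x [[Px [Dx Ex]] Hx]; exists x; split=> // y /segP [Dy [_ [H|[H HW]]]] Py.
    by apply: (Hm (st y)); [rewrite -Ex|exists y].
  by apply: (Hx y) => //; rewrite H.
move=> G [DG [GO [GP Ginj]]]; exists G; split=> //; split=> // x y; exact: Ginj.
Qed.

Lemma succ_inj x y : succ x = succ y -> x = y.
Proof.
move=> E; have : x ∈ succ y by rewrite -E succP; right.
have : y ∈ succ x by rewrite E succP; right.
by rewrite !succP => -[H1|->//] [H2|->//]; case: (mem_asym x y).
Qed.

Lemma nat_rec a F : F1 F ->
  exists r, F1 r /\ r empset = a /\ forall n, is_nat n -> r (succ n) = F (r n).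
Proof.
(* Segments are empty off the natural numbers, which makes the relation transitive on all sets. *)
move=> DF; pose (seg := fun n : V => setof (fun m => m ∈ n /\ is_nat n)).
have segP n m : m ∈ seg n <-> m ∈ n /\ is_nat n.
  apply: setof_spec; first by definability.
  by apply: (Small_sub (fun x => x ∈ n)); [move=> u []|exact: Small_mem].
have Dseg : F1 seg by unfold seg; definability.
pose (Phi := fun n g : V => iota (fun y => (n = empset /\ y = a) \/
  exists m, is_nat m /\ n = succ m /\ y = F (ap g m))).
have DPhi : F2 Phi by unfold Phi; definability.
have segtr : forall x y z, y ∈ seg x -> z ∈ seg y -> z ∈ seg x.
  move=> x y z; rewrite !segP => -[Hy Hx] [Hz _]; split=> //.
  by apply: (ord_trans x y) => //; case: Hx.
have segmin : forall P, R1 P -> (exists x, P x) -> exists x, P x /\ forall y, y ∈ seg x -> ~ P y.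
  by move=> P HP /(mem_min P HP) [x [Hx Hm]]; exists x; split=> // y /segP [/Hm].
exists (rec seg Phi); have Dr : F1 (rec seg Phi) by exact: D_rec.
split=> //; split=> [|n Hn]; rewrite rec_eq //; apply: iota_eq.
- by left.
- by move=> z [[]//|[m [_ [/empset_ne_succ []]]]].
- right; exists n; do 2!split=> //; rewrite ap_lam //; apply/segP; split; last exact: nat_succ.
  by apply/succP; right.
- move=> z [[E _]|[m [_ [/succ_inj <- ->]]]]; first by case: (empset_ne_succ n).
  rewrite ap_lam //; apply/segP; split; last exact: nat_succ.
  by apply/succP; right.
Qed.

(** Unboundedness takes the limit of [omega] closure steps. With [B i] the codes of the data of
    stage [i], the data from stages below an element [k] of [K] are all coded below [k]. *)
Lemma club_closed (C : Cls) (B : V -> V) : club C -> F1 B ->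
  exists K : Cls, club K /\ forall k, K k -> C k /\ is_limit k /\
    (forall i y, i ∈ k -> y ∈ B i -> is_ord y -> y ∈ k) /\
    (forall i, i ∈ k -> exists b, C b /\ b ∈ k /\ i ∈ b).
Proof.
move=> [CO [Cunb Ccl]] DB.
have [K HK] : exists K : Cls, forall k, K k <-> is_limit k /\
    (forall i y, i ∈ k -> y ∈ B i -> is_ord y -> y ∈ k) /\
    (forall i, i ∈ k -> exists b, C b /\ b ∈ k /\ i ∈ b).
  by apply: comprehend; definability.
exists K; split; last first.
  by move=> k /HK [H1 [H2 H3]]; split=> //; apply: Ccl.
split; first by move=> k /HK [[]].
split; last first.
  move=> l Hl H; apply/HK; split=> //; split.
    move=> i y Hi Hy Hyo; case: (H i Hi) => b [/HK [_ [Hb _]] [Hbl Hib]].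
    by apply: (ord_trans l b) => //; [case: Hl|apply: (Hb i)].
  move=> i Hi; case: (H i Hi) => b [/HK [H1 [H2 H3]] [Hbl Hib]].
  by exists b; split=> //; apply: Ccl.
move=> a Ha.
(* One closure step from [g] to [h]; the element of [C] between them makes the limit of the steps a
   limit of [C]. *)
pose (Q := fun g h : V => (exists c, C c /\ g ∈ c /\ c ∈ h) /\ g ∈ h /\
  forall i y, i ∈ g -> y ∈ B i -> is_ord y -> y ∈ h).
pose (step := fun g : V => least_ord (Q g)).
have DQ : R2 Q by unfold Q; definability.
have Dstep : F1 step by unfold step; definability.
have stepP g : is_ord g -> is_ord (step g) /\ Q g (step g).
  move=> Hg; case: (least_ord_spec (Q g)) => [||? []//]; first by unfold Q; definability.
  case: (Cunb g Hg) => c [Hc Hgc].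
  case: (sep_ex (bigcup (image B g)) is_ord) => [|s Hs]; first by definability.
  case: (ord_bound (cup s (upair g c))) => [|b [Hb Hbb]].
    by move=> x /cupP [/Hs [] //|/upairP [->//|->]]; apply: CO.
  exists b; split=> //; split; last split.
    by exists c; split=> //; split=> //; apply: Hbb; rewrite cupP upairP; tauto.
    by apply: Hbb; rewrite cupP upairP; tauto.
  move=> i y Hi Hy Hyo; apply: Hbb; rewrite cupP; left; apply/Hs; split=> //.
  by apply/bigcupP; exists (B i); split=> //; apply/imageP => //; exists i.
(* Starting at [succ a] puts [a] itself below the limit. *)
case: (nat_rec (succ a) step Dstep) => r [Dr [r0 rS]].
have rO : forall n, is_nat n -> is_ord (r n).
  apply: nat_ind; [by definability|by rewrite r0; apply: ord_succ|] => n Hn IH; rewrite rS //.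
  by case: (stepP _ IH).
have kP x : x ∈ bigcup (image r omega) <-> exists n, is_nat n /\ x ∈ r n.
  rewrite bigcupP; split=> [[y [Hx /imageP]]|[n [Hn Hx]]].
    by case=> // n [/omegaP Hn E]; exists n; rewrite -E.
  by exists (r n); split=> //; apply/imageP => //; exists n; rewrite omegaP.
have kS n x : is_nat n -> x ∈ step (r n) -> x ∈ bigcup (image r omega).
  by move=> Hn Hx; apply/kP; exists (succ n); rewrite rS //; split=> //; apply: nat_succ.
have Hlim : forall i, i ∈ bigcup (image r omega) -> exists b, C b /\ b ∈ bigcup (image r omega) /\ i ∈ b.
  move=> i /kP [n [Hn Hi]]; case: (stepP _ (rO n Hn)) => Hso [[c [Hc [H1 H2]]] _].
  exists c; split=> //; split; first exact: (kS n).
  by apply: (ord_trans c (r n)) => //; apply: CO.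
have Hak : a ∈ bigcup (image r omega).
  apply/kP; exists empset; split; first exact: nat_empset.
  by rewrite r0 succP; right.
exists (bigcup (image r omega)); split=> //; apply/HK; split; last split=> //.
- split; first by apply: ord_bigcup => x /imageP [//|n [/omegaP Hn ->]]; apply: rO.
  split; first by exists a.
  by move=> i /Hlim [b [_ H]]; exists b.
- move=> i y /kP [n [Hn Hi]] Hy Hyo; apply: (kS n) => //.
  by case: (stepP _ (rO n Hn)) => _ [_ [_ H]]; apply: (H i).
Qed.

(** Subtlety for sets of arbitrary data: the injection [G] turns [B k] into a set of ordinals, and
    on a club these all lie below [k], so truncating at [k] loses nothing. Coherence of the codes
    becomes inclusion of the data. *)
Lemma subtle_data (C : Cls) (E B : V -> V) : Ord_subtle -> club C -> F1 E -> F1 B ->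
  (forall k x, C k -> is_limit k -> x ∈ B k -> exists i, i ∈ k /\ x ∈ E i) ->
  exists a b, C a /\ C b /\ is_limit a /\ is_limit b /\ a ∈ b /\ subset (B a) (B b).
Proof.
move=> Hsub HC DE DB HB.
case: (enumerate E DE) => G [DG [GO Gi]].
case: (club_closed C (fun i => image G (E i)) HC) => [|K [HK KP]]; first by definability.
pose (A0 := fun k : V => setof (fun y => y ∈ k /\ exists x, x ∈ B k /\ y = G x)).
have A0P k y : y ∈ A0 k <-> y ∈ k /\ exists x, x ∈ B k /\ y = G x.
  apply: setof_spec; first by definability.
  by apply: (Small_sub (fun x => x ∈ k)); [move=> u []|exact: Small_mem].
have DA0 : F1 A0 by unfold A0; definability.
have [A HA] : exists A : Cls, forall p, A p <-> exists k, is_ord k /\ p = opair k (A0 k).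
  by apply: comprehend; definability.
have appA x y : app A x y <-> is_ord x /\ y = A0 x.
  by rewrite appE HA; split=> [[k [Hk /opair_inj [-> ->]]]|[Hx ->]]; [|exists x].
case: (Hsub K A HK).
  split=> [p /HA [k [Hk ->]]|x Hx]; first by exists k, (A0 k); rewrite is_opairE.
  by exists (A0 x); split=> [|y]; rewrite appA // => -[].
  by move=> k s /appA [_ ->] x /A0P [].
move=> a [b [s [t [Ka [Kb [Hab [/appA [_ ->] [/appA [_ ->] H]]]]]]]].
case: (KP a Ka) => Ca [La [Hcl _]]; case: (KP b Kb) => Cb [Lb _].
exists a, b; do 5!split=> //; move=> x Hx.
case: (HB a x Ca La Hx) => i [Hi HxE].
have Hxa : G x ∈ A0 a.
  apply/A0P; split; last by exists x.
  by apply: (Hcl i) => //; apply/imageP => //; exists x.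
case: (proj1 (H _) Hxa) => /A0P [_ [x' [Hx' Ex]]] _.
suff -> : x = x' by [].
apply: Gi => //; first by exists i; split=> //; apply: (ord_mem a) => //; case: La.
case: (HB b x' Cb Lb Hx') => j [Hj HxE']; exists j; split=> //.
by apply: (ord_mem b) => //; case: Lb.
Qed.

End Enumeration.

(** * Languages and structures *)

Section Definable.
Context {U : Universe} {HU : GBC U}.
Lemma D_rel_sig : R2 rel_sig. Proof. unfold rel_sig; definability. Qed.
Lemma D_fun_sig : R2 fun_sig. Proof. unfold fun_sig; definability. Qed.
Lemma D_equinumerous : R2 equinumerous. Proof. unfold equinumerous; definability. Qed.
Lemma D_is_triple : R4 is_triple. Proof. unfold is_triple; definability. Qed.
Lemma D_is_tuple : R3 is_tuple. Proof. unfold is_tuple; definability. Qed.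
End Definable.

Ltac def_known5 := first [ def_known4
 | lazymatch goal with |- DefP (fun e => rel_sig _ _) => apply (DefP_rel2 rel_sig _ _ D_rel_sig) end | lazymatch goal with |- DefP (fun e => fun_sig _ _) => apply (DefP_rel2 fun_sig _ _ D_fun_sig) end
 | lazymatch goal with |- DefP (fun e => equinumerous _ _) => apply (DefP_rel2 equinumerous _ _ D_equinumerous) end
 | lazymatch goal with |- DefP (fun e => is_triple _ _ _ _) => apply (DefP_rel4 is_triple _ _ _ _ D_is_triple) end
 | lazymatch goal with |- DefP (fun e => is_tuple _ _ _) => apply (DefP_rel3 is_tuple _ _ _ D_is_tuple) end ].
Ltac def_known ::= def_known5.

Section Definable2.
Context {U : Universe} {HU : GBC U}.
Lemma D_is_cardinal : R1 is_cardinal. Proof. unfold is_cardinal; definability. Qed.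
Lemma D_is_lang : R1 is_lang. Proof. unfold is_lang; definability. Qed.
End Definable2.

Ltac def_known6 := first [ def_known5
 | lazymatch goal with |- DefP (fun e => is_cardinal _) => apply (DefP_rel1 is_cardinal _ D_is_cardinal) end | lazymatch goal with |- DefP (fun e => is_lang _) => apply (DefP_rel1 is_lang _ D_is_lang) end ].
Ltac def_known ::= def_known6.

Section Definable3.
Context {U : Universe} {HU : GBC U}.
Lemma D_has_card : R2 has_card. Proof. unfold has_card; definability. Qed.
Lemma D_is_structure : R2 is_structure. Proof. unfold is_structure; definability. Qed.
Lemma D_is_renaming : R3 is_renaming. Proof. unfold is_renaming; definability. Qed.
Lemma D_is_renamed : R3 is_renamed. Proof. unfold is_renamed; definability. Qed.
End Definable3.

Ltac def_known7 := first [ def_known6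
 | lazymatch goal with |- DefP (fun e => has_card _ _) => apply (DefP_rel2 has_card _ _ D_has_card) end | lazymatch goal with |- DefP (fun e => is_structure _ _) => apply (DefP_rel2 is_structure _ _ D_is_structure) end
 | lazymatch goal with |- DefP (fun e => is_renaming _ _ _) => apply (DefP_rel3 is_renaming _ _ _ D_is_renaming) end | lazymatch goal with |- DefP (fun e => is_renamed _ _ _) => apply (DefP_rel3 is_renamed _ _ _ D_is_renamed) end ].
Ltac def_known ::= def_known7.

Section Structures.
Context {U : Universe} {HU : GBC U}.

Lemma D_card_lt : R2 card_lt. Proof. unfold card_lt; definability. Qed.

Lemma rel_sigE t n : rel_sig t n <-> is_nat n /\ t = opair empset n.
Proof.
split=> [[Hn [k [/is_emptyE -> /is_opairE ->]]] //|[Hn ->]]; split=> //.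
by exists empset; rewrite is_emptyE is_opairE.
Qed.
Lemma fun_sigE t n : fun_sig t n <-> is_nat n /\ t = opair (succ empset) n.
Proof.
split=> [[Hn [e [k [/is_emptyE -> [/is_succE -> /is_opairE ->]]]]] //|[Hn ->]]; split=> //.
by exists empset, (succ empset); rewrite is_emptyE is_succE is_opairE.
Qed.

Lemma app_sub (a b x y : V) : subset a b -> app a x y -> app b x y.
Proof. by move=> H; rewrite !appE; apply: H. Qed.

Definition tri t D I := opair t (opair D I).
Lemma is_tripleE M t D I : is_triple M t D I <-> M = tri t D I.
Proof.
split=> [[q [/is_opairE -> /is_opairE ->]] //|->].
by exists (opair D I); rewrite !is_opairE.
Qed.
Lemma tri_inj t D I t' D' I' : tri t D I = tri t' D' I' <-> t = t' /\ D = D' /\ I = I'.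
Proof. by rewrite /tri !opair_inj. Qed.
Lemma D_tri : F3 tri. Proof. unfold tri; definability. Qed.

Definition symset t := setof (sym t).
Lemma symsetP t s : s ∈ symset t <-> sym t s.
Proof.
apply: setof_spec; first by definability.
exists (bigcup (bigcup t)) => x [y /appE Hxy]; apply/bigcupP; exists (sing x); split; first exact/singP.
by apply/bigcupP; exists (opair x y); split=> //; exact: opair_fst.
Qed.
Lemma D_symset : F1 symset. Proof. unfold symset; definability. Qed.

Lemma sublang t t0 : is_lang t -> subset t0 t -> is_lang t0.
Proof.
move=> [[H1 H2] H3] Hs.
have Ha s x : app t0 s x -> app t s x by rewrite !appE; apply: Hs.
split; last by move=> s x /Ha; apply: H3.
split=> [p Hp|s [x Hx]].
  case: (H1 p (Hs p Hp)) => s [x [/is_opairE E _]]; exists s, x; rewrite is_opairE; split=> //.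
  by exists x; rewrite appE -E.
exists x; split=> // y Hy; case: (H2 s) => [|z [_ Hz]]; first by exists x; apply: Ha.
by rewrite -(Hz _ (Ha _ _ Hx)) -(Hz _ (Ha _ _ Hy)).
Qed.

Definition okint t D i := forall n, (rel_sig t n -> forall v, v ∈ i -> is_tuple n D v) /\
  (fun_sig t n -> is_fun i (is_tuple n D) /\ forall v x, app i v x -> x ∈ D).

Lemma structP (t D I t' : V) : is_structure (tri t D I) t' <->
  t' = t /\ is_lang t /\ (exists x, x ∈ D) /\ is_fun I (sym t) /\
  forall s u, app t s u -> okint u D (ap I s).
Proof.
split.
  move=> [Ht [D1 [I1 [/is_tripleE /tri_inj [-> [-> ->]] [HD [HI H]]]]]].
  do 4!split=> //; move=> s u Hsu n; apply: (H s u) => //.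
  by apply: (ap_app I1 (sym t')) => //; exists u.
move=> [-> [Ht [HD [HI H]]]]; split=> //; exists D, I; rewrite is_tripleE.
do 3!split=> //; move=> s u i n Hsu /(app_ap I (sym t) _ _ HI) ->.
exact: H.
Qed.

Lemma structE M t : is_structure M t -> exists D I, M = tri t D I.
Proof. by move=> [_ [D [I [/is_tripleE -> _]]]]; exists D, I. Qed.

Lemma mkstr t D F : is_lang t -> (exists x, x ∈ D) -> F1 F ->
  (forall s u, app t s u -> okint u D (F s)) ->
  is_structure (tri t D (lam F (symset t))) t.
Proof.
move=> Ht HD DF H; apply/structP; do 3!split=> //.
  split; first by apply: is_fun_lam => // x; rewrite symsetP.
by move=> s u Hs; rewrite ap_lam //; [apply/symsetP; exists u|apply: H].
Qed.

Lemma is_fun_lam_sym F t : F1 F -> is_fun (lam F (symset t)) (sym t).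
Proof. by move=> DF; apply: is_fun_lam => // x; rewrite symsetP. Qed.

Lemma is_reductE (t D I s E J : V) : is_fun I (sym t) -> is_fun J (sym s) -> subset t s ->
  is_reduct (tri t D I) (tri s E J) <-> D = E /\ forall x, sym t x -> ap I x = ap J x.
Proof.
move=> HI HJ Hts.
have Hs x : sym t x -> sym s x by move=> [y /appE /Hts H]; exists y; apply/appE.
split.
  move=> [t1 [s1 [D1 [I1 [J1 [/is_tripleE /tri_inj [<- [<- <-]] [/is_tripleE /tri_inj [_ [-> <-]] H]]]]]]].
  split=> // x Hx; apply: (app_ap J (sym s)) => //.
  by apply/H => //; apply: (ap_app I (sym t)).
move=> [-> H]; exists t, s, E, I, J; rewrite !is_tripleE; do 2!split=> //.
move=> x i Hx; rewrite (appP I (sym t)) // (appP J (sym s)) // H //.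
by split=> -[_ ->]; split; auto.
Qed.

Lemma reduct_structure (t t0 D I : V) : is_structure (tri t D I) t -> subset t0 t ->
  is_structure (tri t0 D (lam (fun s => ap I s) (symset t0))) t0 /\
  is_reduct (tri t0 D (lam (fun s => ap I s) (symset t0))) (tri t D I).
Proof.
move=> /structP [_ [Ht [HD [HI H]]]] Hs.
have Da : F1 (fun s => ap I s) by definability.
split.
  apply: mkstr => //; first exact: (sublang t).
  by move=> s u /appE /Hs Hsu; apply: H; rewrite appE.
apply/is_reductE => //; first exact: is_fun_lam_sym.
by split=> // x /symsetP Hx; rewrite ap_lam.
Qed.

(** The default interpretation of a symbol with signature [u]: the constant function [d] for a
    function symbol, the empty relation for a relation symbol, for which [fun_sig u n] fails. *)
Definition defint u D d := setof (fun w => exists n v, fun_sig u n /\ is_tuple n D v /\ w = opair v d).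

Lemma tuple_cartesian n D v : is_tuple n D v -> subset v (cartesian n D).
Proof.
move=> [[H1 _] H2] p Hp; case: (H1 p Hp) => i [x [/is_opairE E Hi]].
by rewrite E pair_cartesian; split=> //; apply: (H2 i); apply/appE; rewrite -E.
Qed.

Lemma defintP u D d w : w ∈ defint u D d <-> exists n v, fun_sig u n /\ is_tuple n D v /\ w = opair v d.
Proof.
apply: setof_spec; first by definability.
case: (classic (exists n, fun_sig u n)) => [[n Hn]|H]; last first.
  by exists empset => x [n [v [Hn _]]]; case: H; exists n.
exists (image (fun v => opair v d) (power (cartesian n D))) => x [n' [v [Hn' [Hv ->]]]].
apply/imageP; first by definability.
exists v; split=> //; apply/powerP.
suff <- : n' = n by exact: tuple_cartesian.
by move: Hn Hn'; rewrite !fun_sigE => -[_ ->] [_ /opair_inj [_ ->]].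
Qed.

Lemma D_defint : F3 defint.
Proof. unfold defint; definability. Qed.

Lemma okint_def u D d : d ∈ D -> okint u D (defint u D d).
Proof.
move=> Hd n; split.
  move=> /rel_sigE [_ ->] v /defintP [n' [w [/fun_sigE [_ /opair_inj [/empset_ne_succ []]]]]].
move=> Hn; have K v x : app (defint u D d) v x <-> is_tuple n D v /\ x = d.
  rewrite appE /set_ext defintP; split=> [[n' [w [Hn' [Hw /opair_inj [-> ->]]]]]|[Hv ->]]; last first.
    by exists n, v.
  suff <- : n' = n by [].
  by move: Hn Hn'; rewrite !fun_sigE => -[_ ->] [_ /opair_inj [_ ->]].
split; last by move=> v x /K [_ ->].
split=> [p /defintP [n' [w [Hn' [Hw E]]]]|v Hv].
  exists w, d; rewrite is_opairE; split=> //.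
  suff <- : n' = n by [].
  by move: Hn Hn'; rewrite !fun_sigE => -[_ ->] [_ /opair_inj [_ ->]].
by exists d; split=> [|y]; rewrite K // => -[].
Qed.

Definition ifp (P : Prop) (a b : V) := iota (fun z => (P /\ z = a) \/ (~ P /\ z = b)).
Lemma ifpT (P : Prop) a b : P -> ifp P a b = a.
Proof. by move=> H; apply: iota_eq; [left|move=> z [[_ ->]|[]]]. Qed.
Lemma ifpF (P : Prop) a b : ~ P -> ifp P a b = b.
Proof. by move=> H; apply: iota_eq; [right|move=> z [[]|[_ ->]]]. Qed.

Lemma DefT_ifp (P : (nat -> V) -> Prop) a b : DefP P -> DefT a -> DefT b ->
  DefT (fun e => ifp (P e) (a e) (b e)).
Proof.
move=> HP Ha Hb.
apply (DefT_iota (fun e z => (P e /\ z = a e) \/ (~ P e /\ z = b e))).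
have HP' := DefP_ren S _ HP; have Ha' := DefT_weak _ Ha; have Hb' := DefT_weak _ Hb.
apply DefP_or; apply DefP_and => //; exact (DefP_not _ HP').
Qed.

End Structures.

Ltac def_known8 := first [ def_known7
 | lazymatch goal with |- DefT (fun e => ifp (@?P e) (@?a e) (@?b e)) => apply (DefT_ifp P a b) end; cbv beta
 | lazymatch goal with |- DefP (fun e => card_lt _ _) => apply (DefP_rel2 card_lt _ _ D_card_lt) end | lazymatch goal with |- DefT (fun e => tri _ _ _) => apply (DefT_fun3 tri _ _ _ D_tri) end
 | lazymatch goal with |- DefT (fun e => symset _) => apply (DefT_fun1 symset _ D_symset) end | lazymatch goal with |- DefT (fun e => defint _ _ _) => apply (DefT_fun3 defint _ _ _ D_defint) end ].
Ltac def_known ::= def_known8.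
Ltac def_unfold ::= unfold is_upair, is_opair, app, is_succ, is_empty, subset,
  class_well_order, is_fun, is_bij, is_ord, sym, cup, sing, succ, image, lam, is_theory, okint.

(** * Subtlety yields weak compactness cardinals *)

Ltac def_unfold ::= unfold is_upair, is_opair, app, is_succ, is_empty, subset,
  class_well_order, is_fun, is_bij, is_ord, sym, cup, sing, succ, image, lam, is_theory, okint,
  sentence, has_model.

Section Forward.
Context {U : Universe} {HU : GBC U}.
Context (L Sat : Cls) (HL : is_logic L Sat).

Lemma D_wcc : R1 (weak_compactness_cardinal L Sat).
Proof. unfold weak_compactness_cardinal. definability. Qed.

Let one := succ empset.

(* Sentences are renamed one at a time, each over its own small language [t0]: the
   renaming axiom says nothing on how the bijection [L(t) -> L(s)] acts on sentences of
   sublanguages of [t]. *)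
Definition entry (tau c f i sg psi : V) : Prop := exists t0 f0 phi : V,
  subset t0 tau /\ app c phi i /\ sentence L t0 phi /\ sentence L sg psi /\
  is_renaming f0 t0 sg /\ (forall s s', app f0 s s' -> app f s s') /\
  forall M N, is_structure M t0 -> is_structure N sg -> is_renamed f0 M N ->
    (app Sat M phi <-> app Sat N psi).

(** A counterexample at the cardinal [k], with [c] indexing its sentences and [f] naming its symbols
    injectively. Only [B] is passed to subtlety: for each index it holds a renamed sentence with its
    language, tagged by [one]. The other sets are not coded below [k] and stay existentially
    quantified. *)
Definition card_data (k B : V) : Prop := is_cardinal k /\ exists tau T c f : V,
  is_lang tau /\ is_theory L tau T /\ is_bij c T k /\
  (forall T0, subset T0 T -> card_lt T0 k -> has_model Sat tau T0) /\
  ~ has_model Sat tau T /\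
  (forall s s1 y, app f s y -> app f s1 y -> s = s1) /\
  (forall s y y1, app f s y -> app f s y1 -> y = y1) /\
  (forall x, x ∈ B -> exists i sg psi, i ∈ k /\ x = opair one (opair i (opair sg psi)) /\
     entry tau c f i sg psi) /\
  (forall i, i ∈ k -> exists sg psi, opair one (opair i (opair sg psi)) ∈ B).

(** Each item repeats the domain [a], so that inclusion between two such sets forces equal
    domains. *)
Definition noncard_data (k B : V) : Prop := exists a f : V, a ∈ k /\ is_bij f a k /\
  forall x, x ∈ B <-> exists p, p ∈ f /\ x = opair empset (opair a p).

Lemma sentence_lang t phi : sentence L t phi -> is_lang t.
Proof. by move=> [S [H _]]; apply: (is_fun_app L is_lang t S) => //; case: HL. Qed.

(** A model of the first [a] sentences at [b] is transported to the language at [a] by matching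
    symbols of the same name. The truth of each sentence at [a] is then traced through its small
    language, the common renamed sentence [psi], and the small language on the side of [b]. *)
Lemma card_data_conflict a b B B' : a ∈ b -> card_data a B -> card_data b B' -> ~ subset B B'.
Proof.
move=> Hab [Ca [tau [T [c [f [Htau [HT [Hc [_ [Hno [fi [ff [HB1 HB2]]]]]]]]]]]]].
move=> [Cb [tau' [T' [c' [f' [Htau' [HT' [Hc' [Hsm [_ [fi' [ff' [HB1' HB2']]]]]]]]]]]]] Hsub.
(* [T0] has size exactly [a], as [a] is a cardinal, and is small because [a ∈ b]. *)
case: (sep_ex T' (fun phi => ap c' phi ∈ a)) => [|T0 HT0]; first by definability.
have [M' [HM' Hsat]] : has_model Sat tau' T0.
  apply: Hsm => [x /HT0 [] //|]; exists a; split=> //; split=> //.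
  exists (lam (ap c') T0); apply: bij_lam => //; first by definability.
  by move=> x /HT0 [].
  by move=> x y /HT0 [Hx _] /HT0 [Hy _]; apply: (bij_inj c' T' b).
  move=> y Hy; have Hyb := ord_trans b a y (proj1 Cb) Hab Hy.
    case: (bij_binv c' T' b Hc' y Hyb) => H1 H2; exists (binv c' y); rewrite H2; split=> //.
    by apply/HT0; rewrite H2.
case: (structE _ _ HM') => D [I' EM']; rewrite EM' in HM' Hsat.
case/structP: (HM') => _ [_ [[d Hd] [HI' HokI']]].
(* Symbols of the two languages having the same name. *)
pose (link := fun s s1 : V => exists y, app f s y /\ app f' s1 y).
(* A symbol without a partner of the same name and signature gets the default; the small languages
   [t0] below contain no such symbol. *)
pose (F := fun s : V => ifp (exists s1, link s s1 /\ app tau' s1 (ap tau s))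
                       (ap I' (iota (link s))) (defint (ap tau s) D d)).
have DF : F1 F by unfold F, link; definability.
have linkE s s1 : link s s1 -> iota (link s) = s1.
  move=> H; apply: iota_eq => // s2 [y2 [H1 H2]]; case: H => y [H3 H4].
  by apply: (fi' s2 s1 y) => //; rewrite (ff s y y2).
have HM : is_structure (tri tau D (lam F (symset tau))) tau.
  apply: mkstr => //; first by exists d.
  move=> s u Hsu; have Eu : u = ap tau s by apply: (app_ap tau (sym tau)) => //; case: Htau.
  case: (classic (exists s1, link s s1 /\ app tau' s1 (ap tau s))) => H.
    by rewrite /F ifpT //; case: H => s1 [/linkE -> H]; apply: HokI'; rewrite Eu.
  by rewrite /F ifpF // Eu; apply: okint_def.
apply: Hno; exists (tri tau D (lam F (symset tau))); split=> // phi Hphi.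
have Hia : ap c phi ∈ a by apply: (bij_ap c T a).
set i := ap c phi in Hia.
case: (HB2 i Hia) => sg [psi Hin].
case: (HB1 _ Hin) => i0 [sg0 [psi0 [_ [/opair_inj [_ /opair_inj [<- /opair_inj [<- <-]]]]]]].
move=> [t0 [f0 [phi0 [Ht0 [Hphi0 [Hst0 [Hspsi [Hf0 [Hf0f Heq0]]]]]]]]].
have E0 : phi0 = phi.
  case/(appP c T _ _ (bij_fun _ _ _ Hc)): Hphi0 => H1 H2.
  by apply: (bij_inj c T a Hc).
rewrite {}E0 {Hphi0} in Hst0 Heq0.
case: (HB1' _ (Hsub _ Hin)) => i1 [sg1 [psi1 [_ [/opair_inj [_ /opair_inj [<- /opair_inj [<- <-]]]]]]].
move=> [t1 [f1 [phi1 [Ht1 [Hphi1 [Hst1 [_ [Hf1 [Hf1f Heq1]]]]]]]]].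
have Hphi1T : phi1 ∈ T0.
  case/(appP c' T' _ _ (bij_fun _ _ _ Hc')): Hphi1 => H1 H2.
  by apply/HT0; split=> //; rewrite -H2.
have Hsg := sentence_lang _ _ Hspsi.
case: (reduct_structure tau' t1 D I' HM' Ht1) => HM1 Hred1.
case: (reduct_structure tau t0 D (lam F (symset tau)) HM Ht0) => HM0 Hred0.
case: (Hf0) => Bf0 Rf0; case: (Hf1) => Bf1 Rf1.
(* [J] interprets a name by the symbol of [t1] that carries it. The resulting [sg]-structure is a
   renaming both of the new model reduced to [t0] and of the given model reduced to [t1]. *)
pose (J := fun s' : V => ap I' (binv f1 s')).
have DJ : F1 J by unfold J; definability.
have f1P s' : sym sg s' -> sym t1 (binv f1 s') /\ app f1 (binv f1 s') s'.
  move=> Hs'; case: (bij_binv f1 _ _ Bf1 s' Hs') => H1 H2; split=> //.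
  by apply/(appP f1 (sym t1)); [case: Bf1|split].
have HN : is_structure (tri sg D (lam J (symset sg))) sg.
  apply: mkstr => //; first by exists d.
  move=> s' u Hsu; have Hs' : sym sg s' by exists u.
  case: (f1P s' Hs') => H1 H2; apply: (HokI' (binv f1 s')).
  by apply: (app_sub _ _ _ _ Ht1); apply/(Rf1 _ _ u H2).
apply: (proj2 (logic_reduct L Sat HL t0 tau _ _ phi Ht0 HM HM0 Hred0 Hst0)).
apply: (proj2 (Heq0 _ (tri sg D (lam J (symset sg))) HM0 HN _)).
  exists t0, sg, D, (lam (fun s => ap (lam F (symset tau)) s) (symset t0)), (lam J (symset sg)).
  split; [exact/is_tripleE|split; [exact/is_tripleE|]] => s s' x Hs.
  rewrite !app_lam //; first by definability.
  have [Hs0 Hs'] : sym t0 s /\ sym sg s'.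
    by case/(appP f0 (sym t0) _ _ (bij_fun _ _ _ Bf0)): (Hs) => H ->; split=> //; apply: (bij_ap f0 (sym t0)).
  case: (f1P s' Hs') => H1 H2.
  have [u Hu] := Hs0; have Hut : app tau s u by apply: (app_sub _ _ _ _ Ht0).
  have Eu : u = ap tau s by apply: (app_ap tau (sym tau)) => //; case: Htau.
  have Hl : link s (binv f1 s') by exists s'; split; auto.
  have Hl2 : app tau' (binv f1 s') (ap tau s).
    by rewrite -Eu; apply: (app_sub _ _ _ _ Ht1); apply/(Rf1 _ _ u H2)/(Rf0 _ _ u Hs).
  rewrite !symsetP ap_lam //; first by apply/symsetP; exists u.
  rewrite /F ifpT; first by exists (binv f1 s').
  by rewrite (linkE _ _ Hl) /J; tauto.
apply: (proj1 (Heq1 _ (tri sg D (lam J (symset sg))) HM1 HN _)).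
  exists t1, sg, D, (lam (fun s => ap I' s) (symset t1)), (lam J (symset sg)).
  split; [exact/is_tripleE|split; [exact/is_tripleE|]] => s s' x Hs.
  rewrite !app_lam //; first by definability.
  case/(appP f1 (sym t1) _ _ (bij_fun _ _ _ Bf1)): (Hs) => Hs1 Es'.
  have Hs' : sym sg s' by rewrite Es'; apply: (bij_ap f1 (sym t1)).
  rewrite !symsetP /J {2}Es' (bij_binv_ap f1 (sym t1) (sym sg)) //; tauto.
apply: (proj1 (logic_reduct L Sat HL t1 tau' _ _ phi1 Ht1 HM' HM1 Hred1 Hst1)).
exact: Hsat.
Qed.

(** The tags exclude the mixed cases; as [a] is a limit, [empset ∈ a] provides an item to inspect.
    If neither is a cardinal, the two bijections have the same domain and agree on it, so the one
    onto [b] never takes the value [a], although [a ∈ b]. *)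
Lemma data_conflict a b B B' : is_limit a -> a ∈ b ->
  card_data a B \/ noncard_data a B -> card_data b B' \/ noncard_data b B' -> ~ subset B B'.
Proof.
move=> La Hab [Ha|Ha] [Hb|Hb] Hsub.
- exact: (card_data_conflict a b B B').
- case: Ha => _ [tau [T [c [f [_ [_ [_ [_ [_ [_ [_ [_ H]]]]]]]]]]]].
  case: (H empset (limit_empset a La)) => sg [psi /Hsub]; case: Hb => a' [f' [_ [_ Hb]]] /Hb.
  by move=> [p [_ /opair_inj [/(fun E => eq_sym E) /empset_ne_succ []]]].
- case: Ha => a1 [f1 [Ha1 [Hf1 H1]]]; case: Hb => _ [tau [T [c [f [_ [_ [_ [_ [_ [_ [_ [H _]]]]]]]]]]]].
  case: (bij_binv f1 a1 a Hf1 empset (limit_empset a La)) => K1 _.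
  have : app f1 (binv f1 empset) (ap f1 (binv f1 empset)) by apply: (ap_app f1 a1) => //; case: Hf1.
  move=> /appE Hp.
  case: (H (opair empset (opair a1 (opair (binv f1 empset) (ap f1 (binv f1 empset)))))).
    by apply/Hsub/H1; exists (opair (binv f1 empset) (ap f1 (binv f1 empset))).
  by move=> i [sg [psi [_ [/opair_inj [/empset_ne_succ []]]]]].
- case: Ha => a1 [f1 [Ha1 [Hf1 H1]]]; case: Hb => a2 [f2 [Ha2 [Hf2 H2]]].
  have K x y : app f1 x y -> a1 = a2 /\ app f2 x y.
    move=> /appE Hp; have : opair empset (opair a1 (opair x y)) ∈ B' by apply/Hsub/H1; exists (opair x y).
    by move=> /H2 [p [Hp2 /opair_inj [_ /opair_inj [-> Ep]]]]; split=> //; apply/appE; rewrite Ep.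
  case: (bij_binv f1 a1 a Hf1 empset (limit_empset a La)) => K1 _.
  case: (K (binv f1 empset) (ap f1 (binv f1 empset))) => [|E12 _].
    by apply: (ap_app f1 a1) => //; case: Hf1.
  case: (bij_binv f2 a2 b Hf2 a Hab) => K2 K3.
  have Hx : binv f2 a ∈ a1 by rewrite E12.
  case: (K (binv f2 a) (ap f1 (binv f2 a))) => [|_].
    by apply: (ap_app f1 a1) => //; case: Hf1.
  move=> /(app_ap f2 a2 _ _ (bij_fun _ _ _ Hf2)); rewrite K3 => E.
  by case: (mem_irrefl a); rewrite -{1}E; apply: (bij_ap f1 a1 a).
Qed.

Context (o : V) (Ho : occurrence_number L o).

Let Sig := cartesian (upair empset one) omega.
(** A name is a pair of an index and a position below the occurrence number [o]; the languages of
    names with indices below [i] are subsets of [X i]. *)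
Let X i := cartesian (cartesian i o) Sig.
Definition stage (i : V) : V :=
  cup (cartesian (sing empset) (cartesian i (cartesian i i)))
      (cartesian (sing one) (cartesian i (cartesian (power (X i)) (bigcup (image (apc L) (power (X i))))))).
Lemma D_stage : F1 stage. Proof. unfold stage, X. definability. Qed.

Lemma noncard_ex k : is_limit k -> ~ is_cardinal k ->
  exists B, noncard_data k B /\ forall x, x ∈ B -> exists i, i ∈ k /\ x ∈ stage i.
Proof.
move=> Lk Hk; have Ok : is_ord k by case: Lk.
have [a [f [Ha Hf]]] : exists a f : V, a ∈ k /\ is_bij f a k.
  by apply: NNPP => K; apply: Hk; split=> // a Ha [f Hf]; apply: K; exists a, f.
have HB x : x ∈ image (fun p => opair empset (opair a p)) f <-> exists p, p ∈ f /\ x = opair empset (opair a p).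
  by apply: imageP; definability.
exists (image (fun p => opair empset (opair a p)) f); split; first by exists a, f.
move=> x /HB [p [Hp ->]]; case: (Hf) => -[H1 _] [H2 _].
case: (H1 p Hp) => u [v [/is_opairE E Hu]].
have Hv : v ∈ k by apply: (H2 u); apply/appE; rewrite -E.
have [i [Hi [Hai Hvi]]] : exists i, i ∈ k /\ a ∈ i /\ v ∈ i.
  have Oa : is_ord a by apply: (ord_mem k). have Ov : is_ord v by apply: (ord_mem k).
  case: (ord_tri a v Oa Ov) => [H|[H|H]].
  exists (succ v); rewrite !succP; split; [exact: limit_succ|tauto].
  exists (succ v); rewrite !succP; split; [exact: limit_succ|tauto].
  exists (succ a); rewrite !succP; split; [exact: limit_succ|tauto].
exists i; split=> //; rewrite /stage cupP E; left; rewrite !pair_cartesian singP.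
do 3!split=> //; exact: (ord_trans i a u (ord_mem k i Ok Hi)).
Qed.

Lemma card_ex k : is_limit k -> is_cardinal k -> ~ weak_compactness_cardinal L Sat k ->
  exists B, card_data k B /\ forall x, x ∈ B -> exists i, i ∈ k /\ x ∈ stage i.
Proof.
move=> Lk Ck Hk; have Ok : is_ord k by case: Lk.
have [tau [T [Htau [HT [[_ [c Hc]] [Hsm Hno]]]]]] : exists tau T, is_lang tau /\
    is_theory L tau T /\ has_card T k /\
    (forall T0, subset T0 T -> card_lt T0 k -> has_model Sat tau T0) /\ ~ has_model Sat tau T.
  apply: NNPP => K; apply: Hk; split=> // tau T H1 H2 H3 H4; apply: NNPP => H5.
  by apply: K; exists tau, T.
case: Ho => Co [Hb _].
pose (t := fun phi : V => W_least (fun t0 => subset t0 tau /\ card_lt t0 o /\ sentence L t0 phi)).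
have Dtt : F1 t by unfold t; definability.
(* [e phi] numbers the elements of [t phi], which are pairs of a symbol and its signature; hence the
   argument [opair s (ap tau s)] in [name]. *)
pose (e := fun phi : V => W_least (fun e => exists l, l ∈ o /\ is_bij e (t phi) l)).
have De : F1 e by unfold e; definability.
have tP phi : phi ∈ T -> subset (t phi) tau /\ card_lt (t phi) o /\ sentence L (t phi) phi.
  move=> Hphi; apply: (W_least_spec (fun t0 => subset t0 tau /\ card_lt t0 o /\ sentence L t0 phi)).
    by definability.
  by apply: Hb => //; apply: HT.
have eP phi : phi ∈ T -> exists l : V, l ∈ o /\ is_bij (e phi) (t phi) l.
  move=> Hphi; apply: (W_least_spec (fun e => exists l, l ∈ o /\ is_bij e (t phi) l)).
    by definability.
  by case: (tP phi Hphi) => _ [[l [Hl [_ [g Hg]]]] _]; exists g, l.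
pose (idx := fun s : V => least_ord (fun i => exists phi, app c phi i /\ sym (t phi) s)).
have Didx : F1 idx by unfold idx; definability.
(* The first index at which [s] occurs, and its position in the small language there:
   the names used before stage [i] form a set. *)
pose (name := fun s : V => opair (idx s) (ap (e (binv c (idx s))) (opair s (ap tau s)))).
have Dname : F1 name by unfold name; definability.
have cT phi i : app c phi i -> phi ∈ T /\ i ∈ k /\ i = ap c phi.
  move=> /(appP c T _ _ (bij_fun _ _ _ Hc)) [H ->]; split=> //; split=> //.
  exact: (bij_ap c T k).
have symt phi s : phi ∈ T -> sym (t phi) s -> sym tau s /\ app (t phi) s (ap tau s).
  move=> Hphi [u Hu]; have Hut : app tau s u.
    by apply: (app_sub _ _ _ _ (proj1 (tP phi Hphi))).
  split; first by exists u.
  by rewrite -(app_ap tau (sym tau) s u) //; case: Htau.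
have idxP phi s : phi ∈ T -> sym (t phi) s ->
    (idx s ∈ ap c phi \/ idx s = ap c phi) /\
    exists phi1, phi1 ∈ T /\ binv c (idx s) = phi1 /\ sym (t phi1) s.
  move=> Hphi Hs; case: (least_ord_spec (fun i => exists phi, app c phi i /\ sym (t phi) s)).
  by definability.
  exists (ap c phi); split; first by apply: (ord_mem k) => //; apply: (bij_ap c T k).
    by exists phi; split=> //; apply: (ap_app c T) => //; case: Hc.
  move=> Oi [[phi1 [H1 Hs1]] Hm]; case: (cT _ _ H1) => H2 [H3 H4]; split.
      have Oc : is_ord (ap c phi) by apply: (ord_mem k) => //; apply: (bij_ap c T k).
      case: (ord_tri (idx s) (ap c phi) Oi Oc) => [|[|H]]; auto.
      case: (Hm _ H); exists phi; split=> //; apply: (ap_app c T) => //; by case: Hc.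
    by exists phi1; split=> //; split=> //; rewrite /idx H4 (bij_binv_ap c T k).
(* Equal names have the same first index, hence refer to the same small language, where the
   numbering is injective. *)
have name_inj phi phi' s s' : phi ∈ T -> phi' ∈ T -> sym (t phi) s -> sym (t phi') s' ->
    name s = name s' -> s = s'.
  move=> Hphi Hphi' Hs Hs' /opair_inj [E1 E2].
  case: (idxP phi s Hphi Hs) => _ [phi1 [H1 [H2 H3]]].
  case: (idxP phi' s' Hphi' Hs') => _ [phi2 [H4 [H5 H6]]].
  have E : phi2 = phi1 by rewrite -H2 -H5 E1.
  rewrite E in H6 H5; rewrite H2 H5 in E2.
  case: (eP phi1 H1) => l [_ Hl].
  have : opair s (ap tau s) = opair s' (ap tau s').
    by apply: (bij_inj _ _ _ Hl) => //; apply/appE; apply: (proj2 (symt phi1 _ H1 _)).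
  by move=> /opair_inj [].
have nameE s : name s = opair (idx s) (ap (e (binv c (idx s))) (opair s (ap tau s))) by [].
clearbody name idx e t.
case: (sep_ex (symset tau) (fun s => exists phi, phi ∈ T /\ sym (t phi) s)) => [|S' HS']; first by definability.
pose (f := lam name S').
have fP s y : app f s y <-> (exists phi, phi ∈ T /\ sym (t phi) s) /\ y = name s.
  rewrite /f app_lam // HS' symsetP; split=> [[[_ H] H1]|[[phi [H1 H2]] H3]] //.
  by split=> //; split; [case: (symt phi s H1 H2)|exists phi].
(* [B] takes all entries lying in stages below [k]; what remains is to find one for each index. *)
case: (sep_ex (bigcup (image stage k)) (fun x => exists i sg psi, i ∈ k /\
    x = opair one (opair i (opair sg psi)) /\ entry tau c f i sg psi)) => [|B HB].
  by unfold entry; definability.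
exists B; split; last first.
  move=> x /HB [/bigcupP [y [Hx Hy]] _]; case/imageP: Hy => [|i [Hi Ey]]; first exact: D_stage.
  by exists i; rewrite -Ey.
split=> //; exists tau, T, c, f; do 5!split=> //; split.
  by move=> s s1 y /fP [[phi [H1 H2]] ->] /fP [[phi' [H3 H4]]]; apply: (name_inj phi phi').
split; first by move=> s y y1 /fP [_ ->] /fP [_ ->].
split; first by move=> x /HB [].
move=> i Hi; case: (bij_binv c T k Hc i Hi); set phi := binv c i => Hphi Ei.
case: (tP phi Hphi) => Ht1 [Ht2 Ht3].
pose (sg := image (fun s => opair (name s) (ap tau s)) (symset (t phi))).
have sgP y u : app sg y u <-> exists s, sym (t phi) s /\ y = name s /\ u = ap tau s.
  rewrite appE /set_ext imageP; first by definability.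
  split=> [[s [/symsetP Hs /opair_inj [-> ->]]]|[s [Hs [-> ->]]]]; exists s => //.
  by rewrite symsetP.
have ssgP y : sym sg y <-> exists s, sym (t phi) s /\ y = name s.
  split=> [[u /sgP [s [H1 [H2 _]]]]|[s [H1 H2]]]; first by exists s.
  by exists (ap tau s); apply/sgP; exists s.
have Hsg : is_lang sg.
  split.
    split=> [p /imageP|y [u Hu]].
      case=> [|s [/symsetP Hs ->]]; first by definability.
      exists (name s), (ap tau s); rewrite is_opairE ssgP; split=> //; by exists s.
    exists u; split=> // u' /sgP [s' [Hs' [E1 ->]]]; case/sgP: Hu => s [Hs [E2 ->]].
    by congr ap; apply: (name_inj phi phi) => //; rewrite -E1.
  move=> y u /sgP [s [Hs [_ ->]]]; case: (symt phi s Hphi Hs) => _ H.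
  by case: (sentence_lang _ _ Ht3) => _ K; apply: (K s).
pose (f0 := lam name (symset (t phi))).
have f0P s y : app f0 s y <-> sym (t phi) s /\ y = name s by rewrite /f0 app_lam // symsetP.
have Hren : is_renaming f0 (t phi) sg.
  split.
    apply: bij_lam => //; first by move=> x; rewrite symsetP.
    by move=> s Hs; apply/ssgP; exists s.
    by move=> s s' Hs Hs'; apply: (name_inj phi phi).
    by move=> y /ssgP.
  move=> s s' u /f0P [Hs ->]; rewrite sgP; split=> [Hu|[s1 [Hs1 [E ->]]]].
    exists s; do 2!split=> //; apply: (app_ap tau (sym tau)); first by case: Htau.
    by apply: (app_sub _ _ _ _ Ht1).
  rewrite (name_inj phi phi s s1) //.
  by case: (symt phi s1 Hphi Hs1).
case: (logic_renaming L Sat HL (t phi) sg f0 (sentence_lang _ _ Ht3) Hsg Hren) => g [Hg Hgs].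
have Hgp : app g phi (ap g phi) by apply: (ap_app g (sentence L (t phi))) => //; case: Hg.
have Hspsi : sentence L sg (ap g phi) by apply: (bij_ap g (sentence L (t phi))).
exists sg, (ap g phi); apply/HB; split.
(* The index [i] and the first indices in the names are at most [i], so the entry appears at stage
   [succ i], which is below [k] because [k] is a limit. *)
- apply/bigcupP; exists (stage (succ i)); split; last first.
    by apply/imageP; [exact: D_stage|exists (succ i); split=> //; apply: limit_succ].
  have HX : subset sg (X (succ i)).
    move=> p /imageP []; first by definability.
    move=> s [/symsetP Hs ->]; rewrite /X nameE !pair_cartesian.
    case: (idxP phi s Hphi Hs); rewrite Ei => H [phi1 [H1 [H2 H3]]].
    split; first split; first by apply/succP.
      rewrite H2; case: (eP phi1 H1) => l [Hl Hl2]; apply: (ord_trans o l) => //.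
        by case: Co.
      by apply: (bij_ap _ _ _ Hl2); apply/appE; case: (symt phi1 s H1 H3).
    case: (symt phi s Hphi Hs) => Hst _; case: (proj2 Htau s (ap tau s)).
      by apply: (ap_app tau (sym tau)) => //; case: Htau.
    by move=> n [/rel_sigE [Hn ->]|/fun_sigE [Hn ->]]; rewrite /Sig pair_cartesian upairP omegaP; auto.
  rewrite /stage cupP; right; rewrite !pair_cartesian singP succP powerP.
  split; first by []. split; first by right. split; first by [].
  case: Hspsi => S [HS HpS]; apply/bigcupP; exists S; split=> //; apply/imageP; first by definability.
  exists sg; split; first exact/powerP.
  by case/(apcP L is_lang): HS => //; case: HL.
- exists i, sg, (ap g phi); do 2!split=> //.
  exists (t phi), f0, phi; split=> //; split; last do 3!split=> //.
    by rewrite -Ei; apply: (ap_app c T) => //; case: Hc.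
  split; first by move=> s s' /f0P [Hs ->]; apply/fP; split=> //; exists phi.
  by move=> M N H1 H2 H3; apply: Hgs.
Qed.

End Forward.

Section ForwardMain.
Context {U : Universe} {HU : GBC U}.

Lemma subtle_wcc (L Sat : Cls) : Ord_subtle -> is_logic L Sat ->
  exists S : Cls, stationary S /\ forall k : V, S k -> weak_compactness_cardinal L Sat k.
Proof.
move=> Hsub HL; case: (comprehend _ (D_wcc L Sat)) => S HS.
exists S; split; last by move=> k /HS.
split=> [a /HS [[] //]|C HC]; apply: NNPP => Hno.
case: (logic_occurrence L Sat HL) => o Ho.
(* Data for [k] that occur in stages below [k]; taking the [W]-least such set makes the whole
   sequence of data definable. *)
pose (P := fun k B : V => (card_data L Sat k B \/ noncard_data k B) /\
  forall x, x ∈ B -> exists i, i ∈ k /\ x ∈ stage L o i).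
have DE : F1 (stage L o) by exact: D_stage.
have DP : R2 P by unfold P, card_data, noncard_data, entry; definability.
have DPk k : R1 (P k) by definability.
have Hex k : C k -> is_limit k -> P k (W_least (P k)).
  move=> Ck Lk; apply: W_least_spec => //.
  case: (classic (is_cardinal k)) => Hk; last first.
    by case: (noncard_ex L o k Lk Hk) => B [H1 H2]; exists B; split; auto.
  case: (card_ex L Sat HL o Ho k Lk Hk) => [Hw|B [H1 H2]]; last by exists B; split; auto.
  by apply: Hno; exists k; split=> //; apply/HS.
case: (subtle_data C (stage L o) (fun k => W_least (P k)) Hsub HC DE); first by definability.
  by move=> k x Ck Lk Hx; apply: (proj2 (Hex k Ck Lk)).
move=> a [b [Ca [Cb [La [Lb [Hab H]]]]]].
case: (Hex a Ca La) => Ha _; case: (Hex b Cb Lb) => Hb _.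
exact: (data_conflict L Sat HL a b _ _ La Hab Ha Hb H).
Qed.

End ForwardMain.

(** * Embeddings of ordinals *)

Section Near.
Context {U : Universe} {HU : GBC U}.

(* The sets of ordinals [X] and [Y] have a common nonempty tail. *)
Definition near (X Y : V) : Prop := exists x, is_ord x /\ x ∈ X /\ x ∈ Y /\
  forall z, is_ord z -> x ∈ z \/ x = z -> (z ∈ X <-> z ∈ Y).

Lemma near_refl X x : is_ord x -> x ∈ X -> near X X.
Proof. by move=> Ox Hx; exists x. Qed.

Lemma near_sym X Y : near X Y -> near Y X.
Proof.
by move=> [x [H1 [H2 [H3 H4]]]]; exists x; do 3!split=> //; move=> *; rewrite H4.
Qed.

Lemma near_trans X Y Z : near X Y -> near Y Z -> near X Z.
Proof.
move=> [x [Ox [H1 [H2 H3]]]] [y [Oy [K1 [K2 K3]]]].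
have le_trans u v w : is_ord w -> u ∈ v \/ u = v -> v ∈ w \/ v = w -> u ∈ w \/ u = w.
  by move=> Ow [H|->] // [K|<-]; left=> //; apply: (ord_trans w v).
case: (classic (x ∈ y \/ x = y)) => [H|H].
- exists y; split=> //; split; first by apply/H3.
  by split=> // z Oz Hz; rewrite -K3 // H3 //; apply: (le_trans x y).
- have Hyx : y ∈ x \/ y = x by case: (ord_tri x y Ox Oy) => [|[|]]; tauto.
  exists x; split=> //; split=> //; split; first by apply/K3.
  by move=> z Oz Hz; rewrite H3 // K3 //; apply: (le_trans y x).
Qed.

(* The tail class of [X] is chosen from the pair of tail classes of [X] and [Y]: the
   one whose [W]-least member comes first. *)
Definition before (X Y : V) : Prop :=
  exists Z, near Z X /\ forall Z', near Z' Y -> app W Z Z'.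

Lemma before_congr X X' Y Y' : near X X' -> near Y Y' -> before X Y -> before X' Y'.
Proof.
move=> HX HY [Z [H1 H2]]; exists Z; split; first exact: (near_trans _ X).
by move=> Z' HZ'; apply: H2; apply: (near_trans _ Y') => //; apply: near_sym.
Qed.

Lemma before_asym X Y : before X Y -> ~ before Y X.
Proof.
move=> [Z [H1 H2]] [Z' [K1 K2]]; apply: (W_irr Z).
by apply: (W_trans _ Z'); [apply: H2|apply: K2].
Qed.

(** [near X X] says that the tail class of [X] is inhabited. If the two classes are different, so
    are their [W]-least members, and the order of these decides. *)
Lemma before_total X Y : near X X -> near Y Y -> ~ near X Y -> before X Y \/ before Y X.
Proof.
move=> HX HY Hn.
case: (W_min (fun Z => near Z X)); [by unfold near; definability|by exists X|].
move=> Z [HZ MZ]; case: (W_min (fun Z => near Z Y)); [by unfold near; definability|by exists Y|].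
move=> Z' [HZ' MZ'].
have K A B : (forall y, near y B -> ~ app W y A) -> forall y, near y B -> y = A \/ app W A y.
  by move=> M y Hy; case: (W_tri y A) => [/(M y Hy)|[|]]; auto.
case: (W_tri Z Z') => [H|[E|H]].
- left; exists Z; split=> // y Hy; case: (K Z' Y MZ' y Hy) => [->//|]; exact: W_trans.
- by case: Hn; apply: (near_trans _ Z); [apply: near_sym|rewrite E].
- right; exists Z'; split=> // y Hy; case: (K Z X MZ y Hy) => [->//|]; exact: W_trans.
Qed.

Lemma D_before : R2 before. Proof. unfold before, near; definability. Qed.

End Near.

(** * Types of pairs of countable sets of ordinals *)

Section Types.
Context {U : Universe} {HU : GBC U}.

(** One sequence covers both sets and may take other values, so finite and empty sets are
    included. *)
Definition ctbl (X Y : V) : Prop := exists g : V, is_fun g (set_ext omega) /\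
  forall s, s ∈ X \/ s ∈ Y -> exists n, n ∈ omega /\ s = ap g n.

Lemma ctbl_fun X Y F : F1 F -> (forall s, s ∈ X \/ s ∈ Y -> exists n, n ∈ omega /\ s = F n) -> ctbl X Y.
Proof.
move=> DF H; exists (lam F omega); split; first exact: is_fun_lam.
by move=> s /H [n [Hn ->]]; exists n; rewrite ap_lam.
Qed.

Lemma ctbl_sub X Y X' Y' : (forall x, x ∈ X' -> x ∈ X) -> (forall x, x ∈ Y' -> x ∈ Y) ->
  ctbl X Y -> ctbl X' Y'.
Proof. by move=> HX HY [g [Hg H]]; exists g; split=> // s [/HX|/HY] Hs; apply: H; auto. Qed.

Lemma ctbl_sing x y : ctbl (sing x) (sing y).
Proof.
apply: (ctbl_fun _ _ (fun n => ifp (n = empset) x y)); first by definability.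
move=> s; rewrite !singP => -[->|->].
  by exists empset; rewrite ifpT // omegaP; split=> //; exact: nat_empset.
exists (succ empset); rewrite ifpF ?omegaP; first by move/(fun E => eq_sym E)/empset_ne_succ.
by split=> //; apply: nat_succ; exact: nat_empset.
Qed.

Lemma D_ctbl : R2 ctbl. Proof. unfold ctbl; definability. Qed.

(** Truth values as sets, so that a type is itself a set and can be a component of a sentence. *)
Definition tv (P : Prop) : V := ifp P (sing empset) empset.
Lemma tv_iff P Q : tv P = tv Q -> (P <-> Q).
Proof.
have H : sing empset <> empset by move=> E; apply: (empsetP empset); rewrite -{2}E singP.
rewrite /tv; case: (classic P) => HP; case: (classic Q) => HQ.
- by [].
- by rewrite (ifpT P) // (ifpF Q) // => /H.
- by rewrite (ifpF P) // (ifpT Q) // => /(fun E => eq_sym E) /H.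
- tauto.
Qed.
Lemma tv_in P : tv P ∈ upair (sing empset) empset.
Proof.
rewrite /tv upairP; case: (classic P) => H; first by left; apply: ifpT.
by right; apply: ifpF.
Qed.

Context (C A : Cls).

(** The singleton clause makes the embedding a function on points. The next four give order,
    membership in [C], and the sequence [A] at named points and at the top ordinal [b]. The sixth,
    that [X] bounds the elements of [C] below members of [Y], makes the embedding fix the next
    element of [C]. The last is the choice of a tail. *)
Definition same_type (b X Y b' X' Y' : V) : Prop :=
  ((exists x, X = sing x) <-> (exists x, X' = sing x)) /\
  ((exists x y, x ∈ X /\ y ∈ Y /\ x ∈ y) <-> (exists x y, x ∈ X' /\ y ∈ Y' /\ x ∈ y)) /\
  ((exists x, x ∈ X /\ C x) <-> (exists x, x ∈ X' /\ C x)) /\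
  ((exists x y, x ∈ X /\ y ∈ Y /\ x ∈ apc A y) <-> (exists x y, x ∈ X' /\ y ∈ Y' /\ x ∈ apc A y)) /\
  ((exists x, x ∈ X /\ x ∈ apc A b) <-> (exists x, x ∈ X' /\ x ∈ apc A b')) /\
  ((forall z y, C z -> y ∈ Y -> z ∈ y -> exists x, x ∈ X /\ (z ∈ x \/ z = x)) <->
   (forall z y, C z -> y ∈ Y' -> z ∈ y -> exists x, x ∈ X' /\ (z ∈ x \/ z = x))) /\
  (before X Y <-> before X' Y').

Let tp (b X Y : V) : V :=
  opair (tv (exists x, X = sing x))
 (opair (tv (exists x y, x ∈ X /\ y ∈ Y /\ x ∈ y))
 (opair (tv (exists x, x ∈ X /\ C x))
 (opair (tv (exists x y, x ∈ X /\ y ∈ Y /\ x ∈ apc A y))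
 (opair (tv (exists x, x ∈ X /\ x ∈ apc A b))
 (opair (tv (forall z y, C z -> y ∈ Y -> z ∈ y -> exists x, x ∈ X /\ (z ∈ x \/ z = x)))
        (tv (before X Y))))))).

Let TV : V := let T := upair (sing empset) empset in
  cartesian T (cartesian T (cartesian T (cartesian T (cartesian T (cartesian T T))))).

Let tp_in b X Y : tp b X Y ∈ TV.
Proof. by rewrite /tp /TV !pair_cartesian; do 6!(split; first exact: tv_in); exact: tv_in. Qed.

Let tp_eq b X Y b' X' Y' : tp b X Y = tp b' X' Y' -> same_type b X Y b' X' Y'.
Proof.
rewrite /tp => /opair_inj [H1 /opair_inj [H2 /opair_inj [H3 /opair_inj [H4 /opair_inj
  [H5 /opair_inj [H6 H7]]]]]].
by do 6!(split; first exact: tv_iff); exact: tv_iff.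
Qed.

Let D_tp : F3 tp.
Proof. have H : R2 before by exact: D_before.
unfold tp, tv. definability. Qed.

(* Stated as an existence so that types stay opaque to conversion. *)
Lemma types_exist : exists (tp : V -> V -> V -> V) (TV : V), F3 tp /\
  (forall b X Y, tp b X Y ∈ TV) /\
  (forall b X Y b' X' Y', tp b X Y = tp b' X' Y' -> same_type b X Y b' X' Y').
Proof. by exists tp, TV; split; [exact: D_tp|split; [exact: tp_in|exact: tp_eq]]. Qed.

End Types.

Ltac def_known9 := first [ def_known8
 | lazymatch goal with |- DefP (fun e => ctbl _ _) => apply (DefP_rel2 ctbl _ _ D_ctbl) end ].
Ltac def_known ::= def_known9.

(** * Embeddings that preserve types *)

Section Embedding.
Context {U : Universe} {HU : GBC U}.
Context (C A : Cls) (HC : club C) (HA : is_fun A is_ord) (HAs : forall a s, app A a s -> subset s a).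
Context (tp : V -> V -> V -> V)
  (tp_eq : forall b X Y b' X' Y', tp b X Y = tp b' X' Y' -> same_type C A b X Y b' X' Y').
Context (k b d : V) (j : V -> V) (Dj : F1 j).
Context (Ck : C k) (Lk : is_limit k) (LCk : forall i, i ∈ k -> exists c, C c /\ c ∈ k /\ i ∈ c).
Context (Cb : C b) (jb : forall x, x ∈ k -> j x ∈ b) (db : d ∈ b) (jd : forall x, x ∈ k -> j x <> d).
Context (jtp : forall i X Y, i ∈ k -> subset X i -> subset Y i -> ctbl X Y ->
  tp k X Y = tp b (image j X) (image j Y)).

Let Ok : is_ord k. Proof. by case: Lk. Qed.
Let Ob : is_ord b. Proof. by case: HC => H _; apply: H. Qed.
Let ordk x : x ∈ k -> is_ord x. Proof. exact: ord_mem. Qed.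
Let ordj x : x ∈ k -> is_ord (j x). Proof. by move=> /jb; apply: ord_mem. Qed.

Let img_sing x : image j (sing x) = sing (j x).
Proof.
apply ext => y; rewrite imageP // singP; split=> [[z [/singP -> ->]] //|->].
by exists x; rewrite singP.
Qed.

Let tp1 x y : x ∈ k -> y ∈ k ->
  tp k (sing x) (sing y) = tp b (sing (j x)) (sing (j y)).
Proof.
move=> Hx Hy.
have [i [Hi [Hxi Hyi]]] : exists i, i ∈ k /\ x ∈ i /\ y ∈ i.
  case: (ord_tri x y (ordk x Hx) (ordk y Hy)) => [H|[H|H]].
    exists (succ y); rewrite !succP; split; [exact: limit_succ|tauto].
    exists (succ y); rewrite !succP; split; [exact: limit_succ|tauto].
    exists (succ x); rewrite !succP; split; [exact: limit_succ|tauto].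
rewrite (jtp i) ?img_sing //; last exact: ctbl_sing; by move=> z /singP ->.
Qed.

Let jmono x y : x ∈ k -> y ∈ k -> x ∈ y -> j x ∈ j y.
Proof.
move=> Hx Hy Hxy; case: (tp_eq _ _ _ _ _ _ (tp1 x y Hx Hy)) => _ [[H _] _].
case: H => [|u [v [/singP -> [/singP -> //]]]].
by exists x, y; rewrite !singP.
Qed.

Let jC x : x ∈ k -> C x -> C (j x).
Proof.
move=> Hx Cx; case: (tp_eq _ _ _ _ _ _ (tp1 x x Hx Hx)) => _ [_ [[H _] _]].
case: H => [|u [/singP -> //]].
by exists x; rewrite singP.
Qed.

Let jA x y : x ∈ k -> y ∈ k -> (x ∈ apc A y <-> j x ∈ apc A (j y)).
Proof.
move=> Hx Hy; case: (tp_eq _ _ _ _ _ _ (tp1 x y Hx Hy)) => _ [_ [_ [[H1 H2] _]]].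
split=> H.
  by case: H1 => [|u [v [/singP -> [/singP -> //]]]]; exists x, y; rewrite !singP.
by case: H2 => [|u [v [/singP -> [/singP -> //]]]]; exists (j x), (j y); rewrite !singP.
Qed.

Let jAb x : x ∈ k -> (x ∈ apc A k <-> j x ∈ apc A b).
Proof.
move=> Hx; case: (tp_eq _ _ _ _ _ _ (tp1 x x Hx Hx)) => _ [_ [_ [_ [[H1 H2] _]]]].
split=> H.
  by case: H1 => [|u [/singP -> //]]; exists x; rewrite !singP.
by case: H2 => [|u [/singP -> //]]; exists (j x); rewrite !singP.
Qed.

Let jinj x y : x ∈ k -> y ∈ k -> j x = j y -> x = y.
Proof.
move=> Hx Hy E; case: (ord_tri x y (ordk x Hx) (ordk y Hy)) => [H|[//|H]].
  by case: (mem_irrefl (j y)); rewrite -{1}E; apply: jmono.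
  by case: (mem_irrefl (j y)); rewrite -{2}E; apply: jmono.
Qed.

Let jge : forall x, x ∈ k -> x ∈ j x \/ x = j x.
Proof.
apply: mem_ind; first by definability.
move=> x IH Hx; case: (ord_tri x (j x) (ordk x Hx) (ordj x Hx)) => [|[|H]]; auto.
have Hjx : j x ∈ k by apply: (ord_trans k x).
have H2 := jmono (j x) x Hjx Hx H.
case: (IH (j x) H Hjx) => H3; first by case: (mem_asym _ _ H3).
by case: (mem_irrefl (j x)); rewrite {1}H3.
Qed.

Let subset_A x : is_ord x -> subset (apc A x) x.
Proof. by move=> Ox; apply: HAs; apply: (apc_app A is_ord). Qed.

(** The fixed point [y] keeps the iterates of [j] at [x] below [y], so the sets of even and odd
    iterates are bounded in [k] and [jtp] applies. They are disjoint because [j] is injective and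
    omits [x]. *)
Let no_moved_gap x y : x ∈ k -> y ∈ k -> x ∈ y -> j y = y -> x ∈ j x ->
  (forall z, z ∈ x -> j z = z) -> False.
Proof.
move=> Hx Hy Hxy Ey Hxj Hfix.
have Oy := ordk y Hy.
have ylt z : z ∈ y -> z ∈ k by move=> Hz; apply: (ord_trans k y).
have jy z : z ∈ y -> j z ∈ y by move=> Hz; rewrite -Ey; apply: jmono => //; apply: ylt.
have Hxnot z : z ∈ k -> j z <> x.
  move=> Hz E; case: (ord_tri z x (ordk z Hz) (ordk x Hx)) => [H|[H|H]].
    by apply: (mem_irrefl x); rewrite -{1}E (Hfix z H).
    by apply: (mem_irrefl x); rewrite -{2}E H.
  apply: (mem_asym x (j x)) => //; rewrite -{2}E; exact: jmono.
(* The even iterates, as the least subset of [y] containing [x] and closed under [j] applied twice;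
   this form yields the induction [Xind]. *)
case: (sep_ex y (fun u => forall Z, x ∈ Z -> (forall z, z ∈ Z -> z ∈ y -> j (j z) ∈ Z) -> u ∈ Z))
  => [|X HX]; first by definability.
have Xx : x ∈ X by apply/HX.
have XJ u : u ∈ X -> j (j u) ∈ X.
  move=> /HX [Hu H]; apply/HX; split; first by apply/jy/jy.
  by move=> Z HZ1 HZ2; apply: (HZ2 u) => //; apply: H.
have Xind (P : V -> Prop) : R1 P -> P x -> (forall u, u ∈ X -> P u -> P (j (j u))) ->
    forall u, u ∈ X -> P u.
  move=> HP P0 PS u Hu; case: (sep_ex X P HP) => Z HZ.
  case/HX: (Hu) => Huy /(_ Z); rewrite !HZ => H; apply: (proj2 (H _ _)) => //.
  by move=> z; rewrite !HZ => -[Hz Pz] _; split; [apply: XJ|apply: PS].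
have Xy u : u ∈ X -> u ∈ y by move=> /HX [].
have Xk u : u ∈ X -> u ∈ k by move=> /Xy /ylt.
have Xcases u : u ∈ X -> u = x \/ exists w, w ∈ X /\ u = j (j w).
  move: u; apply: Xind; [by definability|by left|] => u Hu _.
  by right; exists u.
(* Cancelling [j] in an equation between an even and an odd iterate leads to an earlier such
   equation, and in the end makes [x] a value of [j]. *)
have Xdisj u : u ∈ X -> ~ exists w, w ∈ X /\ u = j w.
  move: u; apply: Xind; first by definability.
    by move=> [w [Hw E]]; apply: (Hxnot w); auto.
  move=> u Hu IH [w [Hw E]].
  have Eu : j u = w by apply: jinj; auto.
  case: (Xcases w Hw) => [Ew|[v [Hv Ev]]]; first by apply: (Hxnot u); rewrite -?Ew; auto.
  apply: IH; exists v; split=> //; apply: jinj; auto.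
  by rewrite Eu.
pose (Y := image j X).
have YP u : u ∈ Y <-> exists w, w ∈ X /\ u = j w by apply: imageP.
have YJP u : u ∈ image j Y <-> exists w, w ∈ X /\ u = j (j w).
  rewrite imageP //; split=> [[w [/YP [v [Hv ->]] ->]]|[w [Hw ->]]]; first by exists v.
  by exists (j w); rewrite YP; split=> //; exists w.
clearbody Y.
have Hct : ctbl X Y.
  case: (nat_rec x j Dj) => r [Dr [r0 rS]].
  apply: (ctbl_fun _ _ r Dr).
  have HXr : forall u, u ∈ X -> exists n, is_nat n /\ u = r n.
    apply: Xind; first by definability.
      by exists empset; split=> //; exact: nat_empset.
    move=> u Hu [n [Hn ->]]; exists (succ (succ n)).
    by split; [apply: nat_succ; apply: nat_succ|rewrite !rS //; apply: nat_succ].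
  move=> s [/HXr [n [Hn ->]]|/YP [w [/HXr [n [Hn ->]] ->]]].
    by exists n; rewrite omegaP.
  by exists (succ n); rewrite omegaP rS //; split=> //; apply: nat_succ.
(* As [j[X] = Y], the pair [(X, Y)] is carried to [(Y, j[Y])]. *)
have HB : before X Y <-> before Y (image j Y).
  have EY : image j X = Y by apply ext => u; rewrite imageP // YP.
  have Yy : subset Y y by move=> u /YP [w [Hw ->]]; apply: jy; apply: Xy.
  have E := jtp y X Y Hy Xy Yy Hct; rewrite EY in E.
  exact: (proj2 (proj2 (proj2 (proj2 (proj2 (proj2 (tp_eq _ _ _ _ _ _ E))))))).
have Ox := ordk x Hx.
(* [j[Y]] omits only [x] from [X], so the tails agree from [j (j x)] on. *)
have N1 : near (image j Y) X.
  exists (j (j x)); split; first by apply: ordj; apply: ylt; apply: jy.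
  split; first by apply/YJP; exists x.
  split; first exact: XJ.
  move=> z Oz Hz; rewrite YJP; split=> [[w [Hw ->]]|]; first exact: XJ.
  move=> /Xcases [E|//]; exfalso.
  have Hjjx : x ∈ j (j x).
    apply: (ord_trans _ (j x)) => //; first by apply: ordj; apply: ylt; apply: jy.
    by apply: jmono => //; apply: ylt; apply: jy.
  case: Hz => Hz; first by apply: (mem_asym x (j (j x))) => //; rewrite -{2}E.
  by apply: (mem_irrefl x); rewrite -{2}E -Hz.
have NX : near X X by apply: (near_refl _ x).
have NY : near Y Y by apply: (near_refl _ (j x)); [apply: ordj|apply/YP; exists x].
have NXY : ~ near X Y by move=> [u [_ [Hu [/YP Hu2 _]]]]; apply: (Xdisj u).
(* Replacing [j[Y]] by [X] turns preservation of the choice into its reversal. *)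
have HB2 : before X Y <-> before Y X.
  rewrite HB; split; apply: before_congr => //; exact: near_sym.
have K1 : before X Y -> ~ before Y X by exact: before_asym.
have K2 : before X Y \/ before Y X by exact: before_total.
tauto.
Qed.

Lemma embedding_subtle : exists a c s t, C a /\ C c /\ a ∈ c /\ app A a s /\ app A c t /\
  forall x, x ∈ s <-> x ∈ t /\ x ∈ a.
Proof.
have appA x : is_ord x -> app A x (apc A x) by apply: (apc_app A is_ord).
case: (classic (exists x, x ∈ k /\ j x <> x)) => [Hm|Hid].
- have [x [Hx [Hjx Hmin]]] : exists x, x ∈ k /\ x ∈ j x /\ forall z, z ∈ x -> j z = z.
    case: (mem_min (fun x => x ∈ k /\ j x <> x)) => //; first by definability.
    move=> x [[Hx Hne] Hm']; exists x; split=> //; split.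
      by case: (jge x Hx) => // E; case: Hne.
    by move=> z Hz; apply: NNPP => K; apply: (Hm' z Hz); split=> //; apply: (ord_trans k x).
  case: (classic (C x)) => [Cx|NCx].
    exists x, (j x), (apc A x), (apc A (j x)).
    split=> //; split; first exact: jC.
    split=> //; split; first by apply: appA; apply: ordk.
    split; first by apply: appA; apply: ordj.
    move=> z; split=> [Hz|[Hz Hzx]].
      have Hzx : z ∈ x by apply: (subset_A x (ordk x Hx)).
      have Hzk : z ∈ k by apply: (ord_trans k x).
      by split=> //; rewrite -(Hmin z Hzx); apply/(jA z x Hzk Hx).
    have Hzk : z ∈ k by apply: (ord_trans k x).
    by apply/(jA z x Hzk Hx); rewrite (Hmin z Hzx).
  exfalso.
  (* The next element of [C] after [x]; as [x] is not in [C], the elements of [C] below [c] are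
     below [x]. *)
  have [c [Hc [Hcx [Cc Hcmin]]]] : exists c, c ∈ k /\ x ∈ c /\ C c /\
      forall z, z ∈ c -> C z -> z ∈ x.
    case: (ord_min (fun c => C c /\ x ∈ c /\ c ∈ k)); first by definability.
      by case: (LCk x Hx) => c [H1 [H2 H3]]; exists c; split=> //; apply: ordk.
    move=> c [Oc [[H1 [H2 H3]] H4]]; exists c; do 3!split=> //; move=> z Hz Cz.
    have Hzk : z ∈ k by apply: (ord_trans k c).
    case: (ord_tri z x (ordk z Hzk) (ordk x Hx)) => [//|[E|K]]; first by case: NCx; rewrite -E.
    by case: (H4 z Hz).
  (* As [x] is not in [C], it is not a limit of [C]: one point below [x] bounds [C ∩ x], or [C ∩ x]
     is empty. Being a subset of [x], [X0] is fixed pointwise by [j]. *)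
  have [X0 [HX0 [HX0c HX1]]] : exists X0, subset X0 x /\ ctbl X0 (sing c) /\
      forall z, C z -> z ∈ x -> exists u, u ∈ X0 /\ (z ∈ u \/ z = u).
    case: (classic (exists u, u ∈ x /\ forall z, C z -> z ∈ x -> z ∈ u \/ z = u)) => [[u [Hu Hz]]|Hn].
      exists (sing u); split; first by move=> z /singP ->.
      split; first exact: ctbl_sing.
      by move=> z Cz Hzx; exists u; rewrite singP; split=> //; apply: Hz.
    exists empset; split; first by move=> z /empsetP.
    split; first by apply: (ctbl_sub (sing c) (sing c)) => //; [move=> z /empsetP|exact: ctbl_sing].
    move=> z Cz Hzx; exfalso; apply: NCx; case: (HC) => CO [_ Ccl]; apply: Ccl.
      split; first exact: ordk.
      split; first by exists z.
      move=> w Hw; apply: NNPP => K; apply: Hn; exists w; split=> // v Cv Hv.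
      have Hvk : v ∈ k by apply: (ord_trans k x).
      have Hwk : w ∈ k by apply: (ord_trans k x).
      case: (ord_tri v w (ordk v Hvk) (ordk w Hwk)) => [|[|H]]; auto.
      by case: K; exists v.
    move=> w Hw; apply: NNPP => K; apply: Hn; exists w; split=> // v Cv Hv.
    have Hvk : v ∈ k by apply: (ord_trans k x).
    have Hwk : w ∈ k by apply: (ord_trans k x).
    case: (ord_tri v w (ordk v Hvk) (ordk w Hwk)) => [|[|H]]; auto.
    by case: K; exists v.
  have EX0 : image j X0 = X0.
    apply ext => z; rewrite imageP //; split=> [[w [Hw ->]]|Hz].
      by rewrite (Hmin w) //; apply: HX0.
    by exists z; rewrite (Hmin z) //; apply: HX0.
  (* Otherwise [c] is an element of [C] below [j c], and the sixth clause of [same_type], for [X0]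
     and [{c}], bounds it by an element of [X0], hence of [x]. *)
  have Ejc : j c = c.
    case: (jge c Hc) => [K|//]; exfalso.
    have E : tp k X0 (sing c) = tp b (image j X0) (image j (sing c)).
      apply: (jtp (succ c)) => //; first exact: limit_succ.
        move=> z /HX0 Hz; apply/succP; left; apply: (ord_trans c x) => //; exact: ordk.
      by move=> z /singP ->; apply/succP; right.
    rewrite EX0 img_sing in E.
    case: (tp_eq _ _ _ _ _ _ E) => _ [_ [_ [_ [_ [[H6 _] _]]]]].
    case: (H6 _ c (j c) Cc) => //.
      by move=> z y Cz /singP -> Hz; apply: HX1 => //; apply: Hcmin.
      by apply/singP.
    move=> u [/HX0 Hu [Hcu|Hcu]].
      by apply: (mem_asym c x) => //; apply: (ord_trans x u) => //; apply: ordk.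
    by apply: (mem_asym c x) => //; rewrite Hcu.
  exact: (no_moved_gap x c).
- have jid x : x ∈ k -> j x = x by move=> Hx; apply: NNPP => K; apply: Hid; exists x.
  (* [d] lies in [b] but outside the range [k] of the identity, which rules out [b = k] and
     [b ∈ k]. *)
  have Hkb : k ∈ b.
    have Hdk : ~ d ∈ k by move=> K; apply: (jd d) => //; apply: jid.
    case: (ord_tri k b Ok Ob) => [//|[E|H]]; case: Hdk; first by rewrite E.
    exact: (ord_trans k b).
  exists k, b, (apc A k), (apc A b); do 3!split=> //.
  split; first exact: appA.
  split; first exact: appA.
  move=> x; split=> [Hx|[Hx Hxk]].
    have Hxk : x ∈ k by apply: (subset_A k Ok).
    by split=> //; rewrite -(jid x Hxk); apply/jAb.
  by apply/jAb => //; rewrite jid.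
Qed.

End Embedding.

(** * A logic describing ordinals *)

Section Codes.
Context {U : Universe} {HU : GBC U}.

Definition pr1 (p : V) : V := iota (fun x => exists y, p = opair x y).
Definition pr2 (p : V) : V := iota (fun y => exists x, p = opair x y).
Lemma pr1E x y : pr1 (opair x y) = x.
Proof. by apply: iota_eq => [|z [w /opair_inj []]]; first by exists y. Qed.
Lemma pr2E x y : pr2 (opair x y) = y.
Proof. by apply: iota_eq => [|z [w /opair_inj []]]; first by exists x. Qed.
Lemma D_pr1 : F1 pr1. Proof. unfold pr1; definability. Qed.
Lemma D_pr2 : F1 pr2. Proof. unfold pr2; definability. Qed.

Definition two : V := succ (succ empset).
Lemma nat_two : is_nat two.
Proof. by apply: nat_succ; apply: nat_succ; exact: nat_empset. Qed.
Lemma twoP i : i ∈ two <-> i = empset \/ i = succ empset.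
Proof. rewrite /two !succP; split=> [[[/empsetP//|]|]|[]]; auto. Qed.

Definition binsig : V := opair empset two.
Lemma binsig_rel : rel_sig binsig two.
Proof. by apply/rel_sigE; split; [exact: nat_two|]. Qed.
Lemma rel_sig_bin n : rel_sig binsig n -> n = two.
Proof. by move=> /rel_sigE [_ /opair_inj [_ ->]]. Qed.
Lemma fun_sig_bin n : ~ fun_sig binsig n.
Proof. by move=> /fun_sigE [_ /opair_inj [/empset_ne_succ]]. Qed.

Definition mk2 (x y : V) : V := upair (opair empset x) (opair (succ empset) y).
Lemma app_mk2 x y i z : app (mk2 x y) i z <-> (i = empset /\ z = x) \/ (i = succ empset /\ z = y).
Proof. by rewrite appE /set_ext upairP !opair_inj. Qed.
Lemma mk2_tuple D x y : x ∈ D -> y ∈ D -> is_tuple two D (mk2 x y).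
Proof.
move=> Hx Hy; split; last by move=> i z /app_mk2 [[_ ->]|[_ ->]].
split=> [p /upairP [->|->]|i /twoP [->|->]].
- by exists empset, x; rewrite is_opairE; split=> //; apply/twoP; left.
- by exists (succ empset), y; rewrite is_opairE; split=> //; apply/twoP; right.
- exists x; split=> [|z]; rewrite app_mk2; first by left.
  by move=> [[_ ->]|[/empset_ne_succ]].
- exists y; split=> [|z]; rewrite app_mk2; first by right.
  by move=> [[/(fun E => eq_sym E) /empset_ne_succ]|[_ ->]].
Qed.
Lemma mk2_inj x y x' y' : mk2 x y = mk2 x' y' -> x = x' /\ y = y'.
Proof.
move=> /upair_inj [[/opair_inj [_ ->] /opair_inj [_ ->]] //|[/opair_inj [/empset_ne_succ []]]].
Qed.
Lemma D_mk2 : F2 mk2. Proof. unfold mk2; definability. Qed.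

Definition code (d X Y v : V) : V := opair d (opair X (opair Y v)).
Lemma code_inj d X Y v d' X' Y' v' : code d X Y v = code d' X' Y' v' ->
  d = d' /\ X = X' /\ Y = Y' /\ v = v'.
Proof. by rewrite /code !opair_inj. Qed.

Definition rel (I s x y : V) : Prop := mk2 x y ∈ ap I s.

Lemma lang_const Z : is_lang (lam (fun _ => binsig) Z).
Proof.
have D : F1 (fun _ : V => binsig) by definability.
split=> [|s u]; rewrite ?app_lam //; last by move=> [_ ->]; exists two; left; exact: binsig_rel.
apply: is_fun_lam => // x; split=> [[u]|Hx]; first by rewrite app_lam // => -[].
by exists binsig; rewrite app_lam.
Qed.
Lemma app_const Z s u : app (lam (fun _ => binsig) Z) s u <-> s ∈ Z /\ u = binsig.
Proof. by apply: app_lam; definability. Qed.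

End Codes.

Ltac def_known10 := first [ def_known9
 | lazymatch goal with |- DefT (fun e => pr1 _) => apply (DefT_fun1 pr1 _ D_pr1) end
 | lazymatch goal with |- DefT (fun e => pr2 _) => apply (DefT_fun1 pr2 _ D_pr2) end
 | lazymatch goal with |- DefT (fun e => mk2 _ _) => apply (DefT_fun2 mk2 _ _ D_mk2) end ].
Ltac def_known ::= def_known10.
Ltac def_unfold ::= unfold is_upair, is_opair, app, is_succ, is_empty, subset,
  class_well_order, is_fun, is_bij, is_ord, sym, cup, sing, succ, image, lam, is_theory, okint,
  sentence, has_model, rel, code.

Section OrdinalLogic.
Context {U : Universe} {HU : GBC U}.
Context (C : Cls) (tp : V -> V -> V -> V) (TV : V) (Dtp : F3 tp) (tp_in : forall b X Y, tp b X Y ∈ TV).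

(* All symbols are binary.  Each is used as a unary predicate through its diagonal; in a
   sentence [code d X Y v] the off-diagonal part of [d] moreover is the ordering. *)
Definition is_code (t phi : V) : Prop := exists d X Y v, phi = code d X Y v /\ v ∈ TV /\
  app t d binsig /\ (forall s, s ∈ X \/ s ∈ Y -> app t s binsig) /\ ctbl X Y.

Definition codes (t : V) : V := setof (is_code t).

Lemma D_is_code : R2 is_code. Proof. unfold is_code; definability. Qed.

Lemma codesP t phi : phi ∈ codes t <-> is_code t phi.
Proof.
apply: setof_spec; first by unfold is_code; definability.
exists (cartesian (symset t) (cartesian (power (symset t)) (cartesian (power (symset t)) TV))).
move=> x [d [X [Y [v [-> [Hv [Hd [HXY _]]]]]]]].
rewrite /code !pair_cartesian !powerP; split; first by apply/symsetP; exists binsig.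
split; first by move=> s Hs; apply/symsetP; exists binsig; apply: HXY; left.
split=> //; move=> s Hs; apply/symsetP; exists binsig; apply: HXY; by right.
Qed.

Lemma D_codes : F1 codes. Proof. have H : R2 is_code by exact: D_is_code. unfold codes; definability. Qed.

Definition ev (D I p X : V) : V :=
  setof (fun z => exists x s, x ∈ D /\ s ∈ X /\ rel I s x x /\ z = ap p x).

Lemma evP D I p X z : z ∈ ev D I p X <-> exists x s, x ∈ D /\ s ∈ X /\ rel I s x x /\ z = ap p x.
Proof.
apply: setof_spec; first by definability.
by exists (image (ap p) D) => y [x [s [Hx [_ [_ ->]]]]]; apply/imageP; [definability|exists x].
Qed.

Definition collapses (D I d b p : V) : Prop := is_ord b /\ is_bij p D b /\
  forall x y, x ∈ D -> y ∈ D -> x <> y -> (rel I d x y <-> ap p x ∈ ap p y).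

(** Elements on the diagonal of [d] are marked as new: [X] may not denote the singleton of such an
    element, and its collapse becomes the value missed by the embedding. The type is asserted as a
    value [v], so the logic does without connectives. *)
Definition holds (D I d X Y v : V) : Prop := exists b p, collapses D I d b p /\ C b /\
  (exists x, x ∈ D /\ rel I d x x) /\
  (forall x, x ∈ D -> rel I d x x -> ev D I p X <> sing (ap p x)) /\
  v = tp b (ev D I p X) (ev D I p Y).

(** The common core of invariance under reducts, isomorphisms and renamings: [h] and [k] are inverse
    maps between the domains, and [r] relates corresponding symbols. The second structure is
    collapsed by [k] followed by the collapse of the first. *)
Lemma holds_transfer (D I E J d X Y d' X' Y' v : V) (h k : V -> V) (r : V -> V -> Prop) : F1 k ->
  (forall x, x ∈ D -> h x ∈ E /\ k (h x) = x) ->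
  (forall y, y ∈ E -> k y ∈ D /\ h (k y) = y) ->
  r d d' ->
  (forall s, s ∈ X -> exists s', s' ∈ X' /\ r s s') -> (forall s', s' ∈ X' -> exists s, s ∈ X /\ r s s') ->
  (forall s, s ∈ Y -> exists s', s' ∈ Y' /\ r s s') -> (forall s', s' ∈ Y' -> exists s, s ∈ Y /\ r s s') ->
  (forall s s' x y, r s s' -> x ∈ D -> y ∈ D -> (rel I s x y <-> rel J s' (h x) (h y))) ->
  holds D I d X Y v -> holds E J d' X' Y' v.
Proof.
move=> Dk Hh Hk Hd HX HX' HY HY' Hr [b [p [[Ob [Hp Hc]] [Cb [[x0 [Hx0 Hx0d]] [Hne Hv]]]]]].
pose (p' := lam (fun y => ap p (k y)) E).
have Dp' : F1 (fun y => ap p (k y)) by definability.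
have p'E y : y ∈ E -> ap p' y = ap p (k y) by move=> Hy; rewrite /p' ap_lam.
have Hp' : is_bij p' E b.
  apply: bij_lam => //.
    by move=> y /Hk [Hy _]; apply: (bij_ap p D b).
    move=> y z Hy Hz E1; rewrite -(proj2 (Hk y Hy)) -(proj2 (Hk z Hz)).
    by rewrite (bij_inj p D b Hp (k y) (k z)) //; [case: (Hk y Hy)|case: (Hk z Hz)].
  move=> z Hz; case: (bij_binv p D b Hp z Hz) => H1 H2; exists (h (binv p z)).
  by case: (Hh _ H1) => H3 ->; split.
have evE A A' : (forall s, s ∈ A -> exists s', s' ∈ A' /\ r s s') ->
    (forall s', s' ∈ A' -> exists s, s ∈ A /\ r s s') -> ev E J p' A' = ev D I p A.
  move=> H1 H2; apply ext => z; rewrite !evP; split.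
    move=> [y [s' [Hy [Hs' [Hrel ->]]]]]; case: (H2 s' Hs') => s [Hs Hrs].
    case: (Hk y Hy) => Hky Ehk; exists (k y), s; do 2!split=> //; rewrite p'E //; split=> //.
    by apply/(Hr s s') => //; rewrite Ehk.
  move=> [x [s [Hx [Hs [Hrel ->]]]]]; case: (H1 s Hs) => s' [Hs' Hrs].
  case: (Hh x Hx) => Hhx Ekh; exists (h x), s'; do 2!split=> //; rewrite p'E // Ekh; split=> //.
  by apply/(Hr s s').
clearbody p'.
exists b, p'; rewrite (evE X X' HX HX') (evE Y Y' HY HY'); split; last split=> //.
  split=> //; split=> //; move=> y z Hy Hz Hyz; rewrite !p'E //.
  case: (Hk y Hy) => Hky Ey; case: (Hk z Hz) => Hkz Ez.
  rewrite -Hc //; first by move=> K; apply: Hyz; rewrite -Ey K.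
  by rewrite (Hr d d') // Ey Ez.
split.
  exists (h x0); case: (Hh x0 Hx0) => Hhx _; split=> //; by apply/(Hr d d').
split=> //; move=> y Hy Hrel; rewrite p'E //; case: (Hk y Hy) => Hky Ey.
by apply: Hne => //; apply/(Hr d d') => //; rewrite Ey.
Qed.

(** By ∈-induction on its value, an element has the same collapse under both maps. This lets all
    sentences true in one structure share a single [b] and [p]. *)
Lemma collapses_uniq D I d b p b' p' : collapses D I d b p -> collapses D I d b' p' ->
  b = b' /\ forall x, x ∈ D -> ap p x = ap p' x.
Proof.
move=> [Ob [Hp Hc]] [Ob' [Hp' Hc']].
have K : forall y x, x ∈ D -> ap p x = y -> ap p' x = y.
  apply: mem_ind; first by definability.
  move=> y IH x Hx Ey.
  have Hyb : y ∈ b by rewrite -Ey; apply: (bij_ap p D b).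
  have Hyb' : ap p' x ∈ b' by apply: (bij_ap p' D b').
  apply ext => z; split=> Hz.
    have Hzb : z ∈ b' by apply: (ord_trans b' (ap p' x)).
    case: (bij_binv p' D b' Hp' z Hzb); set w := binv p' z => Hw Ew.
    have Hwx : w <> x by move=> E; apply: (mem_irrefl z); rewrite -{2}Ew E.
    have H : ap p w ∈ y by rewrite -Ey -Hc // Hc' // Ew.
    by rewrite -Ew (IH _ H w).
  have Hzb : z ∈ b by apply: (ord_trans b y).
  case: (bij_binv p D b Hp z Hzb); set w := binv p z => Hw Ew.
  have Hwx : w <> x by move=> E; apply: (mem_irrefl y); rewrite -{1}Ey -E Ew.
  have <- : ap p' w = z by apply: IH.
  by rewrite -Hc' // Hc // Ew Ey.
have K2 x : x ∈ D -> ap p x = ap p' x by move=> Hx; rewrite (K (ap p x) x).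
split=> //; apply ext => z; split=> Hz.
  case: (bij_binv p D b Hp z Hz) => H1 <-; rewrite K2 //; exact: (bij_ap p' D b').
case: (bij_binv p' D b' Hp' z Hz) => H1 <-; rewrite -K2 //; exact: (bij_ap p D b).
Qed.

Context (L Sat : Cls)
  (HLc : forall q, L q <-> exists t, is_lang t /\ q = opair t (codes t))
  (HSat : forall q, Sat q <-> exists t D I d X Y v, is_structure (tri t D I) t /\
     is_code t (code d X Y v) /\ holds D I d X Y v /\ q = opair (tri t D I) (code d X Y v)).

Lemma app_L t S : app L t S <-> is_lang t /\ S = codes t.
Proof.
by rewrite appE HLc; split=> [[t' [H /opair_inj [-> ->]]]|[H ->]]; [|exists t].
Qed.

Lemma sentenceE t phi : sentence L t phi <-> is_lang t /\ is_code t phi.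
Proof.
split=> [[S [/app_L [Ht ->]] /codesP] //|[Ht H]].
by exists (codes t); rewrite app_L codesP.
Qed.

Lemma app_Sat t D I d X Y v : is_structure (tri t D I) t -> is_code t (code d X Y v) ->
  (app Sat (tri t D I) (code d X Y v) <-> holds D I d X Y v).
Proof.
move=> HM Hcode; rewrite appE HSat; split=> [|H]; last by exists t, D, I, d, X, Y, v.
move=> [t' [D' [I' [d' [X' [Y' [v' [_ [_ [H /opair_inj [/tri_inj [_ [-> ->]]]]]]]]]]]]].
by move=> /code_inj [-> [-> [-> ->]]].
Qed.

Lemma is_code_sub t u phi : subset t u -> is_code t phi -> is_code u phi.
Proof.
move=> H [d [X [Y [v [E [Hv [Hd [HXY Hct]]]]]]]]; exists d, X, Y, v; do 2!split=> //.
split; first exact: (app_sub _ _ _ _ H).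
by split=> // s /HXY; apply: app_sub.
Qed.

Lemma L_reduct t u M N phi : subset t u -> is_structure M u -> is_structure N t ->
  is_reduct N M -> sentence L t phi -> (app Sat M phi <-> app Sat N phi).
Proof.
move=> Hs HM HN Hred /sentenceE [Ht Hc]; case: (structE _ _ HM) => E [J EM].
case: (structE _ _ HN) => D [I EN]; rewrite EM EN in HM HN Hred *.
case/structP: (HM) => _ [_ [_ [HJ _]]]; case/structP: (HN) => _ [_ [_ [HI _]]].
case/(is_reductE t D I u E J HI HJ Hs): Hred => ED Hap; rewrite -{}ED in HM *.
have Hc' := is_code_sub t u phi Hs Hc.
case: (Hc) => d [X [Y [v [E' [_ [Hd [HXY _]]]]]]]; rewrite E' in Hc Hc' *.
rewrite !app_Sat //.
have Did : F1 (fun x : V => x) by definability.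
by split; apply: (holds_transfer _ _ _ _ _ _ _ _ _ _ _ (fun x => x) (fun x => x)
  (fun s s' => s = s' /\ app t s binsig)) => //; try (by move=> s Hs'; exists s; split=> //; split=> //; apply: HXY; auto);
  move=> s s' x y [<- Hsb] _ _; rewrite /rel Hap //; exists binsig.
Qed.

Lemma L_iso t M N h phi : is_structure M t -> is_structure N t ->
  is_iso h M N t -> sentence L t phi -> (app Sat M phi <-> app Sat N phi).
Proof.
move=> HM HN [D [I [E [J [/is_tripleE EM [/is_tripleE EN [Hh Hiso]]]]]]] /sentenceE [Ht Hc].
rewrite EM EN in HM HN *; case/structP: (HM) => _ [_ [_ [HI _]]]; case/structP: (HN) => _ [_ [_ [HJ _]]].
case: (Hc) => d [X [Y [v [E' [_ [Hd [HXY _]]]]]]]; rewrite E' in Hc *.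
rewrite !app_Sat //.
have Hrel s x y : app t s binsig -> x ∈ D -> y ∈ D -> (rel I s x y <-> rel J s (ap h x) (ap h y)).
  move=> Hs Hx Hy; have Hst : sym t s by exists binsig.
  case: (Hiso s binsig (ap I s) (ap J s) two Hs).
    exact: (ap_app I (sym t)). exact: (ap_app J (sym t)).
  move=> /(_ binsig_rel (mk2 x y) (mk2 (ap h x) (ap h y))) H _; apply: H.
    exact: mk2_tuple. by apply: mk2_tuple; apply: (bij_ap h D E).
  move=> i u w /app_mk2 [[-> ->]|[-> ->]] /app_mk2 [[E1 ->]|[E1 ->]];
    try (by case: (empset_ne_succ empset)); apply: (ap_app h D) => //; by case: Hh.
have h1 x : x ∈ D -> ap h x ∈ E /\ binv h (ap h x) = x.
  by move=> Hx; split; [apply: (bij_ap h D E)|apply: (bij_binv_ap h D E)].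
have h2 y : y ∈ E -> binv h y ∈ D /\ ap h (binv h y) = y by exact: (bij_binv h D E).
have D1 : F1 (ap h) by definability. have D2 : F1 (binv h) by definability.
split; [apply: (holds_transfer _ _ _ _ _ _ _ _ _ _ _ (ap h) (binv h) (fun s s' => s = s' /\ app t s binsig)) => //
 | apply: (holds_transfer _ _ _ _ _ _ _ _ _ _ _ (binv h) (ap h) (fun s s' => s = s' /\ app t s binsig)) => //];
  try (by move=> s Hs'; exists s; split=> //; split=> //; apply: HXY; auto).
  by move=> s s' x y [<- Hsb]; apply: Hrel.
move=> s s' x y [<- Hsb] Hx Hy; case: (h2 x Hx) => H1 H2; case: (h2 y Hy) => H3 H4.
by rewrite Hrel // H2 H4.
Qed.

Lemma L_renaming t u f : is_lang t -> is_lang u -> is_renaming f t u ->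
  exists g : V, is_bij g (sentence L t) (sentence L u) /\
    forall M N phi psi, is_structure M t -> is_structure N u -> is_renamed f M N ->
      app g phi psi -> (app Sat M phi <-> app Sat N psi).
Proof.
move=> Ht Hu [Hf Hfs].
(* The renaming moves the symbols in a code and leaves the type value alone. *)
pose (F := fun phi : V => code (ap f (pr1 phi)) (image (ap f) (pr1 (pr2 phi)))
  (image (ap f) (pr1 (pr2 (pr2 phi)))) (pr2 (pr2 (pr2 phi)))).
have Df : F1 (ap f) by definability.
have DF : F1 F by unfold F; definability.
have FE d X Y v : F (code d X Y v) = code (ap f d) (image (ap f) X) (image (ap f) Y) v.
  by rewrite /F; congr code; rewrite /code !(pr1E, pr2E).
have Hsym s : app t s binsig -> sym t s by move=> H; exists binsig.
have fapp s : app t s binsig -> app u (ap f s) binsig.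
  move=> Hs; apply/(Hfs s) => //; apply: (ap_app f (sym t)); [by case: Hf|exact: Hsym].
have finv s : app u s binsig -> app t (binv f s) binsig /\ ap f (binv f s) = s.
  move=> Hs; case: (bij_binv f _ _ Hf s) => [|H1 H2]; first by exists binsig.
  by split=> //; apply/(Hfs _ s) => //; rewrite -{2}H2; apply: (ap_app f (sym t)) => //; case: Hf.
have imgc X Y : ctbl X Y -> ctbl (image (ap f) X) (image (ap f) Y).
  move=> [g [Hg H]]; apply: (ctbl_fun _ _ (fun n => ap f (ap g n))); first by definability.
  move=> s [/imageP|/imageP] -/(_ Df) [x [Hx ->]]; case: (H x) => [|n [Hn ->]]; try tauto; by exists n.
have Fcode phi : is_code t phi -> is_code u (F phi).
  move=> [d [X [Y [v [-> [Hv [Hd [HXY Hct]]]]]]]]; rewrite FE.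
  exists (ap f d), (image (ap f) X), (image (ap f) Y), v; do 2!split=> //; split; first exact: fapp.
  split; last exact: imgc.
  by move=> s [/imageP|/imageP] -/(_ Df) [x [Hx ->]]; apply: fapp; apply: HXY; auto.
have img_inj X X' : (forall s, s ∈ X -> app t s binsig) -> (forall s, s ∈ X' -> app t s binsig) ->
    image (ap f) X = image (ap f) X' -> X = X'.
  move=> H1 H2 E.
  have K A B : (forall s, s ∈ A -> app t s binsig) -> (forall s, s ∈ B -> app t s binsig) ->
      image (ap f) A = image (ap f) B -> forall s, s ∈ A -> s ∈ B.
    move=> HA HB EAB s Hs; have : ap f s ∈ image (ap f) B by rewrite -EAB; apply/imageP => //; exists s.
    move=> /imageP -/(_ Df) [s' [Hs' E']].
    by rewrite (bij_inj f _ _ Hf s s') //; apply: Hsym; auto.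
  by apply ext => s; split; apply: K.
exists (lam F (codes t)); split.
{ apply: bij_lam => //.
  - by move=> phi; rewrite sentenceE codesP; tauto.
  - by move=> phi /sentenceE [_ H]; apply/sentenceE; split=> //; apply: Fcode.
  - move=> phi psi /sentenceE [_ [d [X [Y [v [-> [_ [Hd [HXY _]]]]]]]]].
    move=> /sentenceE [_ [d' [X' [Y' [v' [-> [_ [Hd' [HXY' _]]]]]]]]].
    rewrite !FE => /code_inj [E1 [E2 [E3 ->]]].
    rewrite (bij_inj f _ _ Hf d d') //; try exact: Hsym.
    have EX : X = X'.
      by apply: (img_inj X X' _ _ E2) => s Hs; [apply: HXY; left|apply: HXY'; left].
    have EY : Y = Y'.
      by apply: (img_inj Y Y' _ _ E3) => s Hs; [apply: HXY; right|apply: HXY'; right].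
    by rewrite EX EY.
  - move=> psi /sentenceE [_ [d [X [Y [v [-> [Hv [Hd [HXY Hct]]]]]]]]].
    have Db : F1 (binv f) by definability.
    have iE Z : (forall s, s ∈ Z -> app u s binsig) -> image (ap f) (image (binv f) Z) = Z.
      move=> HZ; apply ext => s; rewrite imageP //; split.
        by move=> [x [/imageP -/(_ Db) [y [Hy ->]] ->]]; rewrite (proj2 (finv y (HZ y Hy))).
      move=> Hs; exists (binv f s); rewrite (proj2 (finv s (HZ s Hs))); split=> //.
      by apply/imageP => //; exists s.
    exists (code (binv f d) (image (binv f) X) (image (binv f) Y) v); rewrite FE !iE; try by auto.
    split; last by rewrite (proj2 (finv d Hd)).
    apply/sentenceE; split=> //; exists (binv f d), (image (binv f) X), (image (binv f) Y), v.
    do 2!split=> //; split; first by case: (finv d Hd).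
    split.
      by move=> s [/imageP|/imageP] -/(_ Db) [x [Hx ->]]; refine (proj1 (finv x _)); apply: HXY; auto.
    case: Hct => g [Hg H]; apply: (ctbl_fun _ _ (fun n => binv f (ap g n))); first by definability.
    move=> s [/imageP|/imageP] -/(_ Db) [x [Hx ->]]; case: (H x) => [|n [Hn ->]]; try tauto; by exists n. }
move=> M N phi psi HM HN Hren; rewrite app_lam // codesP => -[Hphi ->].
have HFp := Fcode phi Hphi.
case: Hren => t' [u' [D [I [J [/is_tripleE EM [/is_tripleE EN Hren]]]]]].
rewrite EM EN in HM HN *; case/structP: (HM) => Et [_ [_ [HI _]]]; case/structP: (HN) => Eu [_ [_ [HJ _]]].
rewrite -{}Et in HM HI *; rewrite -{}Eu in HN HJ *.
case: (Hphi) => d [X [Y [v [E' [_ [Hd [HXY _]]]]]]]; rewrite E' in Hphi HFp *; rewrite FE in HFp *.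
rewrite !app_Sat //.
have Did : F1 (fun x : V => x) by definability.
have Hrel s x y : app t s binsig -> (rel I s x y <-> rel J (ap f s) x y).
  move=> Hs; have Hst := Hsym s Hs; rewrite /rel.
  suff -> : ap J (ap f s) = ap I s by [].
  symmetry; apply: (app_ap J (sym u)) => //; apply/(Hren s).
    by apply: (ap_app f (sym t)) => //; case: Hf.
  exact: (ap_app I (sym t)).
have iP Z s : s ∈ image (ap f) Z <-> exists x, x ∈ Z /\ s = ap f x by apply: imageP.
split.
- apply: (holds_transfer _ _ _ _ _ _ _ _ _ _ _ (fun x => x) (fun x => x)
    (fun s s' => s' = ap f s /\ app t s binsig)) => //.
  + by move=> s Hs; exists (ap f s); split; [apply/iP; exists s|split=> //; apply: HXY; left].
  + by move=> s /iP [x [Hx ->]]; exists x; do 2!split=> //; apply: HXY; left.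
  + by move=> s Hs; exists (ap f s); split; [apply/iP; exists s|split=> //; apply: HXY; right].
  + by move=> s /iP [x [Hx ->]]; exists x; do 2!split=> //; apply: HXY; right.
  + by move=> s s' x y [-> Hs] _ _; apply: Hrel.
- apply: (holds_transfer _ _ _ _ _ _ _ _ _ _ _ (fun x => x) (fun x => x)
    (fun s' s => s' = ap f s /\ app t s binsig)) => //.
  + by move=> s /iP [x [Hx ->]]; exists x; do 2!split=> //; apply: HXY; left.
  + by move=> s Hs; exists (ap f s); split; [apply/iP; exists s|split=> //; apply: HXY; left].
  + by move=> s /iP [x [Hx ->]]; exists x; do 2!split=> //; apply: HXY; right.
  + by move=> s Hs; exists (ap f s); split; [apply/iP; exists s|split=> //; apply: HXY; right].
  + by move=> s' s x y [-> Hs] _ _; rewrite Hrel.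
Qed.

(** A sentence uses its ordering symbol and countably many others, so [cover_card] for [succ omega]
    gives some bound; foundation gives the least one. *)
Lemma L_occurrence : exists m, occurrence_number L m.
Proof.
case: (cover_card (succ omega)) => m0 [Cm0 Hm0].
have Hb0 : bounds_occurrences L m0.
  move=> t phi Ht /sentenceE [_ [d [X [Y [v [E [Hv [Hd [HXY Hct]]]]]]]]].
{ case: (sep_ex (symset t) (fun s => s = d \/ s ∈ X \/ s ∈ Y)) => [|Z HZ]; first by definability.
  have HZb s : s ∈ Z -> app t s binsig by move=> /HZ [_ [->//|H]]; apply: HXY.
  have HZ' s : s = d \/ s ∈ X \/ s ∈ Y -> s ∈ Z.
    move=> H; apply/HZ; split=> //; apply/symsetP; exists binsig.
    by case: H => [->//|H]; apply: HXY.
  have DB : F1 (fun _ : V => binsig) by definability.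
  exists (lam (fun _ => binsig) Z); split; [|split].
  - by move=> p /lamP -/(_ DB) [s [Hs ->]]; have /appE := HZb s Hs.
  - case: (Hct) => g [Hg H].
    (* The index [omega] is spent on [d], the finite ones on the enumeration of [X] and [Y]. *)
    apply: (Hm0 _ (fun n => ifp (n = omega) (opair d binsig) (opair (ap g n) binsig))); first by definability.
    move=> z /lamP -/(_ DB) [s [/HZ [_ Hs] ->]]; case: Hs => [->|Hs].
      by exists omega; rewrite ifpT // succP; split=> //; right.
    case: (H s Hs) => n [Hn ->]; exists n; rewrite ifpF ?succP.
    by move=> En; apply: (mem_irrefl omega); rewrite -{1}En.
    by split=> //; left.
  - apply/sentenceE; split; first exact: lang_const.
    exists d, X, Y, v; do 2!split=> //; split; first by apply/app_const; split=> //; apply: HZ'; left.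
    by split=> // s Hs; apply/app_const; split=> //; apply: HZ'; right. }
case: (mem_min (fun m => is_cardinal m /\ bounds_occurrences L m)); [|by exists m0|].
  by unfold bounds_occurrences; definability.
by move=> m [[H1 H2] H3]; exists m; do 2!split=> //; move=> k Hk Ck Hbk; apply: (H3 k Hk).
Qed.

Lemma L_logic : is_logic L Sat.
Proof.
split.
- split=> [q /HLc [t [Ht ->]]|t Ht]; first by exists t, (codes t); rewrite is_opairE.
  by exists (codes t); split=> [|S]; rewrite app_L // => -[].
- move=> M phi /appE /HSat [t [D [I [d [X [Y [v [HM [Hc [_ /opair_inj [-> ->]]]]]]]]]]].
  by exists t; split=> //; apply/sentenceE; split=> //; case/structP: HM => _ [].
- move=> q /HSat [t [D [I [d [X [Y [v [_ [_ [_ ->]]]]]]]]]].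
  by exists (tri t D I), (code d X Y v); rewrite is_opairE.
- by move=> t u phi Ht Hu Hs /sentenceE [_ H]; apply/sentenceE; split=> //; apply: (is_code_sub t).
- exact: L_reduct.
- by move=> t M N h phi; apply: L_iso.
- exact: L_renaming.
- exact: L_occurrence.
Qed.

End OrdinalLogic.

(** * The theory at a weak compactness cardinal, and its models *)

Section Backward.
Context {U : Universe} {HU : GBC U}.
Context (C A : Cls) (HC : club C) (HA : is_fun A is_ord) (HAs : forall a s, app A a s -> subset s a).
Context (tp : V -> V -> V -> V) (TV : V) (Dtp : F3 tp) (tp_in : forall b X Y, tp b X Y ∈ TV)
  (tp_eq : forall b X Y b' X' Y', tp b X Y = tp b' X' Y' -> same_type C A b X Y b' X' Y').
Context (L Sat : Cls)
  (HLc : forall q, L q <-> exists t, is_lang t /\ q = opair t (codes TV t))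
  (HSat : forall q, Sat q <-> exists t D I d X Y v, is_structure (tri t D I) t /\
     is_code TV t (code d X Y v) /\ holds C tp D I d X Y v /\ q = opair (tri t D I) (code d X Y v)).

Definition pairs (i : V) : V := setof (fun q => exists X Y,
  subset X i /\ subset Y i /\ ctbl X Y /\ q = opair X Y).
Lemma pairsP i q : q ∈ pairs i <-> exists X Y, subset X i /\ subset Y i /\ ctbl X Y /\ q = opair X Y.
Proof.
apply: setof_spec; first by definability.
exists (cartesian (power i) (power i)) => x [X [Y [HX [HY [_ ->]]]]].
by rewrite pair_cartesian !powerP.
Qed.
Lemma D_pairs : F1 pairs. Proof. unfold pairs; definability. Qed.

Context (k : V) (Ck : C k) (Lk : is_limit k) (Kk : is_cardinal k).
Let Ok : is_ord k. Proof. by case: Lk. Qed.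

(** An ordinal below [k] is a name for an element; the symbol [k] is the ordering. *)
Let t := lam (fun _ => binsig) (succ k).
(** Boundedness in [k] keeps the number of pairs at [k], which is closed under the codes of
    [pairs i] for [i] below it. *)
Let Dk (X Y : V) : Prop := exists i, i ∈ k /\ subset X i /\ subset Y i /\ ctbl X Y.
Context (T : V) (HT : forall phi, phi ∈ T <-> exists X Y, Dk X Y /\ phi = code k X Y (tp k X Y)).

Let tapp s u : app t s u <-> s ∈ succ k /\ u = binsig.
Proof. exact: app_const. Qed.

Let Dk_sub X Y s : Dk X Y -> s ∈ X \/ s ∈ Y -> s ∈ k.
Proof. by move=> [i [Hi [HX [HY _]]]] [/HX|/HY] Hs; apply: (ord_trans k i). Qed.

Let Dk_sing x : x ∈ k -> Dk (sing x) (sing x).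
Proof.
move=> Hx; exists (succ x); split; first exact: limit_succ.
split; first by move=> s /singP ->; apply/succP; right.
split; first by move=> s /singP ->; apply/succP; right.
exact: ctbl_sing.
Qed.

Let T_code X Y : Dk X Y -> is_code TV t (code k X Y (tp k X Y)).
Proof.
move=> H; exists k, X, Y, (tp k X Y); do 2!split=> //.
split; first by apply/tapp; split=> //; apply/succP; right.
split; last by case: H => i [_ [_ [_]]].
move=> s Hs; apply/tapp; split=> //; apply/succP; left; exact: (Dk_sub X Y).
Qed.

Lemma T_theory : is_theory L t T.
Proof.
move=> phi /HT [X [Y [H ->]]]; apply/(sentenceE TV L HLc); split; first exact: lang_const.
exact: T_code.
Qed.

(** At most [k] sentences, since [G] codes the bounded pairs below [k]; at least [k], through the
    singletons. *)
Lemma T_card G : F1 G -> (forall x y, (exists i, is_ord i /\ x ∈ pairs i) ->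
    (exists i, is_ord i /\ y ∈ pairs i) -> G x = G y -> x = y) ->
  (forall i q, i ∈ k -> q ∈ pairs i -> G q ∈ k) -> has_card T k.
Proof.
move=> DG Gi Gk.
have pE X Y v : pr1 (pr2 (code k X Y v)) = X /\ pr1 (pr2 (pr2 (code k X Y v))) = Y.
  by rewrite /code !(pr2E, pr1E).
have pin i X Y : i ∈ k -> subset X i -> subset Y i -> ctbl X Y -> opair X Y ∈ pairs i.
  by move=> Hi HX HY Hc; apply/pairsP; exists X, Y.
apply: (card_of_inj _ _ (fun phi => G (opair (pr1 (pr2 phi)) (pr1 (pr2 (pr2 phi)))))
  (fun x => code k (sing x) (sing x) (tp k (sing x) (sing x)))) => //; try by definability.
- move=> phi /HT [X [Y [[i [Hi [HX [HY Hc]]]] ->]]]; case: (pE X Y (tp k X Y)) => -> ->.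
  by apply: (Gk i) => //; apply: pin.
- move=> phi psi /HT [X [Y [[i [Hi [HX [HY Hc]]]] ->]]] /HT [X' [Y' [[i' [Hi' [HX' [HY' Hc']]]] ->]]].
  case: (pE X Y (tp k X Y)) => -> ->; case: (pE X' Y' (tp k X' Y')) => -> -> E.
  have : opair X Y = opair X' Y'.
    apply: Gi => //; [exists i|exists i'].
      by split; [apply: (ord_mem k)|apply: pin].
    by split; [apply: (ord_mem k)|apply: pin].
  by move=> /opair_inj [-> ->].
- by move=> x Hx; apply/HT; exists (sing x), (sing x); split=> //; apply: Dk_sing.
- by move=> x y _ _ /code_inj [_ [/sing_inj]].
Qed.

Lemma small_model T0 : subset T0 T -> card_lt T0 k -> has_model Sat t T0.
Proof.
move=> HT0 [l [Hl [_ Hcard]]].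
have [x0 [Hx0 Hfree]] : exists x0, x0 ∈ k /\ forall phi, phi ∈ T0 -> pr1 (pr2 phi) <> sing x0.
  apply: NNPP => K.
  have Hall x : x ∈ k -> exists phi, phi ∈ T0 /\ pr1 (pr2 phi) = sing x.
    move=> Hx; apply: NNPP => K'; apply: K; exists x; split=> // phi Hphi E.
    by apply: K'; exists phi.
  pose (q := fun x : V => W_least (fun phi => phi ∈ T0 /\ pr1 (pr2 phi) = sing x)).
  have Dq : F1 q by unfold q; definability.
  have qP x : x ∈ k -> q x ∈ T0 /\ pr1 (pr2 (q x)) = sing x.
    by move=> /Hall H; apply: (W_least_spec (fun phi => phi ∈ T0 /\ pr1 (pr2 phi) = sing x)) => //; definability.
  clearbody q.
  case/equinumP: Hcard => B [DB [B1 [B2 _]]].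
  apply: (card_no_inj k l (fun x => B (q x))) => //; first by definability.
    by move=> x /qP [/B1].
  move=> x y /qP [Hq1 Hq2] /qP [Hq3 Hq4] E; apply: sing_inj.
  by rewrite -Hq2 -Hq4 (B2 _ _ Hq1 Hq3 E).
(* The symbol [k] is ∈ off the diagonal and marks [x0] on it; a symbol [s] below [k] holds only of
   the pair [(s, s)]. *)
pose (F := fun s : V => setof (fun w => exists x y, x ∈ k /\ y ∈ k /\ w = mk2 x y /\
  ((s = k /\ (x ∈ y \/ (x = y /\ x = x0))) \/ (s <> k /\ x = s /\ y = s)))).
have DF : F1 F by unfold F; definability.
have FP s w : w ∈ F s <-> exists x y, x ∈ k /\ y ∈ k /\ w = mk2 x y /\
  ((s = k /\ (x ∈ y \/ (x = y /\ x = x0))) \/ (s <> k /\ x = s /\ y = s)).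
  apply: setof_spec; first by definability.
  exists (image (fun p => mk2 (pr1 p) (pr2 p)) (cartesian k k)) => z [x [y [Hx [Hy [-> _]]]]].
  apply/imageP; first by definability.
  by exists (opair x y); rewrite pair_cartesian pr1E pr2E.
clearbody F.
have FE s x y : mk2 x y ∈ F s <-> x ∈ k /\ y ∈ k /\
  ((s = k /\ (x ∈ y \/ (x = y /\ x = x0))) \/ (s <> k /\ x = s /\ y = s)).
  rewrite FP; split=> [[x' [y' [Hx [Hy [/mk2_inj [-> ->] H]]]]] //|[Hx [Hy H]]].
  by exists x, y.
pose (I := lam F (symset t)).
have HM : is_structure (tri t k I) t.
  apply: mkstr => //; [exact: lang_const|by exists x0|].
  move=> s u /tapp [_ ->] n; split=> [/rel_sig_bin -> v /FP [x [y [Hx [Hy [-> _]]]]]|/fun_sig_bin //].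
  exact: mk2_tuple.
have relE s x y : s ∈ succ k -> rel I s x y <-> mk2 x y ∈ F s.
  move=> Hs; rewrite /rel /I ap_lam //; apply/symsetP; exists binsig; exact/tapp.
clearbody I.
have Did : F1 (fun x : V => x) by definability.
pose (p := lam (fun x => x) k).
have pE x : x ∈ k -> ap p x = x by move=> Hx; rewrite /p ap_lam.
have Hp : is_bij p k k.
  by apply: bij_lam => // y Hy; exists y.
clearbody p.
have ksucc : k ∈ succ k by apply/succP; right.
have Hnk x : x ∈ k -> x <> k by move=> Hx E; apply: (mem_irrefl k); rewrite -{1}E.
have evE X : (forall s, s ∈ X -> s ∈ k) -> ev k I p X = X.
  move=> HX; apply ext => z; rewrite evP; split.
    move=> [x [s [Hx [Hs [Hrel ->]]]]]; rewrite pE //; move: Hrel.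
    rewrite relE ?FE; first by apply/succP; left; apply: HX.
    move=> [_ [_ [[E _]|[_ [-> _]]]]] //; by case: (Hnk s (HX s Hs)).
  move=> Hz; have Hzk := HX z Hz; exists z, z; rewrite pE //; do 2!split=> //; split=> //.
  rewrite relE ?FE; first by apply/succP; left.
  by do 2!split=> //; right; split=> //; apply: Hnk.
have reld x : rel I k x x <-> x = x0.
  rewrite relE // FE; split=> [[_ [_ [[_ [/mem_irrefl []|[_ ->]]]|[[] ]]]] //|->].
  by do 2!split=> //; left; split=> //; right.
exists (tri t k I); split=> // phi Hphi; case/HT: (HT0 _ Hphi) => X [Y [HD E]].
have Hne : X <> sing x0 by move=> EX; apply: (Hfree phi Hphi); rewrite E /code pr2E pr1E.
rewrite E; apply/(app_Sat C tp TV Sat HSat) => //; first exact: T_code.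
have EX : ev k I p X = X by apply: evE => s Hs; apply: (Dk_sub X Y) => //; left.
have EY : ev k I p Y = Y by apply: evE => s Hs; apply: (Dk_sub X Y) => //; right.
exists k, p; rewrite EX EY; split.
  split=> //; split=> // x y Hx Hy Hxy; rewrite relE // FE !pE //.
  split=> [[_ [_ [[_ [//|[E' _]]]|[[]]]]] //|H]; do 2!split=> //; left; split=> //; by left.
split=> //; split; first by exists x0; rewrite reld.
by split=> // x Hx /reld ->; rewrite pE.
Qed.

(** [b] is the order type of the model, [j x] the collapse of the element denoted by [x], and the
    missed value the collapse of a marked element. *)
Lemma model_subtle : (forall i, i ∈ k -> exists c, C c /\ c ∈ k /\ i ∈ c) -> has_model Sat t T ->
  exists a c s u, C a /\ C c /\ a ∈ c /\ app A a s /\ app A c u /\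
    forall x, x ∈ s <-> x ∈ u /\ x ∈ a.
Proof.
move=> LCk [M [HM Hsat]]; case: (structE _ _ HM) => D [I EM]; rewrite EM in HM Hsat.
have Hh X Y : Dk X Y -> holds C tp D I k X Y (tp k X Y).
  move=> H; apply: (proj1 (app_Sat C tp TV Sat HSat t D I k X Y _ HM (T_code X Y H))).
  by apply: Hsat; apply/HT; exists X, Y.
have H0 : empset ∈ k by exact: limit_empset.
case: (Hh _ _ (Dk_sing empset H0)) => b [p [Hcol [Cb [[x0 [Hx0 Hx0d]] _]]]].
(* Uniqueness of the collapse replaces the witnesses of each sentence by the fixed [b] and [p]. *)
have {}Hh X Y : Dk X Y -> tp k X Y = tp b (ev D I p X) (ev D I p Y) /\ ev D I p X <> sing (ap p x0).
  move=> /Hh [b' [p' [Hcol' [_ [_ [Hne Hv]]]]]].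
  case: (collapses_uniq D I k b p b' p' Hcol Hcol') => Eb Ep.
  have evE Z : ev D I p' Z = ev D I p Z.
    apply ext => z; rewrite !evP.
    by split=> -[x [s [Hx [Hs [Hr ->]]]]]; exists x, s; rewrite Ep.
  rewrite Hv -Eb !evE; split=> //; rewrite Ep // -evE; exact: Hne.
case: (Hcol) => Ob [Hp _].
(* The singleton clause of the type ensures that each name denotes exactly one element. *)
pose (j := fun x : V => iota (fun z => ev D I p (sing x) = sing z)).
have Dj : F1 j by unfold j, ev; definability.
have jE x : x ∈ k -> ev D I p (sing x) = sing (j x).
  move=> Hx; apply: (iota_spec (fun z => ev D I p (sing x) = sing z)).
  case: (Hh _ _ (Dk_sing x Hx)) => /tp_eq [[H _] _] _.
  case: H => [|z Hz]; first by exists x.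
  by exists z; split=> // z'; rewrite Hz => /sing_inj.
clearbody j.
have evsub X z : z ∈ ev D I p X -> z ∈ b.
  by move=> /evP [x [s [Hx [_ [_ ->]]]]]; apply: (bij_ap p D b).
have evimg X : (forall s, s ∈ X -> s ∈ k) -> ev D I p X = image j X.
  move=> HX; apply ext => z; rewrite imageP //; split.
    move=> /evP [x [s [Hx [Hs [Hr ->]]]]]; exists s; split=> //; apply/singP; rewrite -jE; first exact: HX.
    by apply/evP; exists x, s; rewrite singP.
  move=> [s [Hs ->]]; have : j s ∈ ev D I p (sing s) by rewrite jE ?singP //; apply: HX.
  by move=> /evP [x [s' [Hx [/singP -> [Hr ->]]]]]; apply/evP; exists x, s.
apply: (embedding_subtle C A HC HA HAs tp tp_eq k b (ap p x0) j Dj Ck Lk LCk Cb).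
- by move=> x Hx; apply: (evsub (sing x)); rewrite jE // singP.
- exact: (bij_ap p D b).
- by move=> x Hx E; case: (Hh _ _ (Dk_sing x Hx)) => _; rewrite jE // E.
- move=> i X Y Hi HX HY Hc.
  have HD : Dk X Y by exists i.
  case: (Hh X Y HD) => -> _; rewrite !evimg // => s Hs; apply: (Dk_sub X Y) => //; auto.
Qed.

End Backward.

(** * Compactness of every logic implies subtlety; the equivalence *)

Section Main.
Context {U : Universe} {HU : GBC U}.

Lemma wcc_subtle : (forall L Sat : Cls, is_logic L Sat ->
  exists S : Cls, stationary S /\ forall k : V, S k -> weak_compactness_cardinal L Sat k) ->
  Ord_subtle.
Proof.
move=> Hlog C A HC HA HAs.
case: (types_exist C A) => tp [TV [Dtp [tp_in tp_eq]]].
have DC : F1 (codes TV) by exact: D_codes.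
case: (comprehend (fun q => exists t, is_lang t /\ q = opair t (codes TV t))) => [|L HL]; first by definability.
case: (comprehend (fun q => exists t D I d X Y v, is_structure (tri t D I) t /\
     is_code TV t (code d X Y v) /\ holds C tp D I d X Y v /\
     q = opair (tri t D I) (code d X Y v))) => [|Sat HSat].
  by unfold is_code, holds, collapses, ev; definability.
case: (Hlog L Sat) => [|S [[HSo HS] Hw]]; first exact: (L_logic C tp TV L Sat HL HSat).
have DP : F1 pairs by exact: D_pairs.
case: (enumerate pairs DP) => G [DG [GO Gi]].
(* Closure under the codes of bounded pairs gives the theory size [k]; stationarity then provides a
   weak compactness cardinal [k] with this closure. *)
case: (club_closed C (fun i => image G (pairs i)) HC) => [|K [HK KP]]; first by definability.
case: (HS K HK) => k [Kk Sk]; case: (KP k Kk) => Ck [Lk [Hcl LCk]].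
case: (Hw k Sk) => Cardk Hwk.
pose (T := setof (fun phi => exists X Y, (exists i, i ∈ k /\ subset X i /\ subset Y i /\ ctbl X Y) /\
  phi = code k X Y (tp k X Y))).
have HT phi : phi ∈ T <-> exists X Y, (exists i, i ∈ k /\ subset X i /\ subset Y i /\ ctbl X Y) /\
  phi = code k X Y (tp k X Y).
  apply: setof_spec; first by definability.
  exists (cartesian (sing k) (cartesian (power k) (cartesian (power k) TV))).
  move=> x [X [Y [[i [Hi [HX [HY _]]]] ->]]].
  have Hs s : s ∈ i -> s ∈ k by move=> Hs; apply: (ord_trans k i) => //; case: Lk.
  rewrite /code !pair_cartesian !powerP singP; split=> //; split; first by move=> s /HX /Hs.
  by split=> // s /HY /Hs.
clearbody T.
apply: (model_subtle C A HC HA HAs tp TV tp_in tp_eq Sat HSat k Ck Lk T HT LCk).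
apply: Hwk.
- exact: lang_const.
- exact: (T_theory tp TV tp_in L HL k Lk T HT).
- apply: (T_card tp Dtp k Lk Cardk T HT G DG) => //.
  by move=> i q Hi Hq; apply: (Hcl i) => //; apply/imageP => //; exists q.
- move=> T0; exact: (small_model C tp TV tp_in Sat HSat k Ck Lk Cardk T HT).
Qed.

End Main.

Theorem theorem5p3 (U : Universe) (HU : GBC U) :
  Ord_subtle <->
  (forall L Sat : Cls, is_logic L Sat ->
     exists S : Cls, stationary S /\
       forall k : V, S k -> weak_compactness_cardinal L Sat k).
Proof.
split; last exact: wcc_subtle.
by move=> Hs L Sat HL; apply: subtle_wcc.
Qed.
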